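(* Let $l>0$ and $b\in\mathbb{R}$ with $|b|<l$, let $Q$, $S_N$, $\Pi_N$, $\xi_N$, $G(\xi_N)$, $X$ and $\mathcal{G}$ be as in the context, with $\alpha:Q\to[0,\infty)$ continuous, and set $$\mathcal{G}^*=\sup_{y\in X}\mathcal{G}(y).$$ Then $G(\xi_N)\to\mathcal{G}^*$ almost surely as $N\to\infty$. Moreover, for every $\delta>0$ there are constants $c,C>0$ such that $$P\bigl(|G(\xi_N)-\mathcal{G}^*|>\delta\bigr)<Ce^{-cN}\quad\text{for all }N\in\mathbb{N}.$$
   Context: Inhomogeneous last passage percolation. Fix $l>0$ and $b\in\mathbb{R}$ with $|b|<l$, and let $Q=\{(x,y)\in\mathbb{R}^2: 0\le x\le l,\ |y|\le x,\ |b-y|\le l-x\}$. This is the closed rectangle with sides of slope $\pm1$ having $(0,0)$ and $(l,b)$ as opposite vertices. Let $\widetilde{\mathbb{Z}}^2=\{(x,y)\in\mathbb{Z}^2: x+y\in 2\mathbb{Z}\}$, and for $N\in\mathbb{N}$ let $S_N=Q\cap\frac1N\widetilde{\mathbb{Z}}^2$. Let $\alpha:Q\to[0,\infty)$ be continuous. For each $N$, let $\xi_N=(\xi_p)_{p\in S_N}$ be independent random variables with $\xi_p$ distributed as $\frac{\alpha(p)}{N}E_p$, where $E_p$ is exponential with mean $1$. $\Pi_N$ is the set of oriented lattice paths $\pi=(p_0,\dots,p_k)$ with $p_0=(0,0)$, $p_i\in S_N$, $p_i-p_{i-1}=\frac1N(1,\pm1)$ for each $i$, and $p_k$ the rightmost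 point of $S_N$. For $\pi\in\Pi_N$, define $\xi_N\cdot\pi=\sum_{p\in\pi}\xi_p$. Let $G(\xi_N)=\max_{\pi\in\Pi_N}\xi_N\cdot\pi$. Let $\gamma(w)=1+\sqrt{1-w^2}$ for $|w|\le1$. Let $X$ be the set of functions $y:[0,l]\to\mathbb{R}$ that are Lipschitz with constant $1$ and satisfy $y(0)=0$ and $y(l)=b$. For $y\in X$, define $$\mathcal{G}(y)=\int_0^l\alpha\bigl(x,y(x)\bigr)\,\gamma\bigl(\dot y(x)\bigr)\,dx,$$ where $\dot y=dy/dx$, which exists almost everywhere. *)

(* Defs.v *)
From HB Require Import structures.
From mathcomp Require Import all_boot all_order all_algebra.
From mathcomp Require Import all_classical all_reals all_analysis.
Set Implicit Arguments. Unset Strict Implicit. Unset Printing Implicit Defensive.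
Import Order.TTheory GRing.Theory Num.Theory.
Import numFieldNormedType.Exports.
Local Open Scope classical_set_scope.
Local Open Scope ring_scope.

Section LPP.
Context {R : realType}.

(* The closed rectangle Q with opposite vertices (0,0) and (l,b). *)
Definition Qrect (l b : R) : set (R * R) :=
  [set p | [/\ 0 <= p.1 <= l, `|p.2| <= p.1 & `|b - p.2| <= l - p.1]].

Definition SN (l b : R) (N : nat) : set (R * R) :=
  [set p | Qrect l b p /\
     exists i j : int, (2 %| (i + j))%Z /\ p = (i%:~R / N%:R, j%:~R / N%:R)].

(* the rightmost point of S_N (it is unique) *)
Definition rightmost (l b : R) (N : nat) (p : R * R) : Prop :=
  SN l b N p /\ forall q, SN l b N q -> q.1 <= p.1.

Definition lstep (N : nat) : rel (R * R) := fun p q =>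
  (q.1 - p.1 == N%:R^-1) && ((q.2 - p.2 == N%:R^-1) || (q.2 - p.2 == - N%:R^-1)).

(* pi = [p_1; ...; p_k]; the full path is p_0 :: pi with p_0 = (0,0). *)
Definition is_lpath (l b : R) (N : nat) (pi : seq (R * R)) : Prop :=
  [/\ path (lstep N) (0, 0) pi,
      (forall q, q \in pi -> SN l b N q) &
      rightmost l b N (last (0, 0) pi)].

Definition LPP (l b : R) (N : nat) (xi : R * R -> R) : R :=
  sup [set (\sum_(p <- (0, 0) :: pi) xi p) | pi in [set pi | is_lpath l b N pi]].

Definition gammaf (w : R) : R := 1 + Num.sqrt (1 - w ^+ 2).

Definition Xset (l b : R) : set (R -> R) :=
  [set y | [/\ y 0 = 0, y l = b &
     forall x1 x2, x1 \in `[0, l] -> x2 \in `[0, l] -> `|y x1 - y x2| <= `|x1 - x2| ]].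

Definition calG (l : R) (alpha : R * R -> R) (y : R -> R) : R :=
  fine (\int[lebesgue_measure]_(x in `[0%R, l]%classic) (alpha (x, y x) * gammaf (derive1 y x))%:E)%E.

End LPP.

Definition distributed_as_scaled_exp {d} {T : measurableType d} {R : realType}
    (P : probability T R) (X : T -> R) (c : R) : Prop :=
  forall A : set R, measurable A ->
    P (X @^-1` A) = exponential_prob (1 : R) ((fun x => c * x) @^-1` A).

Definition mutually_independent {d} {T : measurableType d} {R : realType}
    (P : probability T R) {I : eqType} (D : set I) (X : I -> T -> R) : Prop :=
  forall s : seq I, uniq s -> (forall i, i \in s -> D i) ->
  forall B : I -> set R, (forall i, measurable (B i)) ->
    fine (P [set w | forall i, i \in s -> B i (X i w)]) =
    \prod_(i <- s) fine (P (X i @^-1` B i)).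

(* Main.v *)
Require Import Defs.
From HB Require Import structures.
From mathcomp Require Import all_boot all_order all_algebra.
From mathcomp Require Import all_classical all_reals all_analysis.
From mathcomp Require Import measurable_realfun ring lra zify.
Set Implicit Arguments. Unset Strict Implicit. Unset Printing Implicit Defensive.
Import Order.TTheory GRing.Theory Num.Theory.
Import numFieldNormedType.Exports.
Local Open Scope classical_set_scope.
Local Open Scope ring_scope.

(* On the lattice of coordinates [u = (x + y) / 2], [v = (x - y) / 2] the set [S_N] is a grid
   [{0..m} x {0..n}], and the weights are [alpha / N] times i.i.d. exponential variables of mean 1
   (created on an extended probability space at the sites where [alpha] vanishes).

   For homogeneous weights the passage time from the origin to [(m, n)] is compared with a
   stationary model, in which the weights on the two axes are rescaled to the rates [1 - rho] and
   [rho].  Burke's theorem makes the increments of the stationary model along any row independent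
   and exponential, so that Chernoff bounds give exponential concentration around
   [m / (1 - rho) + n / rho].  The homogeneous passage time is at most the stationary one, whose
   speed for the optimal [rho] is [(sqrt m + sqrt n) ^ 2]; conversely, for the optimal [rho] a
   stationary maximizer cannot stay on an axis for a macroscopic time, since it would then lose a
   macroscopic amount, and this bounds the homogeneous passage time from below.

   For continuous [alpha] a path is cut into a large but fixed number of pieces, on each of which
   [alpha] is nearly constant and the homogeneous estimate applies.  This identifies the passage
   time with a Riemann sum [sum_k alpha(x_k, y_k) * (sqrt (du_k) + sqrt (dv_k)) ^ 2].  Such a sum is
   nearly [calG] of the polygon through its nodes; conversely [calG y] is at most such a sum up to a
   small error by concavity of [gamma], applied to the Radon-Nikodym density of [y(x) + x].  Almost
   sure convergence follows by the Borel-Cantelli lemma. *)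

(** Independence is stated only through probabilities of boxes over finite index lists, so Burke's
    theorem becomes a replacement rule: in one lattice cell the bottom increment, the left increment
    and the weight are exchanged for the top and right increments, while all other variables are
    kept. The rates [1 - rho] and [rho] sum to the rate of the weight, which makes the rule exact.
    All randomness is confined to one bad event. Pieces of a path start anywhere and point in any
    direction, so the estimates must hold for all starting points, side lengths and parameters [rho]
    at once; these are polynomially many, which the exponential bound absorbs. Off this event the
    argument is deterministic. Nearly axis-parallel directions would push [rho] to 0 or 1, where the
    bounds degenerate, so side lengths are cut off from below at a small multiple of [N].
    Measurability of [derive1 y] is never assumed: integrands containing it are only compared
    pointwise with measurable bounds. The extension of the space changes no probability of an
    original event; it repairs the sites where the weight is zero and no exponential variable can be
    recovered by division. *)

(** * Exponential laws as probability measures, and their tails *)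

Section exponential_law.
Context {R : realType}.
Variables (r : R) (r0 : 0 < r).

(** The proof of [0 < r] is a parameter, so that the probability structure below, valid only for
    positive rates, can be attached to [expo]. *)
Definition expo : set R -> \bar R := let _ := r0 in exponential_prob r.

Local Notation ep := (exponential_distribution_exponential_prob__canonical__measure_function_Measure r0).
Local Notation epp := (exponential_distribution_exponential_prob__canonical__probability_measure_Probability r0).

Let expo0 : expo set0 = 0%E.
Proof. exact: (measure0 ep). Qed.

Let expo_ge0 A : (0 <= expo A)%E.
Proof. exact: (measure_ge0 ep). Qed.

Let expo_sigma_additive : semi_sigma_additive expo.
Proof.
by move=> F mF tF mU; have := @measure_semi_sigma_additive _ _ _ ep F mF tF mU.
Qed.

HB.instance Definition _ := isMeasure.Build _ _ _ expo expo0 expo_ge0 expo_sigma_additive.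

Let expoT : expo [set: R] = 1%E.
Proof. exact: (@probability_setT _ _ _ epp). Qed.

HB.instance Definition _ := @Measure_isProbability.Build _ _ R expo expoT.

Lemma expo_head (a : R) : expo `]-oo, a] = (1 - expR (- r * Num.max a 0))%:E.
Proof.
have expoE : expo `]-oo, a] = exponential_prob r (`[0, a]%classic).
  rewrite /expo /exponential_prob [LHS]integral_mkcond [RHS]integral_mkcond.
  apply: eq_integral => x _; rewrite !patchE.
  have [x0|x0] := ltP x 0; first by rewrite lt0_exponential_pdf//; do 2 case: ifP.
  by congr (if _ then _ else _); apply/idP/idP; rewrite !inE/= !in_itv/= x0.
rewrite expoE; have [a0|a0|->] := ltgtP a 0.
- by rewrite set_itv_ge ?bnd_simp -?ltNge// mulr0 expR0 subrr /exponential_prob integral_set0.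
- by rewrite exponential_prob_itv0c// EFinB.
- by rewrite set_itv1 /exponential_prob integral_set1 mulr0 expR0 subrr.
Qed.

Lemma expo_tail (a : R) : expo `]a, +oo[ = (expR (- r * Num.max a 0))%:E.
Proof.
rewrite -setCitvl probability_setC//.
transitivity (1 - expo `]-oo, a])%E => //.
by rewrite expo_head -EFinB opprB addrC subrK.
Qed.

End exponential_law.

(** * Measures on the line determined by their tails, and a weighted change of variables *)

Section measure_identities.
Context {R : realType}.

(** The rays []a, +oo[] are stable under intersection, generate the Borel sets and exhaust the line
    with finite mass. *)
Lemma measure_eq_tails (m1 m2 : {measure set R -> \bar R}) :
  (forall a : R, m1 `]a, +oo[%classic = m2 `]a, +oo[%classic) ->
  (forall a : R, (m1 `]a, +oo[%classic < +oo)%E) ->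
  forall A : set R, measurable A -> m1 A = m2 A.
Proof.
move=> m12 m1oo A mA.
apply: (measure_unique (@RGenOInfty.G R) (fun n => `]- n%:R, +oo[%classic)) => //.
- exact: RGenOInfty.measurableE.
- move=> _ _ [x ->] [y ->]; exists (Num.max x y).
  by apply/seteqP; split => z /=; rewrite !in_itv/= !andbT gt_max => /andP.
- by move=> i; exists (- i%:R).
- apply/seteqP; split => // x _; exists (Num.truncn `|x|).+1 => //=.
  rewrite in_itv/= andbT ltrNl (le_lt_trans (ler_norm _))// normrN.
  exact: truncnS_gt.
- by move=> _ [x ->].
Qed.

Import HBNNSimple.

(** The hypothesis says that the measure of density [Z] has image [c m] under [X]; it passes from
    indicators to simple functions and then to limits. It serves three ends: [Z] a density, [Z] an
    indicator (restriction of a measure), and [Z] a product of functions of variables independent of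
    [X]. *)
Lemma ge0_integral_of_events d (T : measurableType d) d' (T' : measurableType d')
    (mu : {measure set T -> \bar R}) (m : {measure set T' -> \bar R})
    (X : T -> T') (Z : T -> R) (c : R) :
  measurable_fun setT X -> measurable_fun setT Z -> (forall w, 0 <= Z w) -> 0 <= c ->
  (forall B, measurable B -> (\int[mu]_(w in X @^-1` B) (Z w)%:E = c%:E * m B)%E) ->
  forall f : T' -> \bar R, measurable_fun setT f -> (forall x, 0 <= f x)%E ->
  (\int[mu]_w (f (X w) * (Z w)%:E) = c%:E * \int[m]_x f x)%E.
Proof.
move=> mX mZ Z0 c0 H f mf f0.
have nns (g : {nnsfun T' >-> R}) :
    (\int[mu]_w ((g (X w))%:E * (Z w)%:E) = c%:E * \int[m]_x (g x)%:E)%E.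
  under eq_integral => w _.
    rewrite fimfunE -fsumEFin// ge0_mule_fsuml; last first.
      by move=> y; rewrite EFinM nnfun_muleindic_ge0.
    over.
  rewrite ge0_integral_fsum//; last 2 first.
  - move=> y; apply: emeasurable_funM; last exact/measurable_EFinP.
    by apply/measurable_EFinP/measurable_funM => //; exact: (measurableT_comp _ mX).
  - by move=> y x _; rewrite mule_ge0 ?lee_fin//; have := nnfun_muleindic_ge0 g y (X x); rewrite -EFinM lee_fin.
  rewrite integralT_nnsfun sintegralE ge0_mule_fsumr; last first.
    by move=> y; exact: nnsfun_mulemu_ge0.
  apply: eq_fsbigr => y _.
  (* A negative [y] is not a value of [g]: its preimage is empty and both sides vanish. *)
  have [y0|y0] := ltP y 0.
    rewrite preimage_nnfun0// measure0 !mule0.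
    by apply: integral0_eq => w _; rewrite indic0 mulr0 mul0e.
  under eq_integral do rewrite EFinM -muleA.
  rewrite ge0_integralZl//; last 2 first.
  - apply: emeasurable_funM; last exact/measurable_EFinP.
    by apply/measurable_EFinP/(measurableT_comp _ mX).
  - by move=> w _; rewrite mule_ge0// lee_fin.
  rewrite muleCA -H//; congr (_ * _)%E.
  rewrite [RHS]integral_mkcond; apply: eq_integral => w _.
  rewrite patchE indicE; case: (boolP (w \in _)) => h.
    by rewrite mem_set ?mul1e//; move: h; rewrite inE.
  by rewrite memNset ?mul0e//; move: h; rewrite notin_setE.
pose f_ := nnsfun_approx measurableT mf.
transitivity (lim (\int[mu]_w ((f_ n (X w))%:E * (Z w)%:E) @[n --> \oo])%E).
  rewrite -monotone_convergence//=.
  - apply: eq_integral => w _; apply/esym/cvg_lim => //=.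
    by apply: cvgeZr => //; exact: cvg_nnsfun_approx.
  - move=> n; apply: emeasurable_funM; last exact/measurable_EFinP.
    exact/measurable_EFinP/(measurableT_comp _ mX).
  - by move=> n w _; rewrite mule_ge0// lee_fin.
  - move=> w _ p q pq; rewrite lee_wpmul2r ?lee_fin//.
    by have /lefP/(_ (X w)) := nd_nnsfun_approx measurableT mf pq.
transitivity (lim (c%:E * \int[m]_x (f_ n x)%:E @[n --> \oo])%E).
  by apply: congr_lim; apply/funext => n; exact: nns.
have -> : (\int[m]_x f x = lim (\int[m]_x (f_ n x)%:E @[n --> \oo]))%E.
  rewrite -monotone_convergence//=.
  - by apply: eq_integral => x _; apply/esym/cvg_lim => //=; exact: cvg_nnsfun_approx.
  - by move=> n; exact/measurable_EFinP.
  - by move=> n x _; rewrite lee_fin.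
  - by move=> x _ p q pq; rewrite lee_fin; have /lefP/(_ x) := nd_nnsfun_approx measurableT mf pq.
apply: limeMl => //; apply: ereal_nondecreasing_is_cvgn => p q pq.
apply: ge0_le_integral => //.
- by move=> x _; rewrite lee_fin.
- exact/measurable_EFinP.
- exact/measurable_EFinP.
by move=> x _; rewrite lee_fin; have /lefP/(_ x) := nd_nnsfun_approx measurableT mf pq.
Qed.
End measure_identities.

(** * Integrals against exponential laws *)

Section exponential_integral.
Context {R : realType}.

Lemma integral_expo (r : R) (r0 : 0 < r) (f : R -> \bar R) :
  measurable_fun setT f -> (forall x, 0 <= f x)%E ->
  (\int[expo r0]_x f x = \int[lebesgue_measure]_x (f x * (exponential_pdf r x)%:E))%E.
Proof.
move=> mf f0; rewrite -[LHS]mul1e; symmetry.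
apply: (@ge0_integral_of_events _ _ (measurableTypeR R) _ R lebesgue_measure (expo r0) id (exponential_pdf r) 1) => //.
- exact: measurable_exponential_pdf.
- by move=> x; apply: exponential_pdf_ge0; exact: ltW.
- by move=> B mB; rewrite mul1e.
Qed.

(** Exponential tilting: the factor [expR (t * x)] turns the density of rate [r] into a multiple of
    that of rate [r - t]. Moment generating functions, the race of two clocks and Burke's identity
    all reduce to this. *)
Lemma expo_tilt (r t : R) (r0 : 0 < r) (rt : 0 < r - t) (A : set R) : measurable A ->
  (\int[expo r0]_(x in A) (expR (t * x))%:E = (r / (r - t))%:E * expo rt A)%E.
Proof.
move=> mA.
rewrite integral_mkcond integral_expo; last 2 first.
- apply/(measurable_restrictT _ _).1 => //; apply/measurable_EFinP/measurable_funTS.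
  by apply: measurableT_comp => //; exact: measurable_funM.
- by move=> x; rewrite patchE; case: ifP => // _; rewrite lee_fin expR_ge0.
rewrite /expo /exponential_prob -ge0_integralZl//=; last 3 first.
- apply/measurable_EFinP/measurable_funTS; exact: measurable_exponential_pdf.
- by move=> x _; rewrite lee_fin exponential_pdf_ge0// ltW.
- by rewrite lee_fin divr_ge0// ltW.
rewrite [RHS]integral_mkcond; apply: eq_integral => x _.
rewrite !patchE; case: ifP => _; last by rewrite mul0e.
rewrite -!EFinM; congr EFin.
have [x0|x0] := ltP x 0; first by rewrite !lt0_exponential_pdf// !mulr0.
rewrite !exponential_pdfE// [RHS]mulrA divfK ?gt_eqF// mulrCA -expRD; congr (_ * expR _); ring.
Qed.

End exponential_integral.

(** * Uniqueness of product laws up to a factor, and the race of two exponentials *)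

Section product_laws.
Context {R : realType}.
Local Open Scope ereal_scope.

Definition product_prob d d' (T : measurableType d) (T' : measurableType d')
    (P : probability T R) (Q : probability T' R) : probability (T * T')%type R := P \x Q.

Definition pushm d d' (T : measurableType d) (T' : measurableType d')
    (m : {measure set T -> \bar R}) (f : T -> T') (mf : measurable_fun setT f) :
  {measure set T' -> \bar R} := measure_function_pushforward__canonical__measure_function_Measure m mf.

(** The factor [k] will be the probability of an event of further independent variables. It may
    vanish; then [m'] is the zero measure and cannot be normalized. *)
Lemma product_measure_scaled_unique d1 d2 (T1 : measurableType d1) (T2 : measurableType d2)
    (m1 : {sigma_finite_measure set T1 -> \bar R})
    (m2 : {sigma_finite_measure set T2 -> \bar R})
    (m' : {measure set (T1 * T2) -> \bar R}) (k : R) : (0 <= k)%R ->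
  (forall A B, measurable A -> measurable B -> m' (A `*` B) = k%:E * (m1 A * m2 B)) ->
  m1 setT < +oo -> m2 setT < +oo ->
  forall S : set (T1 * T2), measurable S -> m' S = k%:E * (m1 \x m2) S.
Proof.
move=> k0 m'E m1oo m2oo S mS; have [k_eq0|kn0] := eqVneq k 0%R.
  rewrite k_eq0 mul0e; apply/eqP; rewrite eq_le measure_ge0 andbT.
  rewrite (@le_trans _ _ (m' setT))// ?le_measure ?inE//.
  have <- : [set: T1] `*` [set: T2] = setT by rewrite setXTT.
  by rewrite m'E// k_eq0 mul0e.
have ki0 : (0 <= k^-1)%R by rewrite invr_ge0.
have -> : (m1 \x m2) S = mscale (NngNum ki0) m' S.
  apply: product_measure_unique => // A B mA mB.
  transitivity (k^-1%:E * m' (A `*` B)) => //.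
  by rewrite m'E// muleA -EFinM mulVf// mul1e.
by rewrite /mscale/= muleA -EFinM divff// mul1e.
Qed.

Lemma eq_scaled_expo (r k : R) (r0 : (0 < r)%R) (m : {measure set R -> \bar R}) : (0 <= k)%R ->
  (forall a : R, m `]a, +oo[%classic = k%:E * expo r0 `]a, +oo[) ->
  forall A : set R, measurable A -> m A = k%:E * expo r0 A.
Proof.
move=> k0 H A mA.
transitivity (mscale (NngNum k0) (expo r0) A) => //.
apply: measure_eq_tails => // a.
by rewrite H expo_tail -EFinM ltry.
Qed.

(** One side at a time: with the other side frozen, the set function is a measure on the line, and
    its tails decide. *)
Lemma expo_box_of_tails (r1 r2 : R) (r10 : (0 < r1)%R) (r20 : (0 < r2)%R)
    (m' : {measure set (R * R)%type -> \bar R}) (k : R) : (0 <= k)%R ->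
  (forall a b : R, m' (`]a, +oo[ `*` `]b, +oo[) =
     k%:E * (expo r10 `]a, +oo[ * expo r20 `]b, +oo[)) ->
  forall A B : set R, measurable A -> measurable B ->
    m' (A `*` B) = k%:E * (expo r10 A * expo r20 B).
Proof.
move=> k0 H A B mA mB.
have ffst : measurable_fun setT (@fst R R) by exact: measurable_fst.
have fsnd : measurable_fun setT (@snd R R) by exact: measurable_snd.
have H1 b A' : measurable A' -> m' (A' `*` `]b, +oo[) = k%:E * (expo r10 A' * expo r20 `]b, +oo[).
  move=> mA'.
  have mb : measurable ([set: R] `*` `]b, +oo[%classic) by apply: measurableX.
  have kb0 : (0 <= k * expR (- r2 * Num.max b 0))%R by rewrite mulr_ge0 ?expR_ge0.
  have mE A2 : m' (A2 `*` `]b, +oo[) = pushforward (mrestr m' mb) (@fst R R) A2.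
    rewrite /pushforward /mrestr; congr (m' _).
    by apply/seteqP; split => -[x y]/=; tauto.
  rewrite mE expo_tail muleC -muleA [X in _ * X]muleC -EFinM muleC.
  apply: (eq_scaled_expo kb0) => // a.
  transitivity (m' (`]a, +oo[ `*` `]b, +oo[)); first by rewrite mE.
  by rewrite H !expo_tail -!EFinM; congr EFin; ring.
have mA' : measurable (A `*` [set: R]) by apply: measurableX.
have mE B2 : m' (A `*` B2) = pushforward (mrestr m' mA') (@snd R R) B2.
  rewrite /pushforward /mrestr; congr (m' _).
  by apply/seteqP; split => -[x y]/=; tauto.
have eA : expo r10 A \is a fin_num by exact: fin_num_measure.
have kb0 : (0 <= k * fine (expo r10 A))%R by rewrite mulr_ge0 ?fine_ge0.
rewrite mE -(fineK eA) muleA -EFinM.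
apply: (eq_scaled_expo kb0) => // b.
transitivity (m' (A `*` `]b, +oo[)); first by rewrite mE.
by rewrite H1// EFinM fineK// muleA.
Qed.

Lemma expo_supp (r : R) (r0 : (0 < r)%R) (f g : R -> \bar R) :
  measurable_fun setT f -> (forall x, 0 <= f x) ->
  measurable_fun setT g -> (forall x, 0 <= g x) ->
  (forall x, (0 <= x)%R -> f x = g x) -> \int[expo r0]_x f x = \int[expo r0]_x g x.
Proof.
move=> mf f0 mg g0 fg; rewrite !integral_expo//; apply: eq_integral => x _.
by have [x0|/fg->//] := ltP x 0%R; rewrite lt0_exponential_pdf// !mule0.
Qed.

(** This is the probability that a clock of rate [r2] outlasts one of rate [r1] by more than [t]:
    given the first time [u], the tail is [expR (- r2 * (u + t))], and tilting integrates it. *)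
Lemma expo_race (r1 r2 t : R) (r10 : (0 < r1)%R) (r20 : (0 < r2)%R) : (0 <= t)%R ->
  \int[expo r10]_u expo r20 `](u + t)%R, +oo[%classic =
  (r1 / (r1 + r2) * expR (- r2 * t))%:E.
Proof.
move=> t0.
have mexp c e : measurable_fun setT (fun u : R => (expR (c * (u + e)))%:E).
  apply/measurable_EFinP; apply: measurableT_comp => //; apply: measurable_funM => //.
  exact: measurable_funD.
rewrite (@expo_supp _ _ _ (fun u => (expR (- r2 * (u + t)))%:E))//; last first.
- by move=> u u0; rewrite expo_tail max_l// addr_ge0.
- rewrite (_ : (fun _ => _) = (fun u => (expR (- r2 * Num.max (u + t) 0))%:E)); last first.
    by apply/funext => u; rewrite expo_tail.
  apply/measurable_EFinP; apply: measurableT_comp => //; apply: measurable_funM => //.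
  by apply: measurable_maxr => //; exact: measurable_funD.
have r120 : (0 < r1 - - r2)%R by rewrite opprK addr_gt0.
under eq_integral do rewrite mulrDr expRD EFinM muleC.
rewrite ge0_integralZl//; last first.
  by have := mexp (- r2)%R 0%R; under eq_fun do rewrite addr0.
rewrite (expo_tilt _ r120)// (@probability_setT _ _ _ (expo r120)) mule1 opprK.
by rewrite -EFinM mulrC.
Qed.

End product_laws.

(** * Burke's identity in one cell *)

Section burke_law.
Context {R : realType}.
Variables (rho : R) (rho0 : 0 < rho) (rho1 : 0 < 1 - rho).
Let e1 : probability R R := expo rho1.
Let e2 : probability R R := expo rho0.
Let e3 : probability R R := expo (@ltr01 R).
Let e12 := product_prob e1 e2.
Local Open Scope ereal_scope.

(** The integrand is the probability, given the weight [w], that both new increments exceed their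
    thresholds: certain for [w > b], and for [a < w <= b] a race that must supply the missing
    [b - w]. *)
Let tail_mix (r a b : R) : (0 < r)%R -> (0 < 1 - r)%R -> (a <= b)%R ->
  \int[e3]_w ((\1_(`]b, +oo[%classic) w)%:E +
     ((1 - r) * expR (- r * b))%:E * ((expR (r * w))%:E * (\1_(`]a, b]%classic) w)%:E)) =
  (expR (- (1 - r) * Num.max a 0) * expR (- r * Num.max b 0))%:E.
Proof.
move=> r0 r1 ab.
have mf : measurable_fun setT
    (fun w : R => (expR (r * w))%:E * (\1_(`]a, b]%classic) w)%:E).
  apply: emeasurable_funM; apply/measurable_EFinP => //.
  by apply: measurableT_comp => //; exact: measurable_funM.
have c0 : (0 <= (1 - r) * expR (- r * b))%R by rewrite mulr_ge0 ?expR_ge0// ltW.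
rewrite ge0_integralD//; last 3 first.
- exact/measurable_EFinP.
- by move=> w _; rewrite mule_ge0 ?lee_fin.
- exact: emeasurable_funM.
rewrite integral_indic// setIT ge0_integralZl//.
have -> : \int[e3]_w ((expR (r * w))%:E * (\1_(`]a, b]%classic) w)%:E) =
          \int[e3]_(w in `]a, b]) (expR (r * w))%:E.
  rewrite [RHS]integral_mkcond; apply: eq_integral => w _.
  by rewrite patchE indicE; case: ifP; rewrite ?mule1 ?mule0.
rewrite (expo_tilt _ r1)//.
have -> : expo r1 `]a, b] =
    (expR (- (1 - r) * Num.max a 0) - expR (- (1 - r) * Num.max b 0))%:E.
  have -> : `]a, b]%classic = `]a, +oo[%classic `\` `]b, +oo[%classic.
    apply/seteqP; split => x; rewrite /= !in_itv/= !andbT.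
      by move=> /andP[-> xb]; split => //; apply/negP; rewrite -leNgt.
    by move=> [-> /negP]; rewrite -leNgt.
  rewrite measureD//; last by rewrite (le_lt_trans (probability_le1 (expo r1) _))// ltry.
  rewrite [X in _ - expo _ X](_ : _ = `]b, +oo[%classic).
    by rewrite [X in X - _](expo_tail r1) [X in _ - X](expo_tail r1).
  apply/seteqP; split => x; rewrite /= !in_itv/= !andbT; [by move=> []|].
  by move=> bx; split => //; exact: le_lt_trans bx.
rewrite [X in X + _](expo_tail (@ltr01 R)) -!EFinM -EFinD; congr EFin.
have [b0|b0] := ltP b 0%R.
  by rewrite max_r ?(le_trans ab (ltW b0))// !mulr0 expR0 subrr !mulr0 addr0 mulr1.
(* The tail of the weight beyond [b] is the product of the tails of rates [1 - r] and [r], and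
   cancels the negative term of the tilted law. *)
have -> : (- 1 * b = - (1 - r) * b + - r * b)%R by ring.
by rewrite expRD; field; rewrite gt_eqF.
Qed.

Let in_tail (a w : R) : (w \in `]a, +oo[%classic) = (a < w)%R.
Proof. by apply/idP/idP; rewrite inE/= in_itv/= andbT. Qed.

Let in_oc (a b w : R) : (w \in `]a, b]%classic) = (a < w <= b)%R.
Proof. by apply/idP/idP; rewrite inE/= in_itv/=. Qed.

Let e1T : e1 setT = 1. Proof. exact: probability_setT. Qed.
Let e2T : e2 setT = 1. Proof. exact: probability_setT. Qed.
Let e12T : e12 ([set: R] `*` [set: R]) = 1.
Proof.
transitivity (e1 setT * e2 setT); last by rewrite e1T e2T mule1.
exact: product_measure1E.
Qed.

Let measurable_diff' (t : R) : measurable [set p : R * R | (t < p.1 - p.2)%R].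
Proof.
have m : measurable_fun setT (fun p : R * R => p.1 - p.2)%R.
  by apply: measurable_funB; [exact: measurable_fst|exact: measurable_snd].
by have := m measurableT _ (measurable_itv `]t, +oo[); rewrite setTI;
  congr measurable; apply/seteqP; split => p /=; rewrite in_itv/= andbT.
Qed.

Let race2 (t : R) : (0 <= t)%R ->
  e12 [set p | (t < p.2 - p.1)%R] = ((1 - rho) * expR (- rho * t))%:E.
Proof.
move=> t0.
transitivity (\int[e1]_u e2 `](u + t)%R, +oo[%classic).
  apply: eq_integral => u _ /=; congr (e2 _); apply/seteqP; split => v; rewrite /xsection/= in_itv/= andbT !inE/=; lra.
by rewrite expo_race// subrK divr1.
Qed.

Let race1 (t : R) : (0 <= t)%R ->
  e12 [set p | (t < p.1 - p.2)%R] = (rho * expR (- (1 - rho) * t))%:E.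
Proof.
move=> t0.
(* The slices are taken at a fixed second coordinate, hence the other order of integration. *)
have -> : e12 [set p | (t < p.1 - p.2)%R] = (e1 \x^ e2) [set p | (t < p.1 - p.2)%R].
  by apply: product_measure_unique => // A B mA mB; exact: product_measure2E.
rewrite /product_measure2.
transitivity (\int[e2]_v e1 `](v + t)%R, +oo[%classic).
  apply: eq_integral => u _ /=; congr (e1 _); apply/seteqP; split => v; rewrite /ysection/= in_itv/= andbT !inE/=; lra.
by rewrite expo_race// addrC subrK divr1.
Qed.

(** For [z = (W, (U, V))] with weight [W], bottom increment [U] and left increment [V] of a cell,
    these are the increments on its top and right sides, by the last passage recursion. *)
Definition burke_map (z : R * (R * R)) : R * R :=
  (z.1 + Num.max (z.2.1 - z.2.2) 0, z.1 + Num.max (z.2.2 - z.2.1) 0)%R.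

Lemma measurable_burke_map : measurable_fun setT burke_map.
Proof.
have m21 : measurable_fun setT (fun z : R * (R * R) => z.2.1).
  by apply: (@measurableT_comp _ _ _ _ _ _ (@fst R R)).
have m22 : measurable_fun setT (fun z : R * (R * R) => z.2.2).
  by apply: (@measurableT_comp _ _ _ _ _ _ (@snd R R)).
by apply: measurable_fun_pair; apply: measurable_funD => //; apply: measurable_maxr => //;
  exact: measurable_funB.
Qed.

(* [min U' V' = W], so only the larger threshold involves the race between [U] and [V]. *)
Let burke_tail_le (a b : R) : (a <= b)%R ->
  (product_prob e3 e12) (burke_map @^-1` (`]a, +oo[ `*` `]b, +oo[)) =
  e1 `]a, +oo[%classic * e2 `]b, +oo[%classic.
Proof.
move=> ab.
pose f (w : R) : \bar R := (\1_(`]b, +oo[%classic) w)%:E +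
  ((1 - rho) * expR (- rho * b))%:E * ((expR (rho * w))%:E * (\1_(`]a, b]%classic) w)%:E).
have sectE w : e12 (xsection (burke_map @^-1` (`]a, +oo[ `*` `]b, +oo[)) w) = f w.
  rewrite /f !indicE in_tail in_oc.
  have [wa|aw] := leP w a.
    rewrite (_ : xsection _ _ = set0); last first.
      apply/seteqP; split => -[u v] //=; rewrite /xsection/= inE/= !in_itv/= !andbT.
      by rewrite !maxEge; do 2 case: ifP; lra.
    by rewrite measure0 (le_gtF (le_trans wa ab))/= !mule0 adde0.
  have [bw|wb] := ltP b w.
    rewrite (_ : xsection _ _ = [set: R] `*` [set: R]); last first.
      apply/seteqP; split => -[u v] //= _; rewrite /xsection/= inE/= !in_itv/= !andbT.
      by rewrite !maxEge; do 2 case: ifP; lra.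
    by rewrite e12T andbF !mule0 adde0.
  rewrite (_ : xsection _ _ = [set p | (b - w < p.2 - p.1)%R]); last first.
    apply/seteqP; split => -[u v] //=; rewrite /xsection/= inE/= !in_itv/= !andbT.
      by rewrite !maxEge; do 2 case: ifP; lra.
    by rewrite !maxEge; do 2 case: ifP; lra.
  rewrite race2 ?subr_ge0// add0e mule1 -EFinM -mulrA -expRD.
  by congr ((_ * expR _)%:E); ring.
transitivity (\int[e3]_w f w); first by apply: eq_integral => w _; exact: sectE.
rewrite /f tail_mix// EFinM.
by rewrite [e1 _](expo_tail rho1) [e2 _](expo_tail rho0).
Qed.

Let burke_tail_ge (a b : R) : (b <= a)%R ->
  (product_prob e3 e12) (burke_map @^-1` (`]a, +oo[ `*` `]b, +oo[)) =
  e1 `]a, +oo[%classic * e2 `]b, +oo[%classic.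
Proof.
move=> ab.
(* Mirror image of the previous case: exchanging the two increments exchanges [rho] and
   [1 - rho]. *)
pose r := (1 - rho)%R; have rE : (1 - r = rho)%R by rewrite /r; ring.
pose f (w : R) : \bar R := (\1_(`]a, +oo[%classic) w)%:E +
  ((1 - r) * expR (- r * a))%:E * ((expR (r * w))%:E * (\1_(`]b, a]%classic) w)%:E).
have sectE w : e12 (xsection (burke_map @^-1` (`]a, +oo[ `*` `]b, +oo[)) w) = f w.
  rewrite /f !indicE in_tail in_oc.
  have [wb|bw] := leP w b.
    rewrite (_ : xsection _ _ = set0); last first.
      apply/seteqP; split => -[u v] //=; rewrite /xsection/= inE/= !in_itv/= !andbT.
      by rewrite !maxEge; do 2 case: ifP; lra.
    by rewrite measure0 (le_gtF (le_trans wb ab))/= !mule0 adde0.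
  have [aw|wa] := ltP a w.
    rewrite (_ : xsection _ _ = [set: R] `*` [set: R]); last first.
      apply/seteqP; split => -[u v] //= _; rewrite /xsection/= inE/= !in_itv/= !andbT.
      by rewrite !maxEge; do 2 case: ifP; lra.
    by rewrite e12T andbF !mule0 adde0.
  rewrite (_ : xsection _ _ = [set p | (a - w < p.1 - p.2)%R]); last first.
    apply/seteqP; split => -[u v] //=; rewrite /xsection/= inE/= !in_itv/= !andbT.
      by rewrite !maxEge; do 2 case: ifP; lra.
    by rewrite !maxEge; do 2 case: ifP; lra.
  rewrite race1 ?subr_ge0// add0e mule1 -EFinM -mulrA -expRD.
  by rewrite /r; congr ((_ * expR _)%:E); ring.
transitivity (\int[e3]_w f w); first by apply: eq_integral => w _; exact: sectE.
rewrite /f tail_mix ?rE// EFinM muleC.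
by rewrite [e1 _](expo_tail rho1) [e2 _](expo_tail rho0).
Qed.

Lemma burke_law (A B : set R) : measurable A -> measurable B ->
  product_prob e3 (product_prob e1 e2) (burke_map @^-1` (A `*` B)) =
  expo rho1 A * expo rho0 B.
Proof.
move=> mA mB; rewrite -[RHS]mul1e.
have mb := measurable_burke_map.
apply: (@expo_box_of_tails R _ _ rho1 rho0 (pushm (product_prob e3 e12) mb) 1) => // a b; rewrite mul1e.
by case: (leP a b) => [/burke_tail_le//|/ltW /burke_tail_ge].
Qed.

End burke_law.

(** * Finite families of independent exponential variables *)

Section independent_exponentials.
Context d (T : measurableType d) (R : realType) (P : probability T R) (I : eqType).
Implicit Types (r : I -> R) (X : I -> T -> R) (s : seq I) (B : I -> set R).

Definition box X B s : set T := [set w | forall i, i \in s -> B i (X i w)].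

(** Taking [B i] to be the whole line drops the index [i], so the laws of subfamilies are included;
    the values of [B] outside [s] do not matter. *)
Definition iexp r X s : Prop :=
  (forall i, i \in s -> measurable_fun setT (X i)) /\
  forall B, (forall i, measurable (B i)) ->
  P (box X B s) = (\prod_(i <- s) fine (exponential_prob (r i) (B i)))%:E.

Lemma box_cons X B i s : box X B (i :: s) = X i @^-1` B i `&` box X B s.
Proof.
apply/seteqP; split => w /=.
  move=> h; split; first by apply: h; rewrite mem_head.
  by move=> j js; apply: h; rewrite in_cons js orbT.
by move=> [h1 h2] j; rewrite in_cons => /predU1P[->//|/h2].
Qed.

Lemma measurable_box X B s : (forall i, i \in s -> measurable_fun setT (X i)) ->
  (forall i, measurable (B i)) -> measurable (box X B s).
Proof.
move=> mX mB; elim: s mX => [|i s IH] mX.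
  by rewrite (_ : box _ _ _ = setT)//; apply/seteqP; split.
rewrite box_cons; apply: measurableI.
  by rewrite -[X in measurable X]setTI; apply: mX; rewrite ?mem_head.
by apply: IH => j js; apply: mX; rewrite in_cons js orbT.
Qed.

Lemma exponential_probT (a : R) : 0 < a -> fine (exponential_prob a [set: R]) = 1.
Proof. by move=> a0; rewrite [exponential_prob a _](@probability_setT _ _ _ (expo a0)). Qed.

Lemma iexp_sub r X s s1 : uniq s -> uniq s1 -> {subset s1 <= s} ->
  (forall i, 0 < r i) -> iexp r X s -> iexp r X s1.
Proof.
move=> us us1 ss r0 [mX h]; split => [i /ss|B mB]; first exact: mX.
pose B' i := if i \in s1 then B i else setT.
have mB' i : measurable (B' i) by rewrite /B'; case: ifP.
have -> : box X B s1 = box X B' s.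
  apply/seteqP; split => w /= hw i; rewrite /B'.
    by move=> _; case: ifP => // /hw.
  by move=> is1; have := hw _ (ss _ is1); rewrite /B' is1.
rewrite h//; congr EFin.
rewrite (eq_bigr (fun i => if i \in s1 then fine (exponential_prob (r i) (B i)) else 1)); last first.
  by move=> i _; rewrite /B'; case: ifP => // _; rewrite exponential_probT.
rewrite -big_mkcond -big_filter; apply: perm_big; apply: uniq_perm => //.
  exact: filter_uniq.
by move=> i; rewrite mem_filter andb_idr// => /ss.
Qed.

Lemma iexp_eq r r' X X' s : {in s, r =1 r'} -> {in s, forall i, X i = X' i} ->
  iexp r X s -> iexp r' X' s.
Proof.
move=> rr' XX' [mX h]; split => [i si|B mB]; first by rewrite -XX'//; exact: mX.
transitivity (P (box X B s)).
  by congr (P _); apply/seteqP; split => w hw i si; have := hw i si; rewrite XX'.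
rewrite h; last exact: mB.
apply: (congr1 EFin); apply: eq_big_seq => i si.
exact: (congr1 (fun q => fine (exponential_prob q (B i))) (rr' i si)).
Qed.

Lemma prod_fine_ge0 r B s : (forall i, 0 < r i) ->
  0 <= \prod_(i <- s) fine (exponential_prob (r i) (B i)).
Proof.
by move=> r0; apply: prodr_ge0 => i _; apply: fine_ge0; exact: (measure_ge0 (expo (r0 i))).
Qed.

(** The indices [u], [v], [w] stand for the bottom increment, the left increment and the weight of a
    cell. On an event [C] of the remaining variables the triple has the product law up to the factor
    [k], the probability of [C], so Burke's identity holds jointly with them. The weight is used up,
    and its index leaves the family. *)
Lemma burke_step r X X' (rho : R) (u v w : I) s : 0 < rho -> 0 < 1 - rho ->
  uniq [:: u, v, w & s] -> (forall i, 0 < r i) ->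
  r u = 1 - rho -> r v = rho -> r w = 1 ->
  X' u = (fun t => X w t + Num.max (X u t - X v t) 0) ->
  X' v = (fun t => X w t + Num.max (X v t - X u t) 0) ->
  {in s, forall i, X' i = X i} ->
  iexp r X [:: u, v, w & s] -> iexp r X' [:: u, v & s].
Proof.
move=> rho0 rho1 /= /and4P[]; rewrite !in_cons !negb_or => /and3P[uv uw us] /andP[vw vs] ws uns.
move=> r0 ru rv rw X'u X'v X's [mX h].
have mXu : measurable_fun setT (X u) by apply: mX; rewrite mem_head.
have mXv : measurable_fun setT (X v) by apply: mX; rewrite !in_cons eqxx !orbT.
have mXw : measurable_fun setT (X w) by apply: mX; rewrite !in_cons eqxx !orbT.
have mXs i : i \in s -> measurable_fun setT (X i).
  by move=> si; apply: mX; rewrite !in_cons si !orbT.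
split.
  move=> i; rewrite !in_cons => /or3P[/eqP->|/eqP->|si].
  - by rewrite X'u; apply: measurable_funD => //; apply: measurable_maxr => //; exact: measurable_funB.
  - by rewrite X'v; apply: measurable_funD => //; apply: measurable_maxr => //; exact: measurable_funB.
  - by rewrite X's//; exact: mXs.
move=> B mB.
set C := box X B s; have mC : measurable C by exact: measurable_box.
set k := \prod_(i <- s) fine (exponential_prob (r i) (B i)).
have k0 : 0 <= k by exact: prod_fine_ge0.
pose e1 : probability R R := expo rho1; pose e2 : probability R R := expo rho0.
pose e3 : probability R R := expo (@ltr01 R).
have h3 A1 A2 A3 : measurable A1 -> measurable A2 -> measurable A3 ->
    P (X w @^-1` A3 `&` (X u @^-1` A1 `&` X v @^-1` A2) `&` C) =
    ((k * fine (e3 A3))%:E * (e1 A1 * e2 A2))%E.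
  move=> mA1 mA2 mA3.
  pose B' i := if i == u then A1 else if i == v then A2 else if i == w then A3 else B i.
  have mB' i : measurable (B' i) by rewrite /B'; do ![case: ifP => _ //].
  have B'u : B' u = A1 by rewrite /B' eqxx.
  have B'v : B' v = A2 by rewrite /B' eq_sym (negbTE uv) eqxx.
  have B'w : B' w = A3.
    by rewrite /B' eq_sym (negbTE uw) eq_sym (negbTE vw) eqxx.
  have B's i : i \in s -> B' i = B i.
    move=> si; rewrite /B'; case: eqP => [iu|_]; first by rewrite -iu si in us.
    case: eqP => [iv|_]; first by rewrite -iv si in vs.
    by case: eqP => [iw|//]; rewrite -iw si in ws.
  have := h _ mB'; rewrite !box_cons B'u B'v B'w.
  have -> : box X B' s = C.
    by apply/seteqP; split => t ht i si; have := ht _ si; rewrite B's.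
  rewrite !big_cons B'u B'v B'w ru rv rw.
  rewrite (eq_big_seq (fun i => fine (exponential_prob (r i) (B i)))); last first.
    by move=> i si; rewrite B's.
  rewrite -/k => hP.
  rewrite (_ : _ `&` C = X u @^-1` A1 `&` (X v @^-1` A2 `&` (X w @^-1` A3 `&` C))); last first.
    by apply/seteqP; split => t/=; tauto.
  rewrite [LHS]hP -(@fineK _ (e1 A1)) ?fin_num_measure// -(@fineK _ (e2 A2)) ?fin_num_measure//.
  have perm4 (x1 x2 x3 x4 : R) : x1 * (x2 * (x3 * x4)) = x4 * x3 * (x1 * x2) by ring.
  rewrite -!EFinM; apply: (congr1 EFin); exact: perm4.
pose phi t := (X w t, (X u t, X v t)).
have mphi2 : measurable_fun setT (fun t => (X u t, X v t)) by exact: measurable_fun_pair.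
have mphi : measurable_fun setT phi by exact: measurable_fun_pair.
have mres (D : set T) : measurable D -> {m : {measure set T -> \bar R} | forall A, m A = P (A `&` D)}.
  by move=> mD; exists (measure_function_mrestr__canonical__measure_function_Measure P mD).
(* Uniqueness of product measures is applied twice, since the law is that of [X w] together with the
   pair of [X u] and [X v]; the inner application freezes the event of [X w]. *)
have mE S : measurable S -> P (phi @^-1` S `&` C) = (k%:E * product_prob e3 (product_prob e1 e2) S)%E.
  have [mc mcE] := mres _ mC.
  rewrite -mcE; move: S; apply: (@product_measure_scaled_unique _ _ _ _ _ e3 (product_prob e1 e2) (pushm mc mphi) k) => //.
  - move=> A3 S2 mA3 mS2.
    have mD : measurable (X w @^-1` A3 `&` C).
      by apply: measurableI => //; rewrite -[X in measurable X]setTI; exact: mXw.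
    have [md mdE] := mres _ mD.
    have kA0 : 0 <= k * fine (e3 A3) by rewrite mulr_ge0 ?fine_ge0.
    transitivity ((k * fine (e3 A3))%:E * product_prob e1 e2 S2)%E; last first.
      by rewrite EFinM fineK ?fin_num_measure// muleA.
    transitivity (pushm md mphi2 S2).
      rewrite [LHS]mcE [RHS]mdE; congr (P _).
      by apply/seteqP; split => t/=; tauto.
    apply: (@product_measure_scaled_unique _ _ _ _ _ e1 e2 (pushm md mphi2) _ kA0) => //.
    - move=> A1 A2 mA1 mA2; rewrite -h3// [LHS]mdE; congr (P _).
      by apply/seteqP; split => t/=; tauto.
    - by rewrite (le_lt_trans (probability_le1 _ _))// ltry.
    - by rewrite (le_lt_trans (probability_le1 _ _))// ltry.
  - by rewrite (le_lt_trans (probability_le1 _ _))// ltry.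
  - by rewrite (le_lt_trans (probability_le1 _ _))// ltry.
have mburke : measurable (@burke_map R @^-1` (B u `*` B v)).
  rewrite -[X in measurable X]setTI; apply: measurable_burke_map => //.
  exact: measurableX.
transitivity (P (phi @^-1` (@burke_map R @^-1` (B u `*` B v)) `&` C)).
  congr (P _); rewrite !box_cons; apply/seteqP; split => t /=.
    rewrite /burke_map/= X'u X'v => -[h1 [h2 h4]]; split => // i si.
    by rewrite -X's//; exact: h4.
  rewrite /burke_map/= X'u X'v => -[[h1 h2] h4]; do 2 split => //.
  by move=> i si; rewrite X's//; exact: h4.
rewrite mE//.
have -> : product_prob e3 (product_prob e1 e2) (@burke_map R @^-1` (B u `*` B v)) =
   (e1 (B u) * e2 (B v))%E by exact: burke_law.
rewrite !big_cons ru rv -/k -(@fineK _ (e1 _)) ?fin_num_measure// -(@fineK _ (e2 _)) ?fin_num_measure//.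
have perm3 (x1 x2 x3 : R) : x1 * (x2 * x3) = x2 * (x3 * x1) by ring.
rewrite -!EFinM; apply: (congr1 EFin); exact: perm3.
Qed.

End independent_exponentials.

(** * Scaling, products of expectations and the Chernoff bound *)

Section independent_exponentials_integrals.
Context d (T : measurableType d) (R : realType) (P : probability T R) (I : eqType).
Implicit Types (r : I -> R) (X : I -> T -> R) (s : seq I) (B : I -> set R).

Lemma expo_scale (a c : R) (B : set R) : 0 < a -> 0 < c -> measurable B ->
  exponential_prob (a / c) B = exponential_prob a ((fun x => c * x) @^-1` B).
Proof.
move=> a0 c0 mB; have ac0 : 0 < a / c by rewrite divr_gt0.
have mc : measurable_fun setT (fun x : R => c * x) by exact: measurable_funM.
symmetry; rewrite -[RHS]mul1e.
apply: (@eq_scaled_expo R (a / c) 1 ac0 (pushm (expo a0) mc)) => // t.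
rewrite mul1e expo_tail.
transitivity (expo a0 `](t / c), +oo[%classic).
  congr (expo a0 _); apply/seteqP; split => x /=; rewrite !in_itv/= !andbT.
    by rewrite ltr_pdivrMr// mulrC.
  by rewrite ltr_pdivrMr// mulrC.
rewrite expo_tail; congr (expR _)%:E.
rewrite -[X in Num.max _ X](mul0r c^-1) -maxr_pMl ?invr_ge0 ?ltW//.
by field; rewrite gt_eqF.
Qed.

Lemma iexp_scale r X s (c : I -> R) : (forall i, 0 < r i) -> (forall i, 0 < c i) ->
  iexp P r X s -> iexp P (fun i => r i / c i) (fun i w => c i * X i w) s.
Proof.
move=> r0 c0 [mX h]; split => [i si|B mB].
  by apply: measurable_funM => //; exact: mX.
rewrite -[LHS]/(P (box X (fun i => (fun x => c i * x) @^-1` B i) s)) h; last first.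
  move=> i; rewrite -[X in measurable X]setTI.
  have mc : measurable_fun setT (fun x : R => c i * x) by exact: measurable_funM.
  exact: mc.
by apply: congr1; apply: eq_bigr => i _; rewrite expo_scale.
Qed.

Lemma integral_mrestr (mu : {measure set T -> \bar R}) (D : set T) (mD : measurable D)
    (f : T -> \bar R) : measurable_fun setT f -> (forall w, 0 <= f w)%E ->
  (\int[measure_function_mrestr__canonical__measure_function_Measure mu mD]_w f w =
   \int[mu]_(w in D) f w)%E.
Proof.
move=> mf f0; set md := measure_function_mrestr__canonical__measure_function_Measure mu mD.
rewrite -[LHS]mul1e -(@ge0_integral_of_events _ _ T _ T mu md id (\1_D) 1)//.
  rewrite [RHS]integral_mkcond; apply: eq_integral => w _.
  by rewrite patchE indicE; case: ifP; rewrite ?mule1 ?mule0.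
by move=> B mB; rewrite integral_indic// mul1e setIC.
Qed.

(** Induction on the variables: freezing an event of the first one leaves an integral of the others
    against a restricted measure, whose boxes carry an additional factor. This is why [mu] and [k]
    are general. *)
Lemma integral_prod_box (mu : {measure set T -> \bar R}) (k : R) r (r0 : forall i, 0 < r i) X s
    (f : I -> R -> R) (g : I -> R) : 0 <= k -> uniq s ->
  (forall i, i \in s -> measurable_fun setT (X i)) ->
  (forall B, (forall i, measurable (B i)) ->
    mu (box X B s) = (k * \prod_(i <- s) fine (expo (r0 i) (B i)))%:E) ->
  (forall i, measurable_fun setT (f i)) -> (forall i x, 0 <= f i x) ->
  (forall i, (\int[expo (r0 i)]_x (f i x)%:E = (g i)%:E)%E) ->
  (\int[mu]_w (\prod_(i <- s) f i (X i w))%:E = (k * \prod_(i <- s) g i)%:E)%E.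
Proof.
move=> + + + + mf f0 fg.
elim: s mu k => [|i s IH] mu k k0 us mX h.
  under eq_integral do rewrite big_nil.
  rewrite big_nil integral_cst// mul1e mulr1.
  have := h (fun=> setT) (fun=> measurableT); rewrite big_nil mulr1 => <-.
  by congr (mu _); apply/seteqP; split.
move: us => /= /andP[ins us].
have g0 j : 0 <= g j by rewrite -lee_fin -fg; apply: integral_ge0 => x _; rewrite lee_fin.
have mXi : measurable_fun setT (X i) by apply: mX; rewrite mem_head.
have mXs j : j \in s -> measurable_fun setT (X j).
  by move=> sj; apply: mX; rewrite in_cons sj orbT.
have mZ : measurable_fun setT (fun w => \prod_(j <- s) f j (X j w)).
  elim: s {IH h us mX ins} mXs => [|j s IHs] mXs.
    by rewrite (_ : (fun _ => _) = cst 1)//; apply/funext => w; rewrite big_nil.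
  under eq_fun do rewrite big_cons.
  apply: measurable_funM; first by apply: measurableT_comp => //; apply: mXs; rewrite mem_head.
  by apply: IHs => l sl; apply: mXs; rewrite in_cons sl orbT.
have Z0 w : 0 <= \prod_(j <- s) f j (X j w) by apply: prodr_ge0.
under eq_integral do rewrite big_cons EFinM.
rewrite (@ge0_integral_of_events _ _ _ _ _ mu (expo (r0 i)) (X i)
   (fun w => \prod_(j <- s) f j (X j w)) (k * \prod_(j <- s) g j) mXi mZ Z0 _ _ (EFin \o f i)).
- by rewrite /comp fg -EFinM big_cons; apply: congr1; rewrite mulrAC mulrA.
- by rewrite mulr_ge0// prodr_ge0.
- move=> B0 mB0.
  have mD : measurable (X i @^-1` B0) by rewrite -[X in measurable X]setTI; exact: mXi.
  pose md := measure_function_mrestr__canonical__measure_function_Measure mu mD.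
  transitivity (\int[md]_w (\prod_(j <- s) f j (X j w))%:E)%E.
    by rewrite integral_mrestr//; exact/measurable_EFinP.
  have e0 : 0 <= fine (expo (r0 i) B0) by rewrite fine_ge0.
  rewrite (IH md (k * fine (expo (r0 i) B0)))//.
  - by rewrite mulrAC EFinM fineK// fin_num_measure.
  - exact: mulr_ge0.
  - move=> B mB.
    pose B' j := if j == i then B0 else B j.
    have mB' j : measurable (B' j) by rewrite /B'; case: ifP.
    have B's j : j \in s -> B' j = B j.
      by move=> sj; rewrite /B'; case: eqP => // ji; rewrite -ji sj in ins.
    have B'i : B' i = B0 by rewrite /B' eqxx.
    have := h _ mB'; rewrite box_cons big_cons B'i.
    rewrite (_ : box X B' s = box X B s); last first.
      by apply/seteqP; split => t ht j sj; have := ht _ sj; rewrite B's.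
    rewrite [in X in _ = X -> _](eq_big_seq (fun i => fine (expo (r0 i) (B i)))); last first.
      by move=> j sj; rewrite B's.
    by rewrite mulrA => <-; rewrite /md/= /mrestr setIC.
- exact/measurable_EFinP.
- by move=> x; rewrite lee_fin.
Qed.

Lemma expo_mgf (a t : R) (a0 : 0 < a) : t < a ->
  (\int[expo a0]_x (expR (t * x))%:E = (a / (a - t))%:E)%E.
Proof.
move=> ta; have at0 : 0 < a - t by rewrite subr_gt0.
by rewrite (expo_tilt _ at0)// (@probability_setT _ _ _ (expo at0)) mule1.
Qed.

(** The sign of [t] selects the upper or the lower tail. The logarithm of the moment generating
    function exceeds its linear part only by a term quadratic in [t / a]. *)
Lemma chernoff (X : I -> T -> R) s (a t x : R) : 0 < a -> `|t| <= a / 2 -> uniq s ->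
  iexp P (fun=> a) X s ->
  (P [set w | (t * ((size s)%:R / a) + x <= t * \sum_(i <- s) X i w)%R] <=
    (expR (- x + 2 * (size s)%:R * (t / a) ^+ 2))%:E)%E.
Proof.
move=> a0 ta us [mX h].
have mS : measurable_fun setT (fun w => t * \sum_(i <- s) X i w).
  apply: measurable_funM => //.
  elim: s {h us} mX => [|j s IHs] mX.
    by rewrite (_ : (fun _ => _) = cst 0)//; apply/funext => w; rewrite big_nil.
  under eq_fun do rewrite big_cons.
  apply: measurable_funD; first by apply: mX; rewrite mem_head.
  by apply: IHs => l sl; apply: mX; rewrite in_cons sl orbT.
set y := t * ((size s)%:R / a) + x.
set A := [set w | _].
have mA : measurable A.
  have := mS measurableT _ (measurable_itv `[y, +oo[); rewrite setTI.
  by congr measurable; apply/seteqP; split => w /=; rewrite in_itv/= andbT.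
have mE : measurable_fun setT (fun w => (expR (t * \sum_(i <- s) X i w))%:E).
  by apply/measurable_EFinP; exact: measurableT_comp.
have ta' : t < a by move: ta; rewrite ler_norml => /andP[_]; move: a0; lra.
have EE : (\int[P]_w (expR (t * \sum_(i <- s) X i w))%:E = ((a / (a - t)) ^+ size s)%:E)%E.
  have := @integral_prod_box P 1 (fun=> a) (fun=> a0) X s (fun _ x => expR (t * x)) (fun=> a / (a - t)).
  rewrite big_const_seq count_predT -Monoid.iteropE mul1r.
  rewrite (_ : (fun w => _) = (fun w => (expR (t * \sum_(i <- s) X i w))%:E)); last first.
    by apply/funext => w; rewrite mulr_sumr expR_sum.
  apply => //.
  - by move=> B mB; rewrite mul1r [LHS](h B mB).
  - by move=> _; apply: measurableT_comp => //; exact: measurable_funM.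
  - by move=> _; exact: expo_mgf.
have -> : P A = (\int[P]_w (\1_A w)%:E)%E by rewrite integral_indic// setIT.
apply: (@le_trans _ _ (\int[P]_w ((expR (- y))%:E * (expR (t * \sum_(i <- s) X i w))%:E))%E).
  apply: ge0_le_integral => //.
  - exact/measurable_EFinP.
  - exact: emeasurable_funM.
  - move=> w _; rewrite -EFinM lee_fin -expRD indicE; case: (boolP (w \in A)) => [|_].
      rewrite inE /A/= => hy; rewrite -expR0 ler_expR addrC subr_ge0//.
    exact: expR_ge0.
rewrite ge0_integralZl// EE -EFinM lee_fin.
set q := t / a.
have aq : a / (a - t) = (1 - q)^-1.
  by rewrite /q; field; rewrite !gt_eqF// subr_gt0.
have q2 : `|q| <= 2^-1 by rewrite /q normrM normfV (gtr0_norm a0) ler_pdivrMr// mulrC.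
(* Multiplied by [1 - q], the lower bound [1 + q + 2 q ^ 2] of the exponential becomes
   [1 + q ^ 2 (1 - 2 q)], which is at least 1 for [q <= 1 / 2]. *)
have qe : (1 - q)^-1 <= expR (q + 2 * q ^+ 2).
  have /andP[q1 q3] : - 2^-1 <= q <= 2^-1 by rewrite -ler_norml.
  apply: (le_trans _ (expR_ge1Dx _)).
  rewrite -[leLHS]mulr1 ler_pdivrMl; last by lra.
  have : 0 <= q ^+ 2 * (1 - 2 * q) by rewrite mulr_ge0 ?sqr_ge0//; lra.
  by nra.
rewrite aq.
apply: (@le_trans _ _ (expR (- y) * expR (q + 2 * q ^+ 2) ^+ size s)).
  rewrite ler_wpM2l ?expR_ge0//; apply: lerXn2r => //; rewrite ?nnegrE ?expR_ge0// invr_ge0.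
  by move: q2; rewrite ler_norml => /andP[_]; lra.
rewrite -expRM_natl -expRD ler_expR /y /q.
rewrite le_eqVlt; apply/orP; left; apply/eqP.
by rewrite -mulr_natl; field; rewrite gt_eqF.
Qed.

End independent_exponentials_integrals.

(** * Up-right lattice paths and the last passage recursion *)

Section lattice_paths.
Context {R : realType}.
Implicit Types (x y : nat * nat -> R) (p : nat * nat) (s : seq bool).

(** A path is a word of booleans without a fixed starting point, so that cutting, joining and
    shifting paths are operations on lists. *)
Definition pstep (e : bool) p := if e then (p.1.+1, p.2) else (p.1, p.2.+1).

(* The start point is not counted, so that [psum] is additive under concatenation. *)
Fixpoint psum x p s : R :=
  if s is e :: s' then x (pstep e p) + psum x (pstep e p) s' else 0.

Definition pend p s := (p.1 + count id s, p.2 + count negb s)%N.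

Lemma pend_cons p e s : pend p (e :: s) = pend (pstep e p) s.
Proof. by case: e; rewrite /pend /pstep /= ?add0n ?addnS ?addSn// add1n addnS. Qed.

Lemma pend_cat p s t : pend p (s ++ t) = pend (pend p s) t.
Proof. by rewrite /pend /= !count_cat !addnA. Qed.

Lemma psum_cat x p s t : psum x p (s ++ t) = psum x p s + psum x (pend p s) t.
Proof.
elim: s p => [|e s IH] p /=; first by rewrite add0r /pend /= !addn0; case: p.
by rewrite IH addrA pend_cons.
Qed.

Lemma psum_rcons x p s e : psum x p (rcons s e) = psum x p s + x (pstep e (pend p s)).
Proof. by rewrite -cats1 psum_cat /= addr0. Qed.

Lemma psum_shift x (a b : nat) p s :
  psum (fun q => x (a + q.1, b + q.2)%N) p s = psum x (a + p.1, b + p.2)%N s.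
Proof.
elim: s p => [//|e s IH] p /=; rewrite IH.
by case: e => /=; rewrite !addnS.
Qed.

Lemma ler_psum x y p s :
  (forall q, (p.1 <= q.1 <= (pend p s).1)%N -> (p.2 <= q.2 <= (pend p s).2)%N ->
    q != p -> x q <= y q) -> psum x p s <= psum y p s.
Proof.
elim: s p => [//|e s IH] p; rewrite pend_cons => h /=; apply: lerD.
  apply: h; rewrite /pend/=; case: e => /=; rewrite ?leqnSn ?leqnn ?leq_addr ?(leq_trans (leqnSn _))//=;
    by rewrite ?leq_addr//; apply/eqP => -[]; case: p => a b /= [] => /eqP; rewrite ?gtn_eqF// => _ /eqP; rewrite gtn_eqF.
apply: IH => q q1 q2 qp; apply: h.
- by case: e q1 {q2 qp} => //= /andP[/ltnW-> ->].
- by case: e q2 {q1 qp} => //= /andP[/ltnW-> ->].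
- by apply/eqP => qE; move: q1 q2; rewrite qE; case: (e) => /=; rewrite ltnn.
Qed.

(** Rows are the outer and columns the inner recursion, both structural. The origin has value 0: its
    weight is left out, as in [psum]. *)
Fixpoint lpp_row x (j : nat) : nat -> R :=
  match j with
  | 0 => fix row i := if i is i'.+1 then row i' + x (i, 0)%N else 0
  | j'.+1 => let prev := lpp_row x j' in
      fix row i := if i is i'.+1 then Num.max (row i') (prev i) + x (i, j)
                   else prev 0%N + x (0%N, j)
  end.

Definition lpp x i j := lpp_row x j i.
Arguments lpp : simpl never.

Lemma lpp00 x : lpp x 0 0 = 0. Proof. by []. Qed.
Lemma lppS0 x i : lpp x i.+1 0 = lpp x i 0 + x (i.+1, 0)%N. Proof. by []. Qed.
Lemma lpp0S x j : lpp x 0 j.+1 = lpp x 0 j + x (0, j.+1)%N. Proof. by []. Qed.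
Lemma lppSS x i j :
  lpp x i.+1 j.+1 = Num.max (lpp x i j.+1) (lpp x i.+1 j) + x (i.+1, j.+1).
Proof. by []. Qed.

Lemma psum_le_lpp x s : psum x (0, 0)%N s <= lpp x (count id s) (count negb s).
Proof.
elim/last_ind: s => [//|s e IH]; rewrite psum_rcons -cats1 !count_cat /= addn0 addn0.
rewrite /pend /= !add0n; set i := count id s in IH *; set j := count negb s in IH *.
case: e => /=; rewrite ?addn0 ?addn1.
- case: j IH => [|j] IH; first by rewrite lppS0 lerD2r.
  by rewrite lppSS lerD2r le_max IH.
- case: i IH => [|i] IH; first by rewrite lpp0S lerD2r.
  by rewrite lppSS lerD2r le_max IH orbT.
Qed.

Lemma lpp_path x i j : exists s, [/\ count id s = i, count negb s = j & psum x (0, 0)%N s = lpp x i j].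
Proof.
elim: j i => [|j IHj] i.
  elim: i => [|i [s [si sj sx]]]; first by exists [::].
  exists (rcons s true); rewrite -cats1 !count_cat /= psum_cat /= sx /pend /= si sj.
  by rewrite !addn0 addn1 addr0.
elim: i => [|i [s [si sj sx]]].
  have [s [si sj sx]] := IHj 0%N.
  exists (rcons s false); rewrite -cats1 !count_cat /= psum_cat /= sx /pend /= si sj.
  by rewrite !addn0 addn1 addr0.
have [s' [si' sj' sx']] := IHj i.+1.
rewrite lppSS; have [h|h] := leP (lpp x i j.+1) (lpp x i.+1 j).
  exists (rcons s' false); rewrite -cats1 !count_cat /= psum_cat /= sx' /pend /= si' sj'.
  by rewrite !addn0 addn1 addr0.
exists (rcons s true); rewrite -cats1 !count_cat /= psum_cat /= sx /pend /= si sj.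
by rewrite !addn0 addn1 addr0.
Qed.

Lemma lpp_col0 x n : lpp x 0 n = \sum_(k < n) x (0, k.+1)%N.
Proof. by elim: n => [|n IH]; rewrite ?big_ord0// lpp0S IH big_ord_recr. Qed.

(** Up the first column, then along row [n]: in the stationary model each part is a sum of i.i.d.
    exponentials. *)
Lemma lpp_telescope x m n : lpp x m n = lpp x 0 n + \sum_(k < m) (lpp x k.+1 n - lpp x k n).
Proof.
elim: m => [|m IH]; first by rewrite big_ord0 addr0.
by rewrite big_ord_recr/= addrA -IH addrC subrK.
Qed.

End lattice_paths.
Arguments lpp : simpl never.

(** * Propagation of the stationary increments from row to row *)

Section stationary_model.
Context d (T : measurableType d) (R : realType) (P : probability T R).
Variables (X : nat * nat -> T -> R) (rho : R).
Hypotheses (rho0 : 0 < rho) (rho1 : 0 < 1 - rho).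
Variables (m n : nat).

Definition grid : seq (nat * nat) := [seq (i, j) | i <- iota 0 m.+1, j <- iota 0 n.+1].

Lemma mem_grid p : (p \in grid) = (p.1 <= m)%N && (p.2 <= n)%N.
Proof.
apply/allpairsP/andP => [[[i j] [im jn ->]]|[pm pn]].
  by move: im jn; rewrite !mem_iota !add0n !ltnS.
by exists p; rewrite !mem_iota !add0n !ltnS pm pn; split => //; case: (p).
Qed.

Lemma grid_uniq : uniq grid.
Proof. by apply: allpairs_uniq; rewrite ?iota_uniq// => -[a b] [c e] _ _. Qed.

Definition srate (p : nat * nat) : R :=
  if p.2 == 0%N then 1 - rho else if p.1 == 0%N then rho else 1.

Lemma srate_gt0 p : 0 < srate p.
Proof. by rewrite /srate; do 2 case: ifP => // _. Qed.

Let W (t : T) : nat * nat -> R := X^~ t.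

(* The increments of [lpp] along a down-right lattice path, with the horizontal increment of
   column [k] stored at [(k, 0)] and the vertical increment of row [j+1] at [(0, j+1)]; row [j+1]
   has been processed up to column [i]. *)
Definition sweep_fam i j (p : nat * nat) (t : T) : R :=
  if p.2 == 0%N then
    if (p.1 <= i)%N then lpp (W t) p.1 j.+1 - lpp (W t) p.1.-1 j.+1
    else lpp (W t) p.1 j - lpp (W t) p.1.-1 j
  else if (p.1 == 0%N) && (p.2 == j.+1) then lpp (W t) i j.+1 - lpp (W t) i j
  else X p t.

(** The variables independent at this stage: the horizontal increments, the vertical increment at
    column [i], the axis weights of higher rows, and the interior weights not yet passed, right of
    column [i] in row [j.+1] or above that row. *)
Definition sweep_idx i j (p : nat * nat) : bool :=
  [|| (p.2 == 0%N) && (0 < p.1)%N, (p.1 == 0%N) && (j < p.2)%N,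
      [&& 0 < p.1, p.2 == j.+1 & i < p.1]%N | (0 < p.1)%N && (j.+1 < p.2)%N].

Definition sweep_seq i j := [seq p <- grid | sweep_idx i j p].

Let sweep_step i j : (i < m)%N -> (j < n)%N ->
  iexp P srate (sweep_fam i j) (sweep_seq i j) ->
  iexp P srate (sweep_fam i.+1 j) (sweep_seq i.+1 j).
Proof.
move=> im jn h.
(* The cell being passed: the bottom and left increments, stored at [u] and [v], become the top and
   right ones and consume the weight at [w]. *)
pose u : nat * nat := (i.+1, 0%N); pose v : nat * nat := (0%N, j.+1); pose w := (i.+1, j.+1).
pose s' := [seq p <- sweep_seq i.+1 j | (p != u) && (p != v)].
have s'P p : p \in s' -> [/\ p != u, p != v, sweep_idx i.+1 j p & p \in grid].
  by rewrite !mem_filter => /andP[/andP[-> ->] /andP[-> ->]].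
have us' : uniq [:: u, v, w & s'].
  rewrite /= !in_cons !negb_or !filter_uniq ?grid_uniq// !andbT.
  apply/and3P; split; [apply/and3P; split=> //| apply/andP; split=> // |].
  - by apply/eqP => -[].
  - by apply/negP => /s'P[]; rewrite eqxx.
  - by apply/negP => /s'P[_]; rewrite eqxx.
  - by apply/negP => /s'P[_ _]; rewrite /sweep_idx /= !ltnn andbF.
have ssub : {subset [:: u, v, w & s'] <= sweep_seq i j}.
  move=> p; rewrite !in_cons => /or4P[/eqP->|/eqP->|/eqP->|/s'P[_ _ pi pg]]; rewrite mem_filter mem_grid /=.
  - by rewrite /sweep_idx /= im.
  - by rewrite /sweep_idx /= ltnSn.
  - by rewrite /sweep_idx /= eqxx ltnSn im jn.
  - move: pg pi; rewrite mem_grid => ->; rewrite andbT /sweep_idx.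
    case/or4P=> [->//|->|/and3P[-> -> /ltnW->]|->]; by rewrite ?orbT.
have h3 := iexp_sub (filter_uniq _ grid_uniq) us' ssub srate_gt0 h.
apply: (@iexp_sub _ _ _ _ _ _ _ [:: u, v & s']); last first.
- apply: (burke_step rho0 rho1 us' srate_gt0 _ _ _ _ _ _ h3) => //.
  + rewrite /sweep_fam /= ltnn leqnn eqxx; apply/funext => t; rewrite lppSS /W -/w.
    by rewrite !maxEge; do 2 case: ifP; lra.
  + rewrite /sweep_fam /= eqxx ltnn; apply/funext => t; rewrite lppSS /W -/w.
    by rewrite !maxEge; do 2 case: ifP; lra.
  + move=> p /s'P[pu pv pidx _]; apply/funext => t; rewrite /sweep_fam.
    case: ifP => [/eqP p0|_].
      have pi : p.1 != i.+1 by apply: contraNneq pu => pi; rewrite /u -pi -p0; case: (p).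
      by rewrite leq_eqVlt (negbTE pi)/= ltnS.
    case: ifP => // /andP[/eqP p1 /eqP p2].
    by move: pv; rewrite /v -p1 -p2; case: (p) => ? ?; rewrite eqxx.
- exact: srate_gt0.
- move=> p; rewrite mem_filter => /andP[pidx pg]; rewrite !in_cons.
  case: (eqVneq p u) => //= pu; case: (eqVneq p v) => //= pv.
  by rewrite !mem_filter pu pv pidx.
- by rewrite filter_uniq// grid_uniq.
- by move: us' => /= /and4P[]; rewrite !in_cons !negb_or => /and3P[-> _ ->] /andP[_ ->] _ ->.
Qed.

Let sweep_row j : (j < n)%N -> iexp P srate (sweep_fam 0 j) (sweep_seq 0 j) ->
  iexp P srate (sweep_fam m j) (sweep_seq m j).
Proof.
move=> jn h; suff : forall i, (i <= m)%N -> iexp P srate (sweep_fam i j) (sweep_seq i j) by apply.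
by elim=> // i IH im; apply: sweep_step => //; apply: IH; exact: ltnW.
Qed.

(** At the end of a row its vertical increment is discarded; that of the next row starts at column 0
    as a bare axis weight. *)
Let sweep_next j : (j.+1 < n)%N -> iexp P srate (sweep_fam m j) (sweep_seq m j) ->
  iexp P srate (sweep_fam 0 j.+1) (sweep_seq 0 j.+1).
Proof.
move=> jn h; apply: (@iexp_eq _ _ _ _ _ srate _ (sweep_fam m j)) => //; last first.
  apply: iexp_sub h; rewrite ?filter_uniq ?grid_uniq//; last exact: srate_gt0.
  move=> p; rewrite !mem_filter => /andP[pidx ->]; rewrite andbT; move: pidx; rewrite /sweep_idx.
  case/or4P=> [->//|/andP[-> /ltnW->]|/and3P[-> /eqP-> _]|/andP[-> /ltnW ->]]; by rewrite ?ltnSn ?orbT.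
move=> p; rewrite mem_filter mem_grid /sweep_idx => /andP[pidx /andP[pm pn]].
apply/funext => t; rewrite /sweep_fam; case: ifP => [/eqP p0|p0].
  rewrite pm; move: pidx; rewrite p0 /= !andbF !orbF => pp; by rewrite leqNgt pp.
have -> : p.2 == j.+1 = false.
  apply/negbTE; move: pidx; rewrite p0 /=; apply: contraTneq => ->.
  by lia.
rewrite andbF; case: ifP => // /andP[/eqP p1 /eqP p2].
by rewrite lpp0S /W addrAC subrr add0r -p2 -p1; case: (p).
Qed.

Lemma stationary_row :
  iexp P srate X [seq p <- grid | p != (0, 0)%N] ->
  iexp P srate (fun p t => lpp (X^~ t) p.1 n - lpp (X^~ t) p.1.-1 n)
    [seq (k.+1, 0)%N | k <- iota 0 m].
Proof.
move=> h0.
have mem0 p : p \in [seq (k.+1, 0)%N | k <- iota 0 m] -> [/\ p.2 = 0%N, (0 < p.1)%N & (p.1 <= m)%N].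
  by case/mapP => k; rewrite mem_iota add0n => /andP[_ km] ->.
have uniq0 : uniq [seq (k.+1, 0)%N | k <- iota 0 m].
  by rewrite map_inj_uniq ?iota_uniq// => a b [].
(* On the axis itself the increments are the weights, and there is no row to sweep. *)
have [n0|n0] := posnP n.
  apply: (@iexp_eq _ _ _ _ _ srate _ X) => //; last first.
    apply: iexp_sub h0; rewrite ?filter_uniq ?grid_uniq//; last exact: srate_gt0.
    move=> p /mem0[p2 p1 pm]; rewrite mem_filter mem_grid pm p2 leq0n /= andbT.
    by apply: contraTneq p1 => ->.
  move=> p /mem0[p2 p1 pm]; apply/funext => t; rewrite n0.
  case: p p1 p2 {pm} => -[//|k] l /= _ ->.
  by rewrite lppS0 addrAC subrr add0r.
have hstart : iexp P srate (sweep_fam 0 0) (sweep_seq 0 0).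
  apply: (@iexp_eq _ _ _ _ _ srate _ X) => //; last first.
    apply: iexp_sub h0; rewrite ?filter_uniq ?grid_uniq//; last exact: srate_gt0.
    move=> p; rewrite !mem_filter => /andP[pidx ->]; rewrite andbT.
    by apply: contraTneq pidx => ->.
  move=> p; rewrite mem_filter /sweep_idx => /andP[pidx _]; apply/funext => t; rewrite /sweep_fam.
  case: ifP => [/eqP p0|p0].
    move: pidx; rewrite p0 /= !andbF !orbF => pp; rewrite leqNgt pp /=.
    case: p p0 pp => -[//|k] l /= -> _.
    by rewrite lppS0 /W addrAC subrr add0r.
  case: ifP => // /andP[/eqP p1 /eqP p2].
  by rewrite lpp0S lpp00 add0r subr0 /W -p2 -p1; case: (p).
have hall j : (j < n)%N -> iexp P srate (sweep_fam m j) (sweep_seq m j).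
  elim: j => [|j IH] jn; first exact: sweep_row.
  by apply: sweep_row => //; apply: sweep_next => //; apply: IH; exact: ltnW.
have := hall n.-1; rewrite prednK// => /(_ (leqnn _)) hn.
apply: (@iexp_eq _ _ _ _ _ srate _ (sweep_fam m n.-1)) => //; last first.
  apply: iexp_sub hn; rewrite ?filter_uniq ?grid_uniq//; last exact: srate_gt0.
  move=> p /mem0[p2 p1 pm]; rewrite mem_filter mem_grid pm p2 leq0n /= andbT.
  by rewrite /sweep_idx p2 p1.
move=> p /mem0[p2 p1 pm]; apply/funext => t.
by rewrite /sweep_fam p2 eqxx pm prednK.
Qed.

End stationary_model.

(** * Concentration of the stationary model at all places and in all directions *)

Section rost_bad_event.
Context (R : realType).

Lemma iexp_reindex d (T : measurableType d) (P : probability T R) (I J : eqType)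
    (r : I -> R) (X : I -> T -> R) (f : J -> I) (g : I -> J) (s : seq J) :
  cancel f g -> iexp P r X (map f s) -> iexp P (r \o f) (fun j => X (f j)) s.
Proof.
move=> fK [mX h]; split => [j sj|B mB]; first by apply: mX; exact: map_f.
have := h (B \o g) (fun i => mB _); rewrite big_map.
rewrite (eq_bigr (fun j => fine (exponential_prob ((r \o f) j) (B j)))); last first.
  by move=> j _; rewrite /= fK.
move=> <-; congr (P _); apply/seteqP; split => w hw i.
  by case/mapP => j sj ->; rewrite /= fK; exact: hw.
by move=> si; have := hw _ (map_f f si); rewrite /= fK.
Qed.

(* The weights seen from [(a, b)], with the axes rescaled to the stationary boundary rates. *)
Definition swt (x : nat * nat -> R) (rho : R) (a b : nat) (q : nat * nat) : R :=
  (srate rho q)^-1 * x (a + q.1, b + q.2)%N.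

Lemma iexp_swt d (T : measurableType d) (P : probability T R) (W : nat * nat -> T -> R)
    (m0 n0 a b m n : nat) (rho : R) : 0 < rho -> 0 < 1 - rho ->
  (a + m <= m0)%N -> (b + n <= n0)%N ->
  iexp P (fun=> 1) W (grid m0 n0) ->
  iexp P (srate rho) (fun q t => swt (W^~ t) rho a b q) [seq p <- grid m n | p != (0, 0)%N].
Proof.
move=> rho0 rho1 am bn h.
pose f (q : nat * nat) := (a + q.1, b + q.2)%N.
pose g (q : nat * nat) := (q.1 - a, q.2 - b)%N.
have fK : cancel f g by move=> [i j]; rewrite /g /= !addKn.
have h1 : iexp P (fun=> 1) W (map f [seq p <- grid m n | p != (0, 0)%N]).
  apply: iexp_sub h => //; first exact: grid_uniq.
    by rewrite map_inj_uniq; [rewrite filter_uniq// grid_uniq|exact: can_inj fK].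
  move=> p /mapP[q]; rewrite mem_filter mem_grid => /andP[_ /andP[qm qn]] ->.
  by rewrite mem_grid /= (leq_trans _ am) ?leq_add2l// (leq_trans _ bn) ?leq_add2l.
have h2 := iexp_reindex fK h1.
have sr0 := srate_gt0 rho0 rho1.
have := iexp_scale (c := fun q => (srate rho q)^-1) _ _ h2 => /(_ (fun=> ltr01) _)h3.
apply: iexp_eq (h3 _) => //.
- by move=> q _ /=; rewrite invrK mul1r.
- by move=> q; rewrite invr_gt0.
Qed.

Lemma union_bound d (T : measurableType d) (P : probability T R) (J : Type) (s : seq J)
    (F : J -> set T) (e : R) : (forall j, measurable (F j)) ->
  (forall j, (P (F j) <= e%:E)%E) ->
  measurable (\big[setU/set0]_(j <- s) F j) /\
  (P (\big[setU/set0]_(j <- s) F j) <= ((size s)%:R * e)%:E)%E.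
Proof.
move=> mF hF; elim: s => [|j s [IH1 IH2]]; first by rewrite big_nil measure0 mul0r.
rewrite big_cons; split; first exact: measurableU.
apply: (le_trans (measureU2 _ _ _)) => //.
by rewrite /= -natr1 mulrDl mul1r addrC EFinD leeD.
Qed.

Lemma measurable_lpp d (T : measurableType d) (X : nat * nat -> T -> R) m n :
  (forall p, (p.1 <= m)%N -> (p.2 <= n)%N -> p != (0, 0)%N -> measurable_fun setT (X p)) ->
  measurable_fun setT (fun t => lpp (X^~ t) m n).
Proof.
elim: n m => [|n IHn] m.
  elim: m => [|m IHm] mX; first exact: measurable_cst.
  apply: measurable_funD; last exact: mX.
  by apply: IHm => p pm pn p0; apply: mX => //; exact: leqW.
elim: m => [|m IHm] mX.
  apply: measurable_funD; last exact: mX.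
  by apply: IHn => p pm pn p0; apply: mX => //; exact: leqW.
apply: measurable_funD; last exact: mX.
apply: measurable_maxr.
  by apply: IHm => p pm pn p0; apply: mX => //; exact: leqW.
by apply: IHn => p pm pn p0; apply: mX => //; exact: leqW.
Qed.

(** The first column and the increments of row [n] are each i.i.d., but no joint law of the two sums
    is used: the deviation [2 * y] is split evenly between them. *)
Lemma stationary_tail d (T : measurableType d) (P : probability T R) (X : nat * nat -> T -> R)
    (rho t y : R) (m n : nat) (rho0 : 0 < rho) (rho1 : 0 < 1 - rho) :
  `|t| <= rho / 2 -> `|t| <= (1 - rho) / 2 ->
  iexp P (srate rho) X [seq p <- grid m n | p != (0, 0)%N] ->
  (P [set w | (t * (m%:R / (1 - rho) + n%:R / rho) + 2 * y <= t * lpp (X^~ w) m n)%R] <=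
   (expR (- y + 2 * n%:R * (t / rho) ^+ 2) + expR (- y + 2 * m%:R * (t / (1 - rho)) ^+ 2))%:E)%E.
Proof.
move=> t1 t2 h.
have mX p : (p.1 <= m)%N -> (p.2 <= n)%N -> p != (0, 0)%N -> measurable_fun setT (X p).
  by move=> pm pn p0; apply: h.1; rewrite mem_filter mem_grid p0 pm pn.
have mL := measurable_lpp mX.
have mL0 : measurable_fun setT (fun t => lpp (X^~ t) 0 n).
  by apply: measurable_lpp => p pm; apply: mX; exact: leq_trans pm _.
have h1 : iexp P (fun=> rho) X [seq (0, k.+1)%N | k <- iota 0 n].
  apply: (@iexp_eq _ _ _ _ _ (srate rho) _ X) => //.
    by move=> p /mapP[k _ ->].
  apply: iexp_sub h; rewrite ?filter_uniq ?grid_uniq//; last exact: srate_gt0.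
    by rewrite map_inj_uniq ?iota_uniq// => a b [].
  by move=> p /mapP[k]; rewrite mem_iota mem_filter mem_grid => kn -> /=.
have h2 : iexp P (fun=> 1 - rho) (fun p t => lpp (X^~ t) p.1 n - lpp (X^~ t) p.1.-1 n)
    [seq (k.+1, 0)%N | k <- iota 0 m].
  apply: iexp_eq (stationary_row rho0 rho1 h) => //.
  by move=> p /mapP[k _ ->].
have u1 : uniq [seq (0, k.+1)%N | k <- iota 0 n] by rewrite map_inj_uniq ?iota_uniq// => a b [].
have u2 : uniq [seq (k.+1, 0)%N | k <- iota 0 m] by rewrite map_inj_uniq ?iota_uniq// => a b [].
have := chernoff y rho0 t1 u1 h1; have := chernoff y rho1 t2 u2 h2.
rewrite !size_map !size_iota => c2 c1.
have E1 w : \sum_(i <- [seq (0, k.+1)%N | k <- iota 0 n]) X i w = lpp (X^~ w) 0 n.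
  by rewrite big_map lpp_col0 -(big_mkord xpredT (fun k => X (0, k.+1)%N w)) /index_iota subn0.
have E2 w : \sum_(i <- [seq (k.+1, 0)%N | k <- iota 0 m]) (lpp (X^~ w) i.1 n - lpp (X^~ w) i.1.-1 n) =
    lpp (X^~ w) m n - lpp (X^~ w) 0 n.
  rewrite big_map [in RHS]lpp_telescope addrAC subrr add0r.
  by rewrite -(big_mkord xpredT (fun k => lpp (X^~ w) k.+1 n - lpp (X^~ w) k n)) /index_iota subn0.
have mset (Z : T -> R) z : measurable_fun setT Z -> measurable [set w | (z <= t * Z w)%R].
  move=> mZ; have mZ' : measurable_fun setT (fun w => t * Z w) by exact: measurable_funM.
  have := mZ' measurableT _ (measurable_itv `[z, +oo[); rewrite setTI.
  by congr measurable; apply/seteqP; split => w /=; rewrite in_itv/= andbT.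
rewrite EFinD; apply: le_trans (leeD c1 c2).
have m1 : measurable [set w | (t * (n%:R / rho) + y <= t * \sum_(i <- [seq (0, k.+1)%N | k <- iota 0 n]) X i w)%R].
  by under eq_set do rewrite E1; exact: mset.
have m2 : measurable [set w | (t * (m%:R / (1 - rho)) + y <= t * \sum_(i <- [seq (k.+1, 0)%N | k <- iota 0 m])
     (lpp (X^~ w) i.1 n - lpp (X^~ w) i.1.-1 n))%R].
  by under eq_set do rewrite E2; apply: mset; exact: measurable_funB.
apply: (le_trans _ (measureU2 _ m1 m2)); apply: le_measure; rewrite ?inE//.
- exact: mset.
- exact: measurableU.
move=> w /=; rewrite E1 E2 => hw.
have [|hh] := leP (t * (n%:R / rho) + y) (t * lpp (X^~ w) 0 n); first by left.
by right; rewrite mulrBr; move: hw hh; rewrite mulrDr; lra.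
Qed.

Lemma stationary_deviation (eps r K : R) : 0 < eps -> 0 < r -> 0 < K ->
  exists2 c, 0 < c & forall (N m n : nat) (rho : R) d (T : measurableType d)
    (P : probability T R) (X : nat * nat -> T -> R),
  r <= rho <= 1 - r -> m%:R <= K * N%:R -> n%:R <= K * N%:R ->
  iexp P (srate rho) X [seq p <- grid m n | p != (0, 0)%N] ->
  let A := [set w | eps * N%:R <= `|lpp (X^~ w) m n - (m%:R / (1 - rho) + n%:R / rho)|] in
  measurable A /\ (P A <= (4 * expR (- (c * N%:R)))%:E)%E.
Proof.
move=> eps0 r0 K0.
(* The first bound admits [t] in Chernoff's inequality for every [rho] in [[r, 1 - r]]; the second
   keeps the quadratic error to half of the gain [th * eps / 2] per unit of [N]. *)
pose th := Num.min (r / 2) (eps * r ^+ 2 / (8 * K)).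
have th0 : 0 < th.
  by rewrite lt_min divr_gt0//= divr_gt0// ?mulr_gt0// exprn_gt0.
have thr : th <= r / 2 by rewrite ge_min lexx.
have thK : 2 * K * (th / r) ^+ 2 <= th * eps / 4.
  have h : th <= eps * r ^+ 2 / (8 * K) by rewrite ge_min lexx orbT.
  have -> : 2 * K * (th / r) ^+ 2 = th * (2 * K / r ^+ 2) * th by field; rewrite gt_eqF.
  apply: (@le_trans _ _ (th * (2 * K / r ^+ 2) * (eps * r ^+ 2 / (8 * K)))).
    rewrite ler_wpM2l// mulr_ge0 ?(ltW th0)// divr_ge0 ?mulr_ge0 ?sqr_ge0// ltW//.
  rewrite le_eqVlt; apply/orP; left; apply/eqP; field.
  by rewrite (gt_eqF r0) (gt_eqF K0).
exists (th * eps / 4); first by rewrite divr_gt0// mulr_gt0.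
move=> N m n rho d T P X /andP[rho_ge rho_le] mK nK h.
have rho0 : 0 < rho by apply: lt_le_trans rho_ge.
have rho1 : 0 < 1 - rho by move: r0 rho_le; lra.
set mu := m%:R / (1 - rho) + n%:R / rho.
move=> A.
have mX p : (p.1 <= m)%N -> (p.2 <= n)%N -> p != (0, 0)%N -> measurable_fun setT (X p).
  by move=> pm pn p0; apply: h.1; rewrite mem_filter mem_grid p0 pm pn.
have mL := measurable_lpp mX.
have mset (f : T -> R) z : measurable_fun setT f -> measurable [set w | (z <= f w)%R].
  move=> mZ; have := mZ measurableT _ (measurable_itv `[z, +oo[); rewrite setTI.
  by congr measurable; apply/seteqP; split => w /=; rewrite in_itv/= andbT.
have mA : measurable A.
  by apply: mset; apply: measurableT_comp => //; exact: measurable_funB.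
split=> //.
have tail t : `|t| = th ->
    (P [set w | (t * mu + 2 * (th * eps * N%:R / 2) <= t * lpp (X^~ w) m n)%R] <=
     (2 * expR (- (th * eps / 4 * N%:R)))%:E)%E.
  move=> tth.
  have t1 : `|t| <= rho / 2 by rewrite tth; move: thr rho_ge; lra.
  have t2 : `|t| <= (1 - rho) / 2 by rewrite tth; move: thr rho_le; lra.
  apply: le_trans (stationary_tail (th * eps * N%:R / 2) rho0 rho1 t1 t2 h) _.
  have bnd (z : R) (k : nat) : r <= z -> k%:R <= K * N%:R ->
      - (th * eps * N%:R / 2) + 2 * k%:R * (t / z) ^+ 2 <= - (th * eps / 4 * N%:R).
    move=> rz kK; have z0 : 0 < z by exact: lt_le_trans rz.
    have : 2 * k%:R * (t / z) ^+ 2 <= (2 * K * (th / r) ^+ 2) * N%:R.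
      have -> : (2 * K * (th / r) ^+ 2) * N%:R = (2 * (K * N%:R)) * (th / r) ^+ 2 by ring.
      apply: ler_pM; rewrite ?sqr_ge0 ?mulr_ge0 ?ler0n//.
        by rewrite ler_wpM2l.
      rewrite -real_normK ?num_real// lerXn2r ?nnegrE ?normr_ge0 ?divr_ge0 ?(ltW th0) ?(ltW r0)//.
      rewrite normrM tth normfV (gtr0_norm z0) ler_wpM2l ?(ltW th0)// lef_pV2//.
    move=> h1; have := ler_wpM2r (ler0n R N) thK; lra.
  rewrite lee_fin [leRHS]mulr_natl mulr2n; apply: lerD; rewrite ler_expR; apply: bnd => //.
  by move: rho_le; lra.
have th_ge0 := ltW th0.
have tailp := tail th (ger0_norm th_ge0).
have := tail (- th); rewrite normrN (ger0_norm th_ge0) => /(_ erefl) tailm.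
have -> : 4 * expR (- (th * eps / 4 * N%:R)) =
    2 * expR (- (th * eps / 4 * N%:R)) + 2 * expR (- (th * eps / 4 * N%:R)) by ring.
rewrite EFinD; apply: le_trans (leeD tailp tailm).
have m1 : measurable [set w | (th * mu + 2 * (th * eps * N%:R / 2) <= th * lpp (X^~ w) m n)%R].
  by apply: mset; exact: measurable_funM.
have m2 : measurable [set w | (- th * mu + 2 * (th * eps * N%:R / 2) <= - th * lpp (X^~ w) m n)%R].
  by apply: mset; exact: measurable_funM.
apply: (le_trans _ (measureU2 _ m1 m2)); apply: le_measure; rewrite ?inE//.
  exact: measurableU.
move=> w; rewrite /A /= => hw; set L := lpp _ _ _ in hw *.
have [Lmu|Lmu] := leP mu L; [left|right].
  by move: hw; rewrite ger0_norm ?subr_ge0// => hw; have := ler_wpM2l th_ge0 hw; lra.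
by move: hw; rewrite ltr0_norm ?subr_lt0// => hw; have := ler_wpM2l th_ge0 hw; lra.
Qed.

(** Six integers of order [N] describe the starting point, the sides of the rectangle and the
    direction [(m, n)] that selects [rho]. The union bound thus costs a sixth power, paid for with
    half of the exponent. *)
Lemma bad_event (eps r K : R) : 0 < eps -> 0 < r -> 0 < K ->
  exists c C : R, [/\ 0 < c, 0 < C & forall (N m0 n0 : nat) (rho : nat -> nat -> R)
    d (T : measurableType d) (P : probability T R) (W : nat * nat -> T -> R),
  m0%:R <= K * N%:R -> n0%:R <= K * N%:R ->
  (forall m n, r <= rho m n <= 1 - r) ->
  iexp P (fun=> 1) W (grid m0 n0) ->
  exists Bad : set T, [/\ measurable Bad, (P Bad <= (C * expR (- (c * N%:R)))%:E)%E &
    forall w, ~ Bad w -> (forall p, p \in grid m0 n0 -> 0 <= W p w) /\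
      forall m n a b i j, (m <= m0)%N -> (n <= n0)%N -> (a + i <= m0)%N -> (b + j <= n0)%N ->
      `|lpp (swt (W^~ w) (rho m n) a b) i j - (i%:R / (1 - rho m n) + j%:R / rho m n)| < eps * N%:R]].
Proof.
move=> eps0 r0 K0; have [c0 c00 hc] := stationary_deviation eps0 r0 K0.
(* With these, [M.+1] is at most [C1 * expR (c1 * N)], so its sixth power costs a factor
   [expR (c0 / 2 * N)]. *)
pose c1 := c0 / 12; pose C1 := 1 + K / c1.
have c10 : 0 < c1 by rewrite divr_gt0.
have C10 : 0 < C1 by rewrite addr_gt0// divr_gt0.
exists (c0 / 2), (4 * C1 ^+ 6); split; rewrite ?divr_gt0// ?mulr_gt0 ?exprn_gt0//.
move=> N m0 n0 rho d T P W m0K n0K rhor h.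
pose M := maxn m0 n0.
pose J := ('I_M.+1 * 'I_M.+1 * ('I_M.+1 * 'I_M.+1) * ('I_M.+1 * 'I_M.+1))%type.
pose F (z : J) : set T :=
  let: (m, n, (a, b), (i, j)) := z in
  if (a + i <= m0)%N && (b + j <= n0)%N then
    [set w | eps * N%:R <= `|lpp (swt (W^~ w) (rho m n) a b) i j -
       (i%:R / (1 - rho m n) + j%:R / rho m n)|] else set0.
have hF z : measurable (F z) /\ (P (F z) <= (4 * expR (- (c0 * N%:R)))%:E)%E.
  case: z => -[[m n] [a b]] [i j]; rewrite /F; case: ifP => [/andP[am bn]|_]; last first.
    by rewrite measure0 lee_fin mulr_ge0 ?expR_ge0.
  have /andP[r1 r2] := rhor m n.
  have rho0 : 0 < rho m n by apply: lt_le_trans r1.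
  have rho1 : 0 < 1 - rho m n by move: r0 r2; lra.
  apply: (hc N i j _ _ _ _ (fun q t => swt (W^~ t) (rho m n) a b q)) => //.
  - apply: le_trans m0K; rewrite ler_nat; exact: leq_trans (leq_addl _ _) am.
  - apply: le_trans n0K; rewrite ler_nat; exact: leq_trans (leq_addl _ _) bn.
  - exact: (iexp_swt rho0 rho1 am bn h).
have [mBF PBF] := union_bound (enum {: J}) (fun z => (hF z).1) (fun z => (hF z).2).
(* Weights are nonnegative only almost surely; the null events where one is negative join the bad
   event. *)
pose G (p : nat * nat) : set T := if p \in grid m0 n0 then [set w | W p w < 0] else set0.
have hG p : measurable (G p) /\ (P (G p) <= 0%:E)%E.
  rewrite /G; case: ifP => [pg|_]; last by rewrite measure0.
  have GE : [set w | W p w < 0] = box W (fun=> `]-oo, (0:R)[%classic) [:: p].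
    apply/seteqP; split => w /=; first by move=> wp i; rewrite inE => /eqP->; rewrite /= in_itv.
    by move=> /(_ p); rewrite mem_head /= in_itv /=; apply.
  have [mW hW] : iexp P (fun=> 1) W [:: p].
    by apply: iexp_sub h; rewrite ?grid_uniq// => q; rewrite inE => /eqP->.
  rewrite GE; split; first by apply: measurable_box.
  rewrite hW// big_seq1.
  suff -> : exponential_prob (1 : R) `]-oo, (0:R)[ = 0%E by [].
  rewrite /exponential_prob; apply: integral0_eq => x /=; rewrite in_itv/= => x0.
  by rewrite lt0_exponential_pdf.
have [mBG PBG] := union_bound (grid m0 n0) (fun z => (hG z).1) (fun z => (hG z).2).
exists ((\big[setU/set0]_(z <- enum {: J}) F z) `|` (\big[setU/set0]_(z <- grid m0 n0) G z)); split.
- exact: measurableU.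
- apply: (le_trans (measureU2 _ mBF mBG)).
  move: PBG; rewrite mulr0 => PBG.
  apply: (le_trans (leeD PBF PBG)); rewrite adde0 lee_fin.
  rewrite -cardE !card_prod !card_ord.
  have M1 : (M.+1)%:R <= C1 * expR (c1 * N%:R).
    have : 1 + c1 * N%:R <= expR (c1 * N%:R) by exact: expR_ge1Dx.
    have MK : M%:R <= K * N%:R by rewrite /M; case: (leqP m0 n0).
    move=> hh; apply: (@le_trans _ _ (C1 * (1 + c1 * N%:R))); last by rewrite ler_wpM2l// ltW.
    rewrite -natr1 /C1.
    have -> : (1 + K / c1) * (1 + c1 * N%:R) = 1 + c1 * N%:R + K / c1 + K * N%:R.
      by field; rewrite gt_eqF.
    have : 0 <= c1 * N%:R by rewrite mulr_ge0// ltW.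
    have : 0 <= K / c1 by rewrite divr_ge0// ltW.
    lra.
  have -> : 4 * C1 ^+ 6 * expR (- (c0 / 2 * N%:R)) =
      (C1 * expR (c1 * N%:R)) ^+ 6 * (4 * expR (- (c0 * N%:R))).
    rewrite exprMn -expRM_natl mulrACA [X in _ = X * _]mulrC; congr (_ * _).
    by rewrite -expRD; congr expR; rewrite /c1 -mulr_natl; field.
  rewrite ler_wpM2r ?mulr_ge0 ?expR_ge0//.
  have -> : (M.+1 * M.+1 * (M.+1 * M.+1) * (M.+1 * M.+1) = M.+1 ^ 6)%N by ring.
  by rewrite natrX lerXn2r// nnegrE ?ler0n// mulr_ge0 ?expR_ge0// ltW.
- move=> w nB; split.
    move=> p pg; rewrite leNgt; apply/negP => Wp; apply: nB; right.
    rewrite -bigcup_seq; exists p => //; by rewrite /G pg.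
  move=> m n a b i j mm nn ai bj; rewrite ltNge; apply/negP => hh; apply: nB; left.
  rewrite -bigcup_seq.
  have le_M (k : nat) : (k <= m0)%N || (k <= n0)%N -> (k < M.+1)%N by rewrite ltnS /M leq_max.
  have m1 : (m < M.+1)%N by rewrite le_M// mm.
  have n1 : (n < M.+1)%N by rewrite le_M// nn orbT.
  have a1 : (a < M.+1)%N by rewrite le_M// (leq_trans _ ai) ?leq_addr.
  have b1 : (b < M.+1)%N by rewrite le_M// (leq_trans _ bj) ?leq_addr// orbT.
  have i1 : (i < M.+1)%N by rewrite le_M// (leq_trans _ ai) ?leq_addl.
  have j1 : (j < M.+1)%N by rewrite le_M// (leq_trans _ bj) ?leq_addl// orbT.
  exists (Ordinal m1, Ordinal n1, (Ordinal a1, Ordinal b1), (Ordinal i1, Ordinal j1)) => /=.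
    by rewrite mem_enum.
  by rewrite ai bj.
Qed.

End rost_bad_event.

(** * Point-to-point estimates for homogeneous weights *)

Section rost.
Context (R : realType).
Implicit Types (x : nat * nat -> R) (K N : R).

Definition shape (a b : R) : R := (Num.sqrt a + Num.sqrt b) ^+ 2.

Lemma shapeC (a b : R) : shape a b = shape b a. Proof. by rewrite /shape addrC. Qed.

(** The minimizer [sqrt n / (sqrt m + sqrt n)] of the stationary speed, with both side lengths
    raised to at least [h] to keep it away from 0 and 1. *)
Definition rho_of (h : R) (m n : nat) : R :=
  Num.sqrt (Num.max n%:R h) / (Num.sqrt (Num.max m%:R h) + Num.sqrt (Num.max n%:R h)).

Lemma sqrt_max_le (a h : R) : 0 <= a -> 0 <= h ->
  Num.sqrt (Num.max a h) <= Num.sqrt a + Num.sqrt h.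
Proof. by move=> a0 h0; have [ah|ha] := leP a h; rewrite ?lerDl ?lerDr ?sqrtr_ge0. Qed.

Lemma rho_ofP (h K : R) (m n : nat) : 0 < h -> h <= K -> m%:R <= K -> n%:R <= K ->
  let r := Num.sqrt (h / K) / 2 in
  [/\ 0 < r, r <= rho_of h m n & rho_of h m n <= 1 - r].
Proof.
move=> h0 hK mK nK r; have K0 : 0 < K by exact: lt_le_trans hK.
rewrite /rho_of; set A := Num.sqrt (Num.max m%:R h); set B := Num.sqrt (Num.max n%:R h).
have sh0 : 0 < Num.sqrt h by rewrite sqrtr_gt0.
have sK0 : 0 < Num.sqrt K by rewrite sqrtr_gt0.
have A1 : Num.sqrt h <= A by rewrite ler_wsqrtr// le_max lexx orbT.
have B1 : Num.sqrt h <= B by rewrite ler_wsqrtr// le_max lexx orbT.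
have A2 : A <= Num.sqrt K by rewrite ler_wsqrtr// ge_max mK.
have B2 : B <= Num.sqrt K by rewrite ler_wsqrtr// ge_max nK.
have rE : r = Num.sqrt h / Num.sqrt K / 2 by rewrite /r sqrtrM ?(ltW h0)// sqrtrV// ltW.
have AB0 : 0 < A + B by lra.
have key (Z : R) : Num.sqrt h <= Z -> r <= Z / (A + B).
  move=> hZ; rewrite rE ler_pdivlMr//.
  have -> : Num.sqrt h / Num.sqrt K / 2 * (A + B) = Num.sqrt h * ((A + B) / (2 * Num.sqrt K)).
    by field; rewrite gt_eqF.
  apply: le_trans hZ; rewrite ler_piMr ?(ltW sh0)// ler_pdivrMr ?mulr_gt0//; lra.
split.
- by rewrite rE !divr_gt0.
- exact: key.
- have -> : B / (A + B) = 1 - A / (A + B) by field; rewrite gt_eqF.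
  by rewrite lerD2l lerN2; exact: key.
Qed.

(** The speed increases with [m] and [n]; at the raised values [rho_of] is the exact minimizer, and
    the minimum is the shape function. *)
Lemma rho_of_speed (h : R) (m n : nat) : 0 < h ->
  m%:R / (1 - rho_of h m n) + n%:R / rho_of h m n <= shape (Num.max m%:R h) (Num.max n%:R h).
Proof.
move=> h0; rewrite /rho_of /shape; set a := Num.max m%:R h; set b := Num.max n%:R h.
have a0 : 0 < a by rewrite lt_max h0 orbT.
have b0 : 0 < b by rewrite lt_max h0 orbT.
have ma : m%:R <= a by rewrite le_max lexx.
have nb : n%:R <= b by rewrite le_max lexx.
move: (sqr_sqrtr (ltW a0)) (sqr_sqrtr (ltW b0)).
have : 0 < Num.sqrt a by rewrite sqrtr_gt0.
have : 0 < Num.sqrt b by rewrite sqrtr_gt0.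
move: (Num.sqrt a) (Num.sqrt b) => A B B0 A0 AE BE.
have AB0 : 0 < A + B by rewrite addr_gt0.
have -> : m%:R / (1 - B / (A + B)) + n%:R / (B / (A + B)) =
    m%:R * ((A + B) / A) + n%:R * ((A + B) / B).
  have -> : 1 - B / (A + B) = A / (A + B) by field; rewrite gt_eqF.
  by rewrite !invf_div.
have -> : (A + B) ^+ 2 = A ^+ 2 * ((A + B) / A) + B ^+ 2 * ((A + B) / B).
  by field; rewrite (gt_eqF A0) (gt_eqF B0).
by rewrite AE BE; apply: lerD; rewrite ler_wpM2r// divr_ge0// ltW.
Qed.

Lemma swt_ge x (rho : R) (a b : nat) q : 0 < rho -> 0 < 1 - rho ->
  0 <= x (a + q.1, b + q.2)%N -> x (a + q.1, b + q.2)%N <= swt x rho a b q.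
Proof.
move=> rho0 rho1 x0; rewrite /swt ler_peMl// -[leLHS]invr1 lef_pV2 ?posrE ?srate_gt0//.
by rewrite /srate; case: ifP => _; [lra|case: ifP => _ //; lra].
Qed.

(** Stationary rates are at most 1, so the rescaling only enlarges nonnegative weights. *)
Lemma psum_le_swt x (rho : R) (a b m0 n0 : nat) s : 0 < rho -> 0 < 1 - rho ->
  (forall p, p \in grid m0 n0 -> 0 <= x p) ->
  (a + count id s <= m0)%N -> (b + count negb s <= n0)%N ->
  psum x (a, b) s <= lpp (swt x rho a b) (count id s) (count negb s).
Proof.
move=> rho0 rho1 x0 am bn; apply: le_trans (psum_le_lpp _ _).
have -> : (a, b) = (a + (0, 0)%N.1, b + (0, 0)%N.2)%N by rewrite !addn0.
rewrite -psum_shift; apply: ler_psum => -[i j]; rewrite /pend /= !add0n => im jn _.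
apply: (@swt_ge x rho a b (i, j)) => //; apply: x0; rewrite mem_grid /=.
by rewrite (leq_trans _ am) ?leq_add2l// (leq_trans _ bn) ?leq_add2l.
Qed.

Lemma rost_upper (eps K : R) : 0 < eps -> 0 < K ->
  exists c C : R, [/\ 0 < c, 0 < C & forall (N m0 n0 : nat)
    d (T : measurableType d) (P : probability T R) (W : nat * nat -> T -> R),
  (0 < N)%N -> m0%:R <= K * N%:R -> n0%:R <= K * N%:R ->
  iexp P (fun=> 1) W (grid m0 n0) ->
  exists Bad : set T, [/\ measurable Bad, (P Bad <= (C * expR (- (c * N%:R)))%:E)%E &
    forall w, ~ Bad w -> forall a b s,
      (a + count id s <= m0)%N -> (b + count negb s <= n0)%N ->
      psum (W^~ w) (a, b) s <= shape (count id s)%:R (count negb s)%:R + eps * N%:R]].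
Proof.
move=> eps0 K0.
(* Raising the sides to [eta * N] adds to the shape terms of order [eta * N] and
   [sqrt (K * eta) * N]; the last two bounds make the sum at most [eps / 2 * N], the first keeps the
   cutoff below [K * N]. *)
pose eta := Num.min K (Num.min (eps / 16) ((eps / 32) ^+ 2 / K)).
have e320 : 0 < eps / 32 by rewrite divr_gt0.
have eta0 : 0 < eta.
  rewrite /eta !lt_min K0 /=; apply/andP; split; first by rewrite divr_gt0.
  by apply: divr_gt0 => //; exact: exprn_gt0.
have etaK : eta <= K by rewrite ge_min lexx.
have eta1 : eta <= eps / 16 by rewrite !ge_min lexx orbT.
have eta2 : eta <= (eps / 32) ^+ 2 / K by rewrite !ge_min lexx !orbT.
have sK : Num.sqrt (K * eta) <= eps / 32.
  rewrite -(@ger0_norm _ (eps / 32)) ?(ltW e320)// -sqrtr_sqr ler_wsqrtr//.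
  by rewrite mulrC -ler_pdivlMr.
pose r := Num.sqrt (eta / K) / 2.
have r0 : 0 < r by rewrite divr_gt0// sqrtr_gt0 divr_gt0.
have eps20 : 0 < eps / 2 by rewrite divr_gt0.
have [c [C [c0 C0 hc]]] := bad_event eps20 r0 K0.
exists c, C; split => // N m0 n0 d T P W N0 m0K n0K h.
have NR0 : 0 < N%:R :> R by rewrite ltr0n.
pose eN := eta * N%:R.
have eN0 : 0 < eN by rewrite mulr_gt0.
have eNK : eN <= K * N%:R by rewrite ler_wpM2r// ltW.
(* Truncation by [minn] bounds [rho] for all arguments, as the uniform estimate demands, and changes
   nothing for sides within the grid. *)
pose rho m n := rho_of eN (minn m m0) (minn n n0).
have minK (k k0 : nat) : k0%:R <= K * N%:R -> (minn k k0)%:R <= K * N%:R.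
  by apply: le_trans; rewrite ler_nat geq_minr.
have rE : Num.sqrt (eN / (K * N%:R)) / 2 = r.
  by rewrite /eN /r; congr (Num.sqrt _ / 2); field; rewrite !gt_eqF.
have rhoP m n : r <= rho m n <= 1 - r.
  have := rho_ofP eN0 eNK (minK m _ m0K) (minK n _ n0K).
  by rewrite /= rE => -[_ h1 h2]; rewrite h1.
have [Bad [mBad PBad hBad]] := hc N m0 n0 rho d T P W m0K n0K rhoP h.
exists Bad; split => // w /hBad[W0 hw] a b s am bn.
set i := count id s in am *; set j := count negb s in bn *.
have im : (i <= m0)%N by exact: leq_trans (leq_addl _ _) am.
have jn : (j <= n0)%N by exact: leq_trans (leq_addl _ _) bn.
have /andP[rho_ge rho_le] := rhoP i j.
have rho0 : 0 < rho i j by exact: lt_le_trans rho_ge.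
have rho1 : 0 < 1 - rho i j by move: r0 rho_le; lra.
apply: le_trans (psum_le_swt rho0 rho1 W0 am bn) _.
have := hw i j a b i j im jn am bn; rewrite ltr_norml => /andP[_ hlt].
have sp := rho_of_speed i j eN0.
have rhoE : rho i j = rho_of eN i j by rewrite /rho !(minn_idPl _).
rewrite rhoE in hlt *.
have iK : i%:R <= K * N%:R by apply: le_trans m0K; rewrite ler_nat.
have jK : j%:R <= K * N%:R by apply: le_trans n0K; rewrite ler_nat.
suff : shape (Num.max i%:R eN) (Num.max j%:R eN) <= shape i%:R j%:R + eps / 2 * N%:R.
  by move: hlt sp; rewrite -/i -/j; lra.
have := sqrt_max_le (ler0n R i) (ltW eN0).
have := sqrt_max_le (ler0n R j) (ltW eN0).
have : Num.sqrt i%:R <= Num.sqrt (K * N%:R) by rewrite ler_wsqrtr.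
have : Num.sqrt j%:R <= Num.sqrt (K * N%:R) by rewrite ler_wsqrtr.
have sqeN : Num.sqrt eN * Num.sqrt eN = eN by rewrite -expr2 sqr_sqrtr// ltW.
have sqKe : Num.sqrt (K * N%:R) * Num.sqrt eN <= eps / 32 * N%:R.
  rewrite -sqrtrM ?mulr_ge0 ?(ltW K0)//.
  have -> : K * N%:R * eN = (K * eta) * N%:R ^+ 2 by rewrite /eN; ring.
  by rewrite sqrtrM ?mulr_ge0 ?(ltW K0) ?(ltW eta0)// sqrtr_sqr ger0_norm// ler_wpM2r.
rewrite /shape.
have := sqrtr_ge0 (i%:R : R); have := sqrtr_ge0 (j%:R : R); have := sqrtr_ge0 eN.
have := sqrtr_ge0 (Num.max i%:R eN); have := sqrtr_ge0 (Num.max j%:R eN).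
have := sqrtr_ge0 (K * N%:R).
have eNe : eN <= eps / 16 * N%:R by rewrite ler_wpM2r.
move: sqeN sqKe eNe.
move: (Num.sqrt i%:R) (Num.sqrt j%:R) (Num.sqrt eN) (Num.sqrt (K * N%:R)) => a1 b1 e k.
move: (Num.sqrt (Num.max i%:R eN)) (Num.sqrt (Num.max j%:R eN)) => a2 b2.
move=> eE kE eNe k0 b20 a20 e0 b10 a10 b1k a1k b2h a2h.
have : (a2 + b2) ^+ 2 <= (a1 + b1 + 2 * e) ^+ 2.
  by rewrite lerXn2r ?nnegrE ?addr_ge0 ?mulr_ge0//; lra.
have : (a1 + b1) * e <= 2 * (k * e).
  by have := ler_wpM2r e0 a1k; have := ler_wpM2r e0 b1k; lra.
have -> : (a1 + b1 + 2 * e) ^+ 2 = (a1 + b1) ^+ 2 + 4 * ((a1 + b1) * e) + 4 * (e * e) by ring.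
by rewrite eE; lra.
Qed.

Lemma psum_ge0 x (m0 n0 : nat) p s : (forall q, q \in grid m0 n0 -> 0 <= x q) ->
  ((pend p s).1 <= m0)%N -> ((pend p s).2 <= n0)%N -> 0 <= psum x p s.
Proof.
move=> x0; elim: s p => [//|e s IH] p; rewrite pend_cons => p1 p2 /=.
apply: addr_ge0; last exact: IH.
apply: x0; rewrite mem_grid (leq_trans _ p1) ?(leq_trans _ p2)//=; exact: leq_addr.
Qed.

Lemma psum_row x k : psum x (0, 0)%N (nseq k true) = lpp x k 0.
Proof.
elim: k => [//|k IH]; rewrite -[k.+1]addn1 nseqD psum_cat IH addn1 lppS0 /= addr0.
by rewrite /pend /= count_nseq mul1n count_nseq mul0n.
Qed.

Lemma psum_col x k : psum x (0, 0)%N (nseq k false) = lpp x 0 k.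
Proof.
elim: k => [//|k IH]; rewrite -[k.+1]addn1 nseqD psum_cat IH addn1 lpp0S /= addr0.
by rewrite /pend /= count_nseq mul0n count_nseq mul1n.
Qed.

Lemma lpp_swt_row x rho a b k :
  lpp (swt x rho a b) k 0 = (1 - rho)^-1 * psum x (a, b) (nseq k true).
Proof.
rewrite -psum_row.
have -> : (a, b) = (a + (0, 0)%N.1, b + (0, 0)%N.2)%N by rewrite !addn0.
rewrite -psum_shift; pose z := 0%N; rewrite -[(0, 0)%N]/(z, 0%N).
elim: k z => [|k IH] z /=; first by rewrite mulr0.
by rewrite mulrDr -IH.
Qed.

Lemma lpp_swt_col x rho a b k :
  lpp (swt x rho a b) 0 k = rho^-1 * psum x (a, b) (nseq k false).
Proof.
rewrite -psum_col.
have -> : (a, b) = (a + (0, 0)%N.1, b + (0, 0)%N.2)%N by rewrite !addn0.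
rewrite -psum_shift; pose z := 0%N; rewrite -[(0, 0)%N]/(0%N, z).
elim: k z => [|k IH] z /=; first by rewrite mulr0.
by rewrite mulrDr -IH.
Qed.

(** Off the axes the weights are not rescaled, and an up-right path that has left them never
    returns. *)
Lemma swt_interior x rho a b i j s : (0 < i)%N -> (0 < j)%N ->
  psum (swt x rho a b) (i, j) s = psum x (a + i, b + j)%N s.
Proof.
move=> i0 j0; rewrite -(psum_shift x a b (i, j)).
elim: s i j i0 j0 => [//|e s IH] i j i0 j0 /=; case: e => /=; rewrite IH//; congr (_ + _);
  by rewrite /swt /srate /= ?(gtn_eqF i0) ?(gtn_eqF j0) /= invr1 mul1r.
Qed.

(** Isolates the initial run along an axis of a path that has steps of both kinds. *)
Lemma run_split (e : bool) s : has (predC1 e) (e :: s) ->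
  exists k t, e :: s = nseq k.+1 e ++ ~~ e :: t.
Proof.
elim: s => [|e' s IH]; first by rewrite /= eqxx.
rewrite [has _ _]/= eqxx /=; case: (eqVneq e' e) => [->|e'e] /= h; last first.
  by exists 0%N, s; rewrite /=; congr [:: _, _ & _]; case: e' e e'e {IH h} => -[].
have [|k [t kt]] := IH; first by rewrite /= eqxx.
by exists k.+1, t; rewrite kt.
Qed.

(* The loss of a path which leaves the axis only after [k] steps is [(B / A) (A - A') ^ 2]
   where [A' ^ 2 = A ^ 2 - k]. *)
Lemma exit_gap (A B D k M e r kap K : R) : 0 < M -> 0 < A -> 0 < B -> 0 < K ->
  0 < r -> 0 < kap -> 0 < D -> A <= D -> D ^+ 2 = K * M -> 2 * r * A <= B ->
  k <= A ^+ 2 -> kap * M < k -> 6 * K * e <= r * kap ^+ 2 ->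
  k * ((A + B) / A) + (Num.sqrt (A ^+ 2 - k) + B) ^+ 2 + 3 * e * M <= (A + B) ^+ 2.
Proof.
move=> M0 A0 B0 K0 r0 kap0 D0 AD DE rAB kA kapk eK.
have := sqr_sqrtr (_ : 0 <= A ^+ 2 - k); rewrite subr_ge0 => /(_ kA).
have := sqrtr_ge0 (A ^+ 2 - k); move: (Num.sqrt _) => A' A'0 A'E.
have kE : k = A ^+ 2 - A' ^+ 2 by rewrite A'E; ring.
have k0 : 0 < k by apply: lt_trans kapk; rewrite mulr_gt0.
have A'A : A' <= A.
  rewrite -(@ler_pXn2r _ 2)// ?nnegrE ?(ltW A0)//; move: k0; rewrite kE; lra.
have -> : (A + B) ^+ 2 = k * ((A + B) / A) + (A' + B) ^+ 2 + B / A * (A - A') ^+ 2.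
  by rewrite kE; field; rewrite gt_eqF.
rewrite lerD2l.
have dge : kap * M / (2 * D) <= A - A'.
  rewrite ler_pdivrMr ?mulr_gt0//; apply: (le_trans (ltW kapk)).
  have -> : k = (A - A') * (A + A') by rewrite kE; ring.
  by rewrite ler_wpM2l ?subr_ge0//; move: AD A'A; lra.
have BA : 2 * r <= B / A by rewrite ler_pdivlMr.
apply: (@le_trans _ _ (2 * r * (kap * M / (2 * D)) ^+ 2)).
  have -> : 2 * r * (kap * M / (2 * D)) ^+ 2 = r * kap ^+ 2 * M / (2 * K).
    have -> : 2 * r * (kap * M / (2 * D)) ^+ 2 = r * kap ^+ 2 * M ^+ 2 / (2 * D ^+ 2).
      by field; rewrite gt_eqF.
    by rewrite DE; field; rewrite !gt_eqF.
  rewrite ler_pdivlMr ?mulr_gt0//.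
  have -> : 3 * e * M * (2 * K) = 6 * K * e * M by ring.
  by rewrite ler_wpM2r// ltW.
apply: ler_pM => //; rewrite ?sqr_ge0// ?mulr_ge0 ?(ltW r0)//.
by rewrite lerXn2r ?nnegrE ?divr_ge0 ?mulr_ge0 ?subr_ge0// ltW.
Qed.

Lemma rost (eps K : R) : 0 < eps -> 0 < K ->
  exists c C : R, [/\ 0 < c, 0 < C & forall (N m0 n0 : nat)
    d (T : measurableType d) (P : probability T R) (W : nat * nat -> T -> R),
  (0 < N)%N -> m0%:R <= K * N%:R -> n0%:R <= K * N%:R ->
  iexp P (fun=> 1) W (grid m0 n0) ->
  exists Bad : set T, [/\ measurable Bad, (P Bad <= (C * expR (- (c * N%:R)))%:E)%E &
    forall w, ~ Bad w -> [/\ forall p, p \in grid m0 n0 -> 0 <= W p w,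
      forall a b s, (a + count id s <= m0)%N -> (b + count negb s <= n0)%N ->
      psum (W^~ w) (a, b) s <= shape (count id s)%:R (count negb s)%:R + eps * N%:R &
      forall a b m n, (a + m <= m0)%N -> (b + n <= n0)%N ->
      exists s, [/\ count id s = m, count negb s = n &
        shape m%:R n%:R - eps * N%:R <= psum (W^~ w) (a, b) s]]]].
Proof.
move=> eps0 K0.
have e40 : 0 < eps / 4 by rewrite divr_gt0.
have e80 : 0 < eps / 8 by rewrite divr_gt0.
(* A side shorter than [eta * N] adds to the shape at most [eps / 4 * N] by its length and
   [eps / 4 * N] through the mixed term. *)
pose eta := Num.min K (Num.min (eps / 4) ((eps / 8) ^+ 2 / K)).
have eta0 : 0 < eta.
  rewrite /eta !lt_min K0 e40 /=; by apply: divr_gt0 => //; exact: exprn_gt0.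
have etaK : eta <= K by rewrite ge_min lexx.
have eta1 : eta <= eps / 4 by rewrite !ge_min lexx orbT.
have eta2 : eta <= (eps / 8) ^+ 2 / K by rewrite !ge_min lexx !orbT.
have sK : Num.sqrt (K * eta) <= eps / 8.
  rewrite -(@ger0_norm _ (eps / 8)) ?(ltW e80)// -sqrtr_sqr ler_wsqrtr//.
  by rewrite mulrC -ler_pdivlMr.
pose r := Num.sqrt (eta / K) / 2.
have r0 : 0 < r by rewrite divr_gt0// sqrtr_gt0 divr_gt0.
(* A run of [kap * N] steps on an axis has stationary mean at most [kap * N / r = eps / 4 * N]. *)
pose kap := r * eps / 4.
have kap0 : 0 < kap by rewrite divr_gt0// mulr_gt0.
(* Three errors [e1 * N], from the stationary passage time, the run and the rest of the path, must
   not exceed the loss computed in [exit_gap]. *)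
pose e1 := Num.min (eps / 4) (r * kap ^+ 2 / (6 * K)).
have K60 : 0 < 6 * K by rewrite mulr_gt0.
have e10 : 0 < e1.
  by rewrite lt_min e40 /=; apply: divr_gt0 => //; rewrite mulr_gt0// exprn_gt0.
have e1e : e1 <= eps / 4 by rewrite ge_min lexx.
have e1K : 6 * K * e1 <= r * kap ^+ 2.
  by rewrite mulrC -ler_pdivlMr// ge_min lexx orbT.
have [cu [Cu [cu0 Cu0 hu]]] := rost_upper e10 K0.
have [cb [Cb [cb0 Cb0 hb]]] := bad_event e10 r0 K0.
exists (Num.min cu cb), (Cu + Cb); split; rewrite ?lt_min ?cu0 ?addr_gt0//.
move=> N m0 n0 d T P W N0 m0K n0K h.
have NR0 : 0 < N%:R :> R by rewrite ltr0n.
pose eN := eta * N%:R.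
have eN0 : 0 < eN by rewrite mulr_gt0.
have eNK : eN <= K * N%:R by rewrite ler_wpM2r// ltW.
pose rho m n := rho_of eN (minn m m0) (minn n n0).
have minK (k k0 : nat) : k0%:R <= K * N%:R -> (minn k k0)%:R <= K * N%:R.
  by apply: le_trans; rewrite ler_nat geq_minr.
have rE : Num.sqrt (eN / (K * N%:R)) / 2 = r.
  by rewrite /eN /r; congr (Num.sqrt _ / 2); field; rewrite !gt_eqF.
have rhoP m n : r <= rho m n <= 1 - r.
  have := rho_ofP eN0 eNK (minK m _ m0K) (minK n _ n0K).
  by rewrite /= rE => -[_ h1 h2]; rewrite h1.
have [Bu [mBu PBu hBu]] := hu N m0 n0 d T P W N0 m0K n0K h.
have [Bb [mBb PBb hBb]] := hb N m0 n0 rho d T P W m0K n0K rhoP h.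
exists (Bu `|` Bb); split.
- exact: measurableU.
- apply: (le_trans (measureU2 _ mBu mBb)); apply: (le_trans (leeD PBu PBb)).
  rewrite -EFinD lee_fin mulrDl; apply: lerD; rewrite ler_wpM2l ?(ltW Cu0) ?(ltW Cb0)// ler_expR lerN2.
    by rewrite ler_wpM2r// ge_min lexx.
  by rewrite ler_wpM2r// ge_min lexx orbT.
move=> w nB.
have {hBu}hU := hBu w (fun hB => nB (or_introl hB)).
have {hBb}[W0 hw] := hBb w (fun hB => nB (or_intror hB)).
set x := W^~ w in hU hw *.
split => //.
  move=> a b s am bn; apply: le_trans (hU _ _ _ am bn) _.
  by rewrite lerD2l ler_wpM2r//; apply: (le_trans e1e); lra.
move=> a b m n am bn.
have mm : (m <= m0)%N by exact: leq_trans (leq_addl _ _) am.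
have nn : (n <= n0)%N by exact: leq_trans (leq_addl _ _) bn.
have /andP[rho_ge rho_le] := rhoP m n.
have rho0 : 0 < rho m n by exact: lt_le_trans rho_ge.
have rho1 : 0 < 1 - rho m n by move: r0 rho_le; lra.
have rho1r : r <= 1 - rho m n by move: rho_le; lra.
have mK : m%:R <= K * N%:R by apply: le_trans m0K; rewrite ler_nat.
have nK : n%:R <= K * N%:R by apply: le_trans n0K; rewrite ler_nat.
have eN1 : e1 * N%:R <= eps / 4 * N%:R by rewrite ler_wpM2r.
have eN10 : 0 < e1 * N%:R by rewrite mulr_gt0.
have degen (k k' : nat) : k%:R <= K * N%:R -> k'%:R < eN ->
    shape k%:R k'%:R - eps * N%:R <= k%:R - e1 * N%:R.
  move=> kK k'e; have : Num.sqrt k%:R * Num.sqrt k'%:R <= eps / 8 * N%:R.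
    apply: (@le_trans _ _ (Num.sqrt (K * N%:R) * Num.sqrt eN)).
      by apply: ler_pM; rewrite ?sqrtr_ge0// ler_wsqrtr// ltW.
    rewrite -sqrtrM ?mulr_ge0 ?(ltW K0)//.
    have -> : K * N%:R * eN = (K * eta) * N%:R ^+ 2 by rewrite /eN; ring.
    by rewrite sqrtrM ?mulr_ge0 ?(ltW K0) ?(ltW eta0)// sqrtr_sqr ger0_norm// ler_wpM2r.
  rewrite /shape sqrrD !sqr_sqrtr// -mulr_natl.
  have : eN <= eps / 4 * N%:R by rewrite ler_wpM2r.
  by move: k'e eN1; lra.
(* In a thin rectangle the straight run along the long side already suffices. *)
have [nsmall|nbig] := ltP n%:R eN.
  exists (nseq m true ++ nseq n false); rewrite !count_cat !count_nseq /= !mul1n !mul0n addn0.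
  split=> //; apply: le_trans (degen _ _ mK nsmall) _.
  have := hw m n a b m 0%N mm nn am; rewrite addn0 => /(_ (leq_trans (leq_addr _ _) bn)).
  rewrite lpp_swt_row mul0r addr0 ltr_norml => /andP[hh _].
  rewrite psum_cat; apply: (@le_trans _ _ (psum x (a, b) (nseq m true))); last first.
    rewrite lerDl; apply: (psum_ge0 W0); rewrite -pend_cat /pend /=.
      by rewrite count_cat !count_nseq /= mul1n mul0n addn0.
    by rewrite count_cat !count_nseq /= mul1n mul0n.
  have {}hh : - (e1 * N%:R) < ((1 - rho m n)^-1 * (psum x (a, b) (nseq m true) - m%:R)).
    by rewrite mulrBr [X in _ - X]mulrC.
  rewrite ltr_pdivlMl// mulrN in hh.
  have : (1 - rho m n) * (e1 * N%:R) <= e1 * N%:R by rewrite ler_piMl ?(ltW eN10)//; move: rho0; lra.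
  by move: hh; lra.
have [msmall|mbig] := ltP m%:R eN.
  exists (nseq n false ++ nseq m true); rewrite !count_cat !count_nseq /= !mul1n !mul0n addn0.
  split=> //; rewrite shapeC; apply: le_trans (degen _ _ nK msmall) _.
  have := hw m n a b 0%N n mm nn; rewrite addn0 => /(_ (leq_trans (leq_addr _ _) am) bn).
  rewrite lpp_swt_col mul0r add0r ltr_norml => /andP[hh _].
  rewrite psum_cat; apply: (@le_trans _ _ (psum x (a, b) (nseq n false))); last first.
    rewrite lerDl; apply: (psum_ge0 W0); rewrite -pend_cat /pend /=.
      by rewrite count_cat !count_nseq /= mul1n mul0n.
    by rewrite count_cat !count_nseq /= mul1n mul0n addn0.
  have {}hh : - (e1 * N%:R) < ((rho m n)^-1 * (psum x (a, b) (nseq n false) - n%:R)).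
    by rewrite mulrBr [X in _ - X]mulrC.
  rewrite ltr_pdivlMl// mulrN in hh.
  have : rho m n * (e1 * N%:R) <= e1 * N%:R by rewrite ler_piMl ?(ltW eN10)//; move: rho1; lra.
  by move: hh; lra.
have m_gt0 : (0 < m)%N by rewrite -(ltr_nat R); exact: lt_le_trans mbig.
have n_gt0 : (0 < n)%N by rewrite -(ltr_nat R); exact: lt_le_trans nbig.
have rhoE : rho m n = Num.sqrt n%:R / (Num.sqrt m%:R + Num.sqrt n%:R).
  by rewrite /rho !(minn_idPl _)// /rho_of !max_l.
pose A : R := Num.sqrt m%:R; pose B : R := Num.sqrt n%:R; pose D : R := Num.sqrt (K * N%:R).
have KN0 : 0 < K * N%:R by rewrite mulr_gt0.
have A0 : 0 < A by rewrite sqrtr_gt0 ltr0n.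
have B0 : 0 < B by rewrite sqrtr_gt0 ltr0n.
have D0 : 0 < D by rewrite sqrtr_gt0.
have AE : A ^+ 2 = m%:R by rewrite sqr_sqrtr.
have BE : B ^+ 2 = n%:R by rewrite sqr_sqrtr.
have DE : D ^+ 2 = K * N%:R by rewrite sqr_sqrtr// ltW.
have AD : A <= D by rewrite ler_wsqrtr.
have BD : B <= D by rewrite ler_wsqrtr.
have rD (Z : R) : Num.sqrt eN <= Z -> 2 * r * D <= Z.
  apply: le_trans; rewrite /r mulrC [2 * _]mulrC divfK// /D -sqrtrM ?(ltW KN0)//.
  rewrite le_eqVlt; apply/orP; left; apply/eqP; congr (Num.sqrt _).
  by rewrite /eN; field; rewrite gt_eqF.
have rA : 2 * r * A <= B.
  apply: le_trans (rD B _); last by rewrite ler_wsqrtr.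
  by rewrite ler_wpM2l// mulr_ge0// ltW.
have rB : 2 * r * B <= A.
  apply: le_trans (rD A _); last by rewrite ler_wsqrtr.
  by rewrite ler_wpM2l// mulr_ge0// ltW.
have AB0 : 0 < A + B by rewrite addr_gt0.
have rho1E : (1 - rho m n)^-1 = (A + B) / A.
  rewrite rhoE -/A -/B (_ : 1 - B / (A + B) = A / (A + B)) ?invf_div//.
  by field; rewrite gt_eqF.
have rho0E : (rho m n)^-1 = (A + B) / B by rewrite rhoE -/A -/B invf_div.
have spE : m%:R / (1 - rho m n) + n%:R / rho m n = (A + B) ^+ 2.
  by rewrite rho1E rho0E -AE -BE; field; rewrite !gt_eqF.
have := hw m n a b m n mm nn am bn; rewrite spE ltr_norml => /andP[hL _].
(* The maximizer of the stationary model is the candidate for the original weights too. *)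
have [s [sm sn sL]] := lpp_path (swt x (rho m n) a b) m n.
exists s; split=> //; rewrite -sL in hL.
rewrite /shape -/A -/B.
have kapr (Z : R) : r <= Z -> kap * N%:R / Z <= eps / 4 * N%:R.
  move=> rZ; rewrite ler_pdivrMr ?(lt_le_trans r0)// /kap.
  have -> : r * eps / 4 * N%:R = eps / 4 * N%:R * r by ring.
  by rewrite ler_wpM2l// mulr_ge0// ltW.
case: s sm sn sL hL => [|e s] sm sn sL hL; first by rewrite -sm in m_gt0.
have hsplit : has (predC1 e) (e :: s).
  rewrite has_count; case: e sm sn {sL hL} => sm sn.
    by rewrite (eq_count (_ : _ =1 negb)) ?sn//; case.
  by rewrite (eq_count (_ : _ =1 id)) ?sm//; case.
have [k [t st]] := run_split hsplit.
case: e st {hsplit} sm sn sL hL => st sm sn sL hL.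
- have {}st : true :: s = nseq k.+1 true ++ false :: t by [].
  rewrite st in sm sn hL *.
  move: sm sn; rewrite !count_cat !count_nseq !mul1n !mul0n => sm sn.
  have pE : pend (0, 0)%N (nseq k.+1 true) = (k.+1, 0)%N.
    by rewrite /pend !count_nseq /= mul1n mul0n.
  have pE' : pend (a, b) (nseq k.+1 true) = (a + k.+1, b)%N.
    by rewrite /pend !count_nseq /= mul1n mul0n addn0.
  move: hL; rewrite psum_cat psum_row pE => hL.
  rewrite psum_cat pE'.
  (* After the turn the path is off both axes, so its weights are the original ones. *)
  have ZE : psum (swt x (rho m n) a b) (k.+1, 0)%N (false :: t) = psum x (a + k.+1, b)%N (false :: t).
    by rewrite /= swt_interior// /swt /srate /= invr1 mul1r addn1.
  rewrite ZE in hL; set Z := psum x _ (false :: t) in hL *.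
  have km : (k.+1 <= m)%N by rewrite -sm leq_addr.
  have P1 : 0 <= psum x (a, b) (nseq k.+1 true).
    apply: (psum_ge0 W0); rewrite pE' /=; first by apply: leq_trans am; rewrite leq_add2l.
    exact: leq_trans (leq_addr _ _) bn.
  have := hw m n a b k.+1 0%N mm nn; rewrite addn0.
  rewrite (leq_trans _ am) ?leq_add2l// (leq_trans _ bn) ?leq_addr// => /(_ erefl erefl).
  rewrite mul0r addr0 ltr_norml => /andP[_ hk].
  (* A short run has small stationary weight, and the original weights are nonnegative: what follows
     the turn carries the bound. *)
  have [ksmall|kbig] := leP k.+1%:R (kap * N%:R).
    have : k.+1%:R / (1 - rho m n) <= eps / 4 * N%:R.
      by apply: le_trans (kapr _ rho1r); rewrite ler_wpM2r// invr_ge0 ltW.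
    by move: hL hk P1 eN1; rewrite /shape; lra.
  (* A long run is contradictory: the upper bounds of the run and of the remainder add up to less
     than the stationary passage time. *)
  have cnt1 : (a + k.+1 + count id (false :: t) <= m0)%N by rewrite -addnA sm.
  have cnt2 : (b + count negb (false :: t) <= n0)%N by rewrite -[count _ _]add0n sn.
  have := hU _ _ _ cnt1 cnt2; rewrite -/Z.
  have -> : count negb (false :: t) = n by rewrite -sn add0n.
  have -> : count id (false :: t) = (m - k.+1)%N by rewrite -sm addKn.
  rewrite natrB// /shape -AE -/B => hZ.
  have kA : k.+1%:R <= A ^+ 2 by rewrite AE ler_nat.
  have := exit_gap NR0 A0 B0 K0 r0 kap0 D0 AD DE rA kA kbig e1K.
  by move: hL hk hZ; rewrite rho1E; lra.
- have {}st : false :: s = nseq k.+1 false ++ true :: t by [].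
  rewrite st in sm sn hL *.
  move: sm sn; rewrite !count_cat !count_nseq !mul1n !mul0n => sm sn.
  have pE : pend (0, 0)%N (nseq k.+1 false) = (0, k.+1)%N.
    by rewrite /pend !count_nseq /= mul1n mul0n.
  have pE' : pend (a, b) (nseq k.+1 false) = (a, b + k.+1)%N.
    by rewrite /pend !count_nseq /= mul1n mul0n addn0.
  move: hL; rewrite psum_cat psum_col pE => hL.
  rewrite psum_cat pE'.
  have ZE : psum (swt x (rho m n) a b) (0, k.+1)%N (true :: t) = psum x (a, b + k.+1)%N (true :: t).
    by rewrite /= swt_interior// /swt /srate /= invr1 mul1r addn1.
  rewrite ZE in hL; set Z := psum x _ (true :: t) in hL *.
  have kn : (k.+1 <= n)%N by rewrite -sn leq_addr.
  have P1 : 0 <= psum x (a, b) (nseq k.+1 false).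
    apply: (psum_ge0 W0); rewrite pE' /=; last by apply: leq_trans bn; rewrite leq_add2l.
    exact: leq_trans (leq_addr _ _) am.
  have := hw m n a b 0%N k.+1 mm nn; rewrite addn0.
  rewrite (leq_trans _ bn) ?leq_add2l// (leq_trans _ am) ?leq_addr// => /(_ erefl erefl).
  rewrite mul0r add0r ltr_norml => /andP[_ hk].
  have [ksmall|kbig] := leP k.+1%:R (kap * N%:R).
    have : k.+1%:R / rho m n <= eps / 4 * N%:R.
      by apply: le_trans (kapr _ rho_ge); rewrite ler_wpM2r// invr_ge0 ltW.
    by move: hL hk P1 eN1; rewrite /shape; lra.
  have cnt1 : (b + k.+1 + count negb (true :: t) <= n0)%N by rewrite -addnA sn.
  have cnt2 : (a + count id (true :: t) <= m0)%N by rewrite -[count _ _]add0n sm.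
  have := hU _ _ _ cnt2 cnt1; rewrite -/Z.
  have -> : count id (true :: t) = m by rewrite -sm add0n.
  have -> : count negb (true :: t) = (n - k.+1)%N by rewrite -sn addKn.
  rewrite shapeC natrB// /shape -BE -/A => hZ.
  have kB : k.+1%:R <= B ^+ 2 by rewrite BE ler_nat.
  have := exit_gap NR0 B0 A0 K0 r0 kap0 D0 BD DE rB kB kbig e1K.
  by move: hL hk hZ; rewrite rho0E [B + A]addrC; lra.
Qed.

End rost.

(** * Compactness of the rectangle and uniform continuity of [alpha] *)

Section modulus.
Context (R : realType).
Variables (l b : R) (alpha : R * R -> R).

Lemma compact_Qrect : compact (Qrect l b).
Proof.
have cfst : continuous (@fst R R) by move=> p; exact: cvg_fst.
have csnd : continuous (@snd R R) by move=> p; exact: cvg_snd.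
have c1 : continuous (fun p : R * R => `|p.2| - p.1).
  by move=> p; apply: cvgB; [apply: cvg_norm; exact: csnd|exact: cfst].
have c2 : continuous (fun p : R * R => `|b - p.2| + p.1).
  move=> p; apply: cvgD; last exact: cfst.
  by apply: cvg_norm; apply: cvgB; [exact: cvg_cst|exact: csnd].
(* The condition [0 <= x <= l] follows from the two others, which are closed. *)
have -> : Qrect l b = ((fun p : R * R => `|p.2| - p.1) @^-1` `]-oo, 0]%classic) `&`
                      ((fun p : R * R => `|b - p.2| + p.1) @^-1` `]-oo, l]%classic).
  apply/seteqP; split => -[x y]; rewrite /Qrect /= !in_itv/=; first by case=> _; lra.
  move=> [h1 h2]; have := normr_ge0 y; have := normr_ge0 (b - y) => h3 h4.
  by split; lra.
apply: (@subclosed_compact _ _ (`[0, l]%classic `*` `[-l, l]%classic)).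
- by apply: closedI; apply: (closed_comp (fun p _ => _ p)); rewrite //; exact: interval_closed.
- by apply: compact_setX; exact: segment_compact.
- move=> -[x y] /=; rewrite !in_itv/=; move=> [h1 h2]; have := normr_ge0 y; have := normr_ge0 (b - y) => h3 h4.
  have := ler_norm y; have := ler_norm (- y); rewrite normrN => h5 h6.
  by split; lra.
Qed.

Hypothesis (ca : {within Qrect l b, continuous alpha}).

Lemma alpha_modulus (e : R) : 0 < e -> exists2 dl : R, 0 < dl &
  forall p q, Qrect l b p -> Qrect l b q -> `|p.1 - q.1| <= dl -> `|p.2 - q.2| <= dl ->
    `|alpha p - alpha q| <= e.
Proof.
move=> e0.
have cQ := compact_Qrect.
move/compact_near_coveringP/near_covering_withinP : cQ.
move=> /(_ R (0 : R)^'+ (fun dl p => forall q, Qrect l b q -> `|p.1 - q.1| <= dl ->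
   `|p.2 - q.2| <= dl -> `|alpha p - alpha q| <= e)) /= h.
have : \forall dl \near (0:R)^'+, Qrect l b `<=` (fun p => forall q, Qrect l b q -> `|p.1 - q.1| <= dl ->
   `|p.2 - q.2| <= dl -> `|alpha p - alpha q| <= e).
  apply: h => x Qx.
  have /subspace_continuousP/(_ x Qx) := ca.
  move=> /cvgrPdist_le /(_ (e / 2)); rewrite divr_gt0// => /(_ isT).
  rewrite /within/= => -[[A1 A2]/= [/nbhs_ballP[r1/= r10 hr1] /nbhs_ballP[r2/= r20 hr2]] hA].
  pose rr := Num.min r1 r2.
  have rr0 : 0 < rr by rewrite lt_min r10.
  have hr t : Qrect l b t -> `|x.1 - t.1| < rr -> `|x.2 - t.2| < rr ->
      `|alpha x - alpha t| <= e / 2.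
    move=> Qt t1 t2; apply: (hA t) => //; split => /=.
      by apply: hr1; rewrite /ball/=; apply: lt_le_trans t1 _; rewrite ge_min lexx.
    by apply: hr2; rewrite /ball/=; apply: lt_le_trans t2 _; rewrite ge_min lexx orbT.
  exists (ball x (rr / 2), [set t | t < rr / 2]) => /=.
    split; first by apply: nbhsx_ballx; rewrite divr_gt0.
    by apply: nbhs_right_lt; rewrite divr_gt0.
  move=> [p dl] [/= [px1 px2] dlr] Qp q Qq h1 h2.
  have pE : `|alpha x - alpha p| <= e / 2.
    apply: hr => //.
      by apply: lt_trans px1 _; move: rr0; lra.
    by apply: lt_trans px2 _; move: rr0; lra.
  have qE : `|alpha x - alpha q| <= e / 2.
    apply: hr => //.
      have -> : x.1 - q.1 = (x.1 - p.1) + (p.1 - q.1) by ring.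
      by apply: (le_lt_trans (ler_normD _ _)); move: px1 h1 dlr; rewrite /ball/=; lra.
    have -> : x.2 - q.2 = (x.2 - p.2) + (p.2 - q.2) by ring.
    by apply: (le_lt_trans (ler_normD _ _)); move: px2 h2 dlr; rewrite /ball/=; lra.
  have -> : alpha p - alpha q = (alpha x - alpha q) - (alpha x - alpha p) by ring.
  by apply: (le_trans (ler_normB _ _)); move: pE qE; lra.
move=> hn.
have [dl [hdl dl0]] : exists dl : R, (Qrect l b `<=` (fun p => forall q, Qrect l b q -> `|p.1 - q.1| <= dl ->
   `|p.2 - q.2| <= dl -> `|alpha p - alpha q| <= e)) /\ 0 < dl.
  by apply: (@filter_ex _ (0:R)^'+); apply: filterI => //; exact: nbhs_right_gt.
by exists dl => // p q Qp Qq; exact: hdl.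
Qed.

Lemma alpha_bounded : exists2 A : R, 0 < A & forall p, Qrect l b p -> alpha p <= A.
Proof.
have [[p0 Q0]|Q0] := pselect (exists p, Qrect l b p); last first.
  by exists 1 => // p Qp; exfalso; apply: Q0; exists p.
have [|c _ hc] := compact_EVT_max _ compact_Qrect ca; first by exists p0.
exists (`|alpha c| + 1); first by rewrite ltr_wpDl.
move=> p Qp; apply: (le_trans (hc p _)); first by rewrite inE.
by apply: (le_trans (ler_norm _)); rewrite lerDl.
Qed.

End modulus.

(** * Integral comparisons without measurability, and step functions *)

Section step_integral.
Context (R : realType).
Notation mu := lebesgue_measure.
Local Open Scope ereal_scope.

(** The integral of a nonnegative function is a supremum over simple functions below it, so
    monotonicity holds without measurability. This matters for integrands containing [derive1 y]. *)
Lemma ge0_le_integral_any d (T : measurableType d) (m : {measure set T -> \bar R})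
    (D : set T) (f g : T -> \bar R) : (forall x, D x -> 0 <= f x) ->
  (forall x, D x -> f x <= g x) -> \int[m]_(x in D) f x <= \int[m]_(x in D) g x.
Proof.
move=> f0 fg; rewrite !(integral_mkcond D) !ge0_integralTE; last 2 first.
- by move=> x; rewrite patchE; case: ifPn => // /set_mem Dx; exact: le_trans (f0 _ Dx) (fg _ Dx).
- by move=> x; rewrite patchE; case: ifPn => // /set_mem Dx; exact: f0.
apply: le_ereal_sup => _ [h hf <-]; exists h => // x; apply: le_trans (hf x) _.
by rewrite !patchE; case: ifPn => // /set_mem Dx; exact: fg.
Qed.

Lemma step_sum (xs c : nat -> R) (K : nat) (x : R) : (forall k, (k < K)%N -> (xs k <= xs k.+1)%R) ->
  forall j, (j < K)%N -> (xs j < x < xs j.+1)%R ->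
  (\sum_(k < K) c k * \1_(`]xs k, xs k.+1[%classic) x = c j)%R.
Proof.
move=> mono j jK /andP[xj xj1].
have mono2 a b : (a <= b)%N -> (b <= K)%N -> (xs a <= xs b)%R.
  elim: b => [|b IH]; first by rewrite leqn0 => /eqP->.
  rewrite leq_eqVlt => /predU1P[->//|ab] bK; apply: (le_trans (IH _ _)) => //; first exact: ltnW.
  exact: mono.
rewrite (bigD1 (Ordinal jK))//= big1 ?addr0.
  by rewrite indicE mem_set ?mulr1//= in_itv/= xj xj1.
move=> k /eqP kj; rewrite indicE memNset ?mulr0//= in_itv/= => /andP[h1 h2].
have [kj'|jk|kj'] := ltngtP k j.
- by have := mono2 k.+1 j kj' (ltnW jK); move: h2 xj; lra.
- by have := mono2 j.+1 k jk (ltnW (ltn_ord k)); move: h1 xj1; lra.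
- by apply: kj; apply: val_inj.
Qed.

Lemma step_sum0 (xs c : nat -> R) (K : nat) (x : R) :
  (forall j, (j < K)%N -> ~ (xs j < x < xs j.+1)%R) ->
  (\sum_(k < K) c k * \1_(`]xs k, xs k.+1[%classic) x = 0)%R.
Proof.
move=> h; apply: big1 => k _; rewrite indicE memNset ?mulr0//= in_itv/=.
exact: h.
Qed.

(** Only the open intervals carry mass; the nodes, where a polygon may fail to be differentiable,
    are left out. *)
Lemma integral_ge_steps (xs c : nat -> R) (K : nat) (D : set R) (f : R -> \bar R) : measurable D ->
  (forall k, (k < K)%N -> (xs k <= xs k.+1)%R) -> (forall k, (0 <= c k)%R) ->
  (forall x, D x -> 0 <= f x) ->
  (forall k x, (k < K)%N -> (xs k < x < xs k.+1)%R -> D x /\ (c k)%:E <= f x) ->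
  (\sum_(k < K) c k * (xs k.+1 - xs k))%:E <= \int[mu]_(x in D) f x.
Proof.
move=> mD mono c0 f0 cf.
have -> : (\sum_(k < K) c k * (xs k.+1 - xs k))%:E =
    \int[mu]_(x in D) (\sum_(k < K) c k * \1_(`]xs k, xs k.+1[%classic) x)%:E.
  under eq_integral do rewrite -sumEFin.
  rewrite ge0_integral_sum//; last 2 first.
  - by move=> k; apply/measurable_EFinP; apply: measurable_funM => //; exact: measurable_funTS.
  - by move=> k x _; rewrite lee_fin mulr_ge0.
  rewrite -sumEFin; apply: eq_bigr => k _.
  under eq_integral do rewrite EFinM.
  rewrite ge0_integralZl//; last 2 first.
  - by apply/measurable_EFinP; exact: measurable_funTS.
  - by rewrite lee_fin.
  rewrite integral_indic// (setIidl _); last first.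
    by move=> x /=; rewrite in_itv/= => /(cf k x (ltn_ord k))[].
  transitivity ((c k)%:E * lebesgue_measure (`](xs k), (xs k.+1)[%classic : set R)); last by [].
  rewrite lebesgue_measure_itv/= lte_fin; case: ifPn => [_|].
    by rewrite -EFinB -EFinM.
  rewrite -leNgt => h; have -> : xs k.+1 = xs k by apply/eqP; rewrite eq_le h mono.
  by rewrite subrr mule0 mulr0.
apply: ge0_le_integral_any.
  by move=> x Dx; rewrite lee_fin sumr_ge0// => k _; rewrite mulr_ge0.
move=> x Dx; have [[j [jK xj]]|h] := pselect (exists j, (j < K)%N /\ (xs j < x < xs j.+1)%R).
  by rewrite (step_sum _ mono jK xj); have [] := cf j x jK xj.
rewrite step_sum0 ?f0// => j jK xj; apply: h; by exists j.
Qed.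

End step_integral.

(** * Polygons through given nodes *)

Section polygon.
Context (R : realType).
Variables (xs ys : nat -> R) (K : nat).
Hypothesis step_le : forall k, (k < K)%N -> `|ys k.+1 - ys k| <= xs k.+1 - xs k.

Definition slope k : R := (ys k.+1 - ys k) / (xs k.+1 - xs k).
Definition clampr (a c x : R) : R := Num.min (Num.max x a) c.
(** Each piece is a ramp that is constant outside its interval, so pieces are added instead of glued
    by cases. Coinciding nodes are allowed: division by zero gives slope 0. *)
Fixpoint poly_fun (k : nat) (x : R) : R :=
  if k is k'.+1 then poly_fun k' x + slope k' * (clampr (xs k') (xs k) x - xs k') else ys 0.

Let xs_le k : (k < K)%N -> xs k <= xs k.+1.
Proof. by move=> kK; rewrite -subr_ge0 (le_trans (normr_ge0 _) (step_le kK)). Qed.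

Let xs_mono a c : (a <= c)%N -> (c <= K)%N -> xs a <= xs c.
Proof.
elim: c => [|c IH]; first by rewrite leqn0 => /eqP->.
rewrite leq_eqVlt => /predU1P[->//|ac] cK; apply: (le_trans (IH _ _)) => //; first exact: ltnW.
exact: xs_le.
Qed.

Lemma slopeK k : (k < K)%N -> slope k * (xs k.+1 - xs k) = ys k.+1 - ys k.
Proof.
move=> kK; rewrite /slope; have := step_le kK.
have [->|h _] := eqVneq (xs k.+1 - xs k) 0; last by rewrite divfK.
by rewrite normr_le0 => /eqP->; rewrite mulr0.
Qed.

Lemma slope_le1 k : (k < K)%N -> `|slope k| <= 1.
Proof.
move=> kK; rewrite /slope; have := step_le kK.
have [->|h hh] := eqVneq (xs k.+1 - xs k) 0; first by rewrite invr0 mulr0 normr0.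
have h0 : 0 < xs k.+1 - xs k by rewrite lt0r h subr_ge0 xs_le.
by rewrite normrM normfV (gtr0_norm h0) ler_pdivrMr// mul1r.
Qed.

Lemma poly_fun_low k x : (k <= K)%N -> x <= xs 0 -> poly_fun k x = ys 0.
Proof.
elim: k => [//|k IH] kK x0 /=; rewrite IH// ?(ltnW kK)//.
rewrite /clampr max_r; last by apply: le_trans x0 _; exact: xs_mono (ltnW kK).
by rewrite min_l ?xs_le// subrr mulr0 addr0.
Qed.

Lemma poly_fun_high k x : (k <= K)%N -> xs k <= x -> poly_fun k x = ys k.
Proof.
elim: k => [//|k IH] kK xk /=.
have xk' : xs k <= x by apply: le_trans xk; exact: xs_le.
rewrite IH ?(ltnW kK)// /clampr max_l// min_r// slopeK//.
by rewrite addrC subrK.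
Qed.

Lemma poly_fun_mid j k x : (j < k)%N -> (k <= K)%N -> xs j <= x <= xs j.+1 ->
  poly_fun k x = ys j + slope j * (x - xs j).
Proof.
elim: k => [//|k IH]; rewrite ltnS leq_eqVlt => /predU1P[-> kK /andP[h1 h2]|jk kK hx] /=.
  by rewrite poly_fun_high ?(ltnW kK)// /clampr max_l// min_l.
rewrite IH// ?(ltnW kK)//.
have h : x <= xs k by case/andP: hx => _ /le_trans; apply; apply: xs_mono => //; exact: ltnW.
by rewrite /clampr max_r// min_l ?xs_le// subrr mulr0 addr0.
Qed.

Lemma poly_fun_lip k x x' : (k <= K)%N -> x <= x' ->
  `|poly_fun k x' - poly_fun k x| <= clampr (xs 0) (xs k) x' - clampr (xs 0) (xs k) x.
Proof.
move=> + xx'; elim: k => [_|k IH kK] /=.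
  rewrite subrr normr0 /clampr.
  by rewrite !minEle !maxEle; do 2 case: ifP; do 2 case: ifP; lra.
have sl := slope_le1 kK; have x0k := xs_mono (leq0n k) (ltnW kK); have xk := xs_le kK.
have -> : poly_fun k x' + slope k * (clampr (xs k) (xs k.+1) x' - xs k) -
   (poly_fun k x + slope k * (clampr (xs k) (xs k.+1) x - xs k)) =
   (poly_fun k x' - poly_fun k x) + slope k * (clampr (xs k) (xs k.+1) x' - clampr (xs k) (xs k.+1) x) by ring.
apply: (le_trans (ler_normD _ _)); rewrite normrM.
have c0 : 0 <= clampr (xs k) (xs k.+1) x' - clampr (xs k) (xs k.+1) x.
  rewrite /clampr !minEle !maxEle; do 2 case: ifP; do 2 case: ifP; lra.
have h1 : `|slope k| * `|clampr (xs k) (xs k.+1) x' - clampr (xs k) (xs k.+1) x| <=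
    clampr (xs k) (xs k.+1) x' - clampr (xs k) (xs k.+1) x.
  by rewrite (ger0_norm c0) ler_piMl.
have h2 := IH (ltnW kK).
apply: (le_trans (lerD h2 h1)).
(* Consecutive clamps add up to one clamp over the union of the intervals, so the Lipschitz bounds
   telescope. *)
have cE z : clampr (xs 0) (xs k) z + clampr (xs k) (xs k.+1) z = clampr (xs 0) (xs k.+1) z + xs k.
  rewrite /clampr; have [z0|z0] := leP z (xs 0).
    by rewrite !min_l ?(le_trans x0k)// max_r ?min_l ?(le_trans z0)//; ring.
  have [zk|zk] := leP z (xs k).
    by rewrite (min_l xk) (min_l (le_trans zk xk)).
  by rewrite addrC.
by have := cE x; have := cE x'; lra.
Qed.

Lemma derive1_poly_fun j x : (j < K)%N -> xs j < x < xs j.+1 -> derive1 (poly_fun K) x = slope j.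
Proof.
move=> jK hx.
rewrite derive1E (@near_eq_derive _ _ _ _ (fun z => ys j + slope j * (z - xs j))); last first.
  near=> z; apply: poly_fun_mid => //.
  have : z \in `](xs j), (xs j.+1)[ by near: z; exact: near_in_itvoo.
  by rewrite in_itv/= => /andP[/ltW-> /ltW->].
rewrite deriveD//= deriveM//= deriveB//= !derive_cst derive_id.
by rewrite scaler0 addr0 add0r subr0 [LHS]mulr1.
Unshelve. all: by end_near. Qed.

End polygon.

(** * The shape function and [gammaf] *)

Section shape_facts.
Context (R : realType).
Implicit Types h D u v : R.

Lemma shapeE u v : 0 <= u -> 0 <= v -> shape u v = u + v + 2 * (Num.sqrt u * Num.sqrt v).
Proof. by move=> u0 v0; rewrite /shape sqrrD !sqr_sqrtr// mulr_natl; ring. Qed.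

Lemma shape_ge0 u v : 0 <= shape u v. Proof. exact: sqr_ge0. Qed.

Lemma shape_le u v : 0 <= u -> 0 <= v -> shape u v <= 2 * (u + v).
Proof.
move=> u0 v0; rewrite shapeE//.
have := sqr_ge0 (Num.sqrt u - Num.sqrt v); rewrite sqrrB !sqr_sqrtr// -mulr_natl; lra.
Qed.

Lemma gammaf_ge0 (w : R) : 0 <= gammaf w.
Proof. by rewrite addr_ge0 ?sqrtr_ge0. Qed.

Lemma gammaf_le2 (w : R) : gammaf w <= 2.
Proof.
rewrite /gammaf; have : Num.sqrt (1 - w ^+ 2) <= 1.
  by rewrite -[leRHS]sqrtr1 ler_wsqrtr// gerBl sqr_ge0.
lra.
Qed.

(** Both sides are [h + sqrt (h ^ 2 - D ^ 2)]. The arguments on the right are increments of the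
    coordinates [u] and [v]: this links the limit shape on the lattice with the integrand of
    [calG]. *)
Lemma shape_gamma h D : `|D| <= h -> h * gammaf (D / h) = shape ((h + D) / 2) ((h - D) / 2).
Proof.
rewrite ler_norml => /andP[D1 D2].
have h0 : 0 <= h by lra.
rewrite shapeE ?divr_ge0//; [|lra|lra].
have [h00|hn0] := eqVneq h 0.
  have -> : D = 0 by lra.
  by rewrite h00 mul0r addr0 subr0 !mul0r sqrtr0 !mulr0 !addr0.
rewrite /gammaf mulrDr mulr1; have -> : (h + D) / 2 + (h - D) / 2 = h by field.
congr (h + _); rewrite -sqrtrM; last by rewrite divr_ge0//; lra.
have pullin (c z : R) : 0 <= c -> c * Num.sqrt z = Num.sqrt (c ^+ 2 * z).
  by move=> c0; rewrite sqrtrM ?sqr_ge0// sqrtr_sqr ger0_norm.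
by rewrite !pullin//; congr (Num.sqrt _); field.
Qed.

End shape_facts.

(** * Lower bounds for the supremum by polygons *)

Section calG_facts.
Context (R : realType).
Variables (l b : R) (alpha : R * R -> R).
Hypotheses (l0 : 0 < l) (ca : {within Qrect l b, continuous alpha}).
Hypothesis (a0 : forall p, Qrect l b p -> 0 <= alpha p).
Notation mu := (@lebesgue_measure R).

Lemma Xset_Qrect (y : R -> R) x : Xset l b y -> 0 <= x <= l -> Qrect l b (x, y x).
Proof.
move=> [y0 yl ylip] xl; have /andP[x0 xl'] := xl; split => //=.
  have := ylip x 0; rewrite !in_itv/= lexx x0 xl' (ltW l0) y0 !subr0 (ger0_norm x0).
  by apply.
have := ylip l x; rewrite !in_itv/= lexx x0 xl' (ltW l0) yl [`|l - x|]ger0_norm ?subr_ge0//.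
by apply.
Qed.

(** The bound [2 * A * l] shows that the integral is finite, so [fine] loses nothing. *)
Lemma calG_integral (y : R -> R) : Xset l b y ->
  (calG l alpha y)%:E =
  (\int[mu]_(x in `[0%R, l]%classic) (alpha (x, y x) * gammaf (derive1 y x))%:E)%E /\
  forall A, (forall p, Qrect l b p -> alpha p <= A) -> calG l alpha y <= 2 * A * l.
Proof.
move=> Xy.
have f0 x : `[0, l]%classic x -> (0 <= (alpha (x, y x) * gammaf (derive1 y x))%:E)%E.
  rewrite /= in_itv/= => xl; rewrite lee_fin mulr_ge0 ?gammaf_ge0//.
  by apply: a0; exact: Xset_Qrect.
have bnd A : (forall p, Qrect l b p -> alpha p <= A) ->
    (\int[mu]_(x in `[0%R, l]%classic) (alpha (x, y x) * gammaf (derive1 y x))%:E <= (2 * A * l)%:E)%E.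
  move=> hA.
  have -> : (2 * A * l)%:E = (\int[mu]_(x in `[0%R, l]%classic) (2 * A)%:E)%E.
    rewrite integral_cst//=.
    by rewrite lebesgue_measure_itv/= lte_fin l0 -EFinB subr0 -EFinM.
  apply: ge0_le_integral_any => // x /[dup] /f0 hx; rewrite /= in_itv/= => xl.
  have Qx := Xset_Qrect Xy xl.
  rewrite lee_fin mulrC; apply: ler_pM; rewrite ?gammaf_ge0 ?a0 ?gammaf_le2//; exact: hA.
have [A A0 hA] := alpha_bounded ca.
have fin : (\int[mu]_(x in `[0%R, l]%classic) (alpha (x, y x) * gammaf (derive1 y x))%:E)%E \is a fin_num.
  rewrite ge0_fin_numE; last exact: integral_ge0.
  by apply: (le_lt_trans (bnd A hA)); exact: ltry.
split; first by rewrite /calG fineK.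
by move=> A' /bnd; rewrite -lee_fin /calG fineK.
Qed.

Lemma calG_le_sup (y : R -> R) : Xset l b y ->
  calG l alpha y <= sup [set calG l alpha y | y in Xset l b].
Proof.
move=> Xy; apply: ub_le_sup; last by exists y.
have [A A0 hA] := alpha_bounded ca.
by exists (2 * A * l) => _ [z Xz <-]; have [_] := calG_integral Xz; apply.
Qed.

(** On each edge the polygon stays within [dl] of the left node, so [alpha] varies by at most [e];
    the loss is [e] times a total shape of at most [2 * l]. *)
Lemma calG_polygon (xs ys : nat -> R) (K : nat) (e dl : R) : 0 < e ->
  (forall p q, Qrect l b p -> Qrect l b q -> `|p.1 - q.1| <= dl -> `|p.2 - q.2| <= dl ->
    `|alpha p - alpha q| <= e) ->
  (forall k, (k < K)%N -> `|ys k.+1 - ys k| <= xs k.+1 - xs k) ->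
  (forall k, (k < K)%N -> xs k.+1 - xs k <= dl) ->
  xs 0 = 0 -> ys 0 = 0 -> xs K = l -> ys K = b ->
  \sum_(k < K) alpha (xs k, ys k) *
     shape ((xs k.+1 - xs k + (ys k.+1 - ys k)) / 2) ((xs k.+1 - xs k - (ys k.+1 - ys k)) / 2)
   - 2 * e * l <= sup [set calG l alpha y | y in Xset l b].
Proof.
move=> e0 hmod step mesh xs0 ys0 xsK ysK.
pose y := poly_fun xs ys K.
have xs_le k : (k < K)%N -> xs k <= xs k.+1.
  by move=> kK; rewrite -subr_ge0 (le_trans (normr_ge0 _) (step _ kK)).
have xs_mono p q : (p <= q)%N -> (q <= K)%N -> xs p <= xs q.
  elim: q => [|q IH]; first by rewrite leqn0 => /eqP->.
  rewrite leq_eqVlt => /predU1P[->//|ac] cK; apply: (le_trans (IH _ _)) => //; first exact: ltnW.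
  exact: xs_le.
have Xy : Xset l b y.
  split.
  - by rewrite /y (poly_fun_low step) ?xs0.
  - by rewrite /y (poly_fun_high step) ?xsK.
  - have lip x1 x2 : x1 \in `[0, l] -> x2 \in `[0, l] -> x1 <= x2 -> `|y x2 - y x1| <= x2 - x1.
      rewrite !in_itv/= => /andP[h1 h2] /andP[h3 h4] h5.
      have := poly_fun_lip step (leqnn K) h5; rewrite xs0 xsK /clampr.
      by rewrite (max_l h1) (max_l h3) (min_l h2) (min_l h4).
    move=> x1 x2 h1 h2; have [h|/ltW h] := leP x1 x2.
      by rewrite distrC [`|x1 - x2|]distrC [`|x2 - x1|]ger0_norm ?subr_ge0//; exact: lip.
    by rewrite [`|x1 - x2|]ger0_norm ?subr_ge0//; exact: lip.
apply: le_trans (calG_le_sup Xy).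
have [intE _] := calG_integral Xy; rewrite -lee_fin intE.
(* Truncated at 0 to keep the step function nonnegative; it stays below the integrand because
   [alpha] is nonnegative. *)
pose c k := Num.max (alpha (xs k, ys k) - e) 0 * gammaf (slope xs ys k).
have yk k : (k <= K)%N -> y (xs k) = ys k.
  rewrite leq_eqVlt => /predU1P[->|kK]; first by rewrite /y (poly_fun_high step).
  rewrite /y (poly_fun_mid step kK)// ?lexx ?xs_le//.
  by rewrite subrr mulr0 addr0.
have xk k : (k <= K)%N -> 0 <= xs k <= l by move=> kK; rewrite -xs0 -xsK !xs_mono.
apply: (@le_trans _ _ (\sum_(k < K) c k * (xs k.+1 - xs k))%:E); last first.
  apply: integral_ge_steps => //.
  - by move=> k; rewrite mulr_ge0 ?gammaf_ge0// le_max lexx orbT.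
  - move=> x; rewrite /= in_itv/= => xl; rewrite lee_fin mulr_ge0 ?gammaf_ge0//.
    by apply: a0; exact: Xset_Qrect.
  - move=> k x kK hx; have /andP[hx1 hx2] := hx.
    have /andP[k0 kl] := xk _ (ltnW kK); have /andP[k10 k1l] := xk _ kK.
    have xl : 0 <= x <= l by apply/andP; split; lra.
    split; first by rewrite /= in_itv/=.
    rewrite lee_fin (derive1_poly_fun step kK hx) ler_wpM2r ?gammaf_ge0//.
    have Qx := Xset_Qrect Xy xl; have Qk := Xset_Qrect Xy (xk _ (ltnW kK)).
    have [_ _ ylip] := Xy.
    have mk := mesh _ kK.
    have h1 : `|xs k - x| <= dl by rewrite distrC ger0_norm; lra.
    have h2 : `|y (xs k) - y x| <= dl.
      apply: le_trans (ylip _ _ _ _) h1; rewrite in_itv//=; exact: xk (ltnW kK).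
    have := hmod _ _ Qk Qx h1 h2; rewrite yk ?(ltnW kK)// ler_norml => /andP[_ h3].
    by rewrite ge_max a0// andbT; lra.
rewrite lee_fin.
have -> : 2 * e * l = \sum_(k < K) 2 * e * (xs k.+1 - xs k).
  rewrite -mulr_sumr; congr (_ * _).
  by rewrite -(big_mkord xpredT (fun k => xs k.+1 - xs k)) telescope_sumr// xs0 xsK subr0.
rewrite -sumrB; apply: ler_sum => k _.
have kK := ltn_ord k; have st := step _ kK.
rewrite [leRHS]mulrAC -[leRHS]mulrA /slope shape_gamma//.
set S := shape _ _.
have S0 : 0 <= S by exact: shape_ge0.
have S2 : S <= 2 * (xs k.+1 - xs k).
  have /andP[st1 st2] : - (xs k.+1 - xs k) <= ys k.+1 - ys k <= xs k.+1 - xs k by rewrite -ler_norml.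
  apply: le_trans (shape_le _ _) _; [lra|lra|].
  by rewrite le_eqVlt; apply/orP; left; apply/eqP; field.
apply: (@le_trans _ _ ((alpha (xs k, ys k) - e) * S)).
  rewrite mulrBl lerD2l lerN2.
  by have := ler_wpM2l (ltW e0) S2; lra.
by rewrite ler_wpM2r// le_max lexx.
Qed.

End calG_facts.

(** * The derivative of a Lipschitz function as a density *)

Section lipschitz_density.
Context (R : realType).
Notation mu := (@lebesgue_measure R).

Definition cumul (f : R -> R) (nd : nondecreasing f) (cf : continuous f) : cumulative R R :=
  HB.pack_for (cumulative R R) f (isCumulative.Build R _ R f nd (right_continuousW cf)).

Lemma stieltjes_oc (f : cumulative R R) (s t : R) : s <= t ->
  lebesgue_stieltjes_measure f `]s, t]%classic = (f t - f s)%:E.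
Proof.
move=> st; rewrite /lebesgue_stieltjes_measure /measure_extension measurable_mu_extE/=.
  by rewrite wlength_itv_bnd.
exact: is_ocitv.
Qed.

(** Lebesgue measure is half the sum of the two Stieltjes measures, so its null sets are null for
    each of them. *)
Lemma stieltjes_dominated (f g : cumulative R R) : (forall x, f x + g x = 2 * x) ->
  lebesgue_stieltjes_measure f `<< mu.
Proof.
move=> fg.
have h0 : (0 <= 2^-1 :> R) by rewrite invr_ge0.
pose m : {measure set (measurableTypeR R) -> \bar R} :=
  mscale (NngNum h0) (measure_add (lebesgue_stieltjes_measure f) (lebesgue_stieltjes_measure g)).
have mm X : m X = (2^-1%:E * (lebesgue_stieltjes_measure f X + lebesgue_stieltjes_measure g X))%E.
  transitivity (2^-1%:E * measure_add (lebesgue_stieltjes_measure f) (lebesgue_stieltjes_measure g) X)%E => //.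
  by congr (_ * _)%E; exact: measure_addE.
have mE A : measurable A -> mu A = m A.
  apply: lebesgue_stieltjes_measure_unique => X [[s t]/= _ <-].
  have [ts|st] := ltP t s.
    by rewrite set_itv_ge ?bnd_simp -?leNgt ?(ltW ts)// !measure0.
  transitivity (2^-1%:E * (lebesgue_stieltjes_measure f `]s, t]%classic +
                           lebesgue_stieltjes_measure g `]s, t]%classic))%E.
    rewrite !stieltjes_oc// -EFinD -EFinM; apply: congr1.
    by rewrite -[LHS]/(t - s); have := fg t; have := fg s; lra.
  by rewrite mm.
apply/null_content_dominatesP => A mA A0.
apply/eqP; rewrite eq_le measure_ge0 andbT.
have : m A = 0%E by rewrite -mE.
rewrite mm => /eqP; rewrite mule_eq0 eqe invr_eq0 pnatr_eq0/=.
by rewrite padde_eq0// => /andP[/eqP-> _].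
Qed.

Lemma lip_derive (l x c : R) (y F0 : R -> R) :
  (forall x1 x2, x1 \in `[0, l] -> x2 \in `[0, l] -> `|y x1 - y x2| <= `|x1 - x2|) ->
  0 < x < l -> derivable F0 x 1 -> derive1 F0 x = c ->
  (forall z, 0 < z < l -> F0 z - z + y 0 = y z) ->
  derive1 y x = c - 1 /\ `|derive1 y x| <= 1.
Proof.
move=> lip /andP[x0 xl] dF0 eF0 FE.
have dF : is_derive x (1:R) F0 c by rewrite -eF0 derive1E; exact: derivableP.
pose G : R -> R := F0 - id + cst (y 0).
have dG : is_derive x (1:R) G (c - 1 + 0).
  by apply: is_deriveD; apply: is_deriveB.
have nearE : \near x, G x = y x.
  near=> z; apply: FE.
  have : z \in `](0:R), l[ by near: z; apply: near_in_itvoo; rewrite in_itv/= x0 xl.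
  by rewrite in_itv.
have dy : derivable y x 1 by apply: near_eq_derivable nearE _; case: dG.
split.
  by rewrite derive1E -(near_eq_derive _ nearE); case: dG => _ ->; rewrite addr0.
rewrite derive1E /derive -lim_norm//.
apply: limr_le; first by apply: is_cvg_norm.
near=> h; rewrite normrZ normfV.
have h0 : h != 0 by near: h; exact: nbhs_dnbhs_neq.
have h1 : `|h| < x by near: h; exact: dnbhs0_lt.
have h2 : `|h| < l - x by near: h; apply: dnbhs0_lt; rewrite subr_gt0.
have hn : 0 < `|h| by rewrite normr_gt0.
rewrite mulrC ler_pdivrMr// mul1r.
have := lip (h *: 1 + x) x; rewrite [h *: 1]mulr1 addrK; apply.
  by move: h1 h2; rewrite in_itv/= !ltr_norml => /andP[? ?] /andP[? ?]; apply/andP; split; lra.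
by rewrite in_itv/= (ltW x0) (ltW xl).
Unshelve. all: by end_near. Qed.

Lemma lipschitz_density (l : R) (y : R -> R) : 0 < l ->
  (forall x1 x2, x1 \in `[0, l] -> x2 \in `[0, l] -> `|y x1 - y x2| <= `|x1 - x2|) ->
  exists g : R -> R, [/\ measurable_fun setT g, (forall x, 0 <= g x <= 2),
   (forall s t, 0 <= s -> s <= t -> t <= l ->
     (\int[mu]_(x in `]s, t[) (g x)%:E = (y t - y s + (t - s))%:E)%E) &
   {ae mu, forall x, 0 < x < l -> derive1 y x = g x - 1}].
Proof.
move=> l0 lip.
have cl x : clampr 0 l x \in `[0, l].
  by rewrite in_itv/= /clampr; rewrite le_min le_max lexx orbT (ltW l0) ge_min lexx orbT.
(* The function [x + y(x)], continued by constants outside [[0, l]], and its complement to [2 * x]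
   are both nondecreasing because [y] has Lipschitz constant 1. *)
pose f x := clampr 0 l x + y (clampr 0 l x).
pose f' x := 2 * x - f x.
have clip x x' : `|clampr 0 l x - clampr 0 l x'| <= `|x - x'|.
  by rewrite /clampr !minEle !maxEle; do 4 case: ifP; rewrite !ler_norml; have := ler_norm (x - x'); have := ler_norm (- (x - x')); rewrite normrN; lra.
have cmono x x' : x <= x' -> 0 <= clampr 0 l x' - clampr 0 l x <= x' - x.
  by move=> xx'; rewrite /clampr !minEle !maxEle; do 2 case: ifP; do 2 case: ifP; move: l0; lra.
have nd : nondecreasing f.
  move=> x x' xx'; have /andP[h1 h2] := cmono _ _ xx'.
  have := lip _ _ (cl x) (cl x'); rewrite ler_norml => /andP[h3 h4].
  by rewrite /f; move: h4; rewrite distrC (ger0_norm h1); lra.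
have nd' : nondecreasing f'.
  move=> x x' xx'; have /andP[h1 h2] := cmono _ _ xx'.
  have := lip _ _ (cl x) (cl x'); rewrite distrC [`|clampr 0 l x - _|]distrC (ger0_norm h1) ler_norml => /andP[h3 h4].
  by rewrite /f' /f; lra.
have cf : continuous f.
  move=> x; apply/cvgrPdist_le => e e0; near=> z.
  have -> : f x - f z = (clampr 0 l x - clampr 0 l z) + (y (clampr 0 l x) - y (clampr 0 l z)).
    by rewrite /f; ring.
  apply: (le_trans (ler_normD _ _)).
  have h1 := clip x z; have h2 := lip _ _ (cl x) (cl z).
  have : `|x - z| <= e / 2 by near: z; apply: cvgr_dist_le; rewrite ?divr_gt0//; exact: cvg_id.
  lra.
have cf' : continuous f'.
  by move=> x; apply: cvgB; [apply: cvgM; [exact: cvg_cst|exact: cvg_id]|exact: cf].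
pose F := cumul nd cf; pose F' := cumul nd' cf'.
have dom : lebesgue_stieltjes_measure F `<< mu.
  by apply: (@stieltjes_dominated F F') => x; rewrite /F /F' /= /f'; ring.
have mD : measurable (`]0, l]%classic : set (measurableTypeR R)) by exact: measurable_itv.
have Doo : (lebesgue_stieltjes_measure F `](0%R : R), l]%classic < +oo)%E.
  by have := ltry (F l - F 0); rewrite -(stieltjes_oc F (ltW l0)).
pose nu : {finite_measure set (measurableTypeR R) -> \bar R} := mfrestr mD Doo.
have nuE A : nu A = lebesgue_stieltjes_measure F (A `&` `]0, l]%classic) by [].
have numu : nu `<< mu.
  apply/null_content_dominatesP => A mA A0; rewrite nuE.
  move/null_content_dominatesP : dom; apply; first exact: measurableI.
  apply/eqP; rewrite eq_le measure_ge0 andbT -A0.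
  by apply: le_measure; rewrite ?inE//; exact: measurableI.
have [g0 [g0_ge0 g0_fin g0_int g0E]] := radon_nikodym_sigma_finite numu.
pose gR x := fine (g0 x).
have gRE x : (gR x)%:E = g0 x by rewrite fineK.
have igR : mu.-integrable setT (EFin \o gR).
  by rewrite (_ : EFin \o gR = g0)//; apply/funext => x; exact: gRE.
have mgR : measurable_fun setT gR by case/integrableP : igR => /measurable_EFinP.
have fE t : 0 <= t -> t <= l -> f t = t + y t.
  by move=> t0 tl; rewrite /f /clampr max_l// min_l.
have int_oc s t : 0 <= s -> s <= t -> t <= l ->
    (\int[mu]_(x in `]s, t]) (gR x)%:E = (y t - y s + (t - s))%:E)%E.
  move=> s0 st tl; under eq_integral do rewrite gRE.
  rewrite -g0E; last exact: measurable_itv.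
  rewrite nuE setIidl.
    transitivity (F t - F s)%:E; first exact: (stieltjes_oc F st).
    by rewrite /F /= !fE ?(le_trans s0)// ?(le_trans st)//; apply: congr1; ring.
  by move=> x /=; rewrite !in_itv/= => /andP[h1 h2]; apply/andP; split; lra.
have fBR (x : R) : 0 < x -> (BRight (0 : R) < BRight x)%O by move=> x0; rewrite bnd_simp.
have int_y (z : R) : mu.-integrable [set` Interval (BRight (0:R)) (BRight z)] (EFin \o gR).
  by apply: integrableS igR => //; exact: measurable_itv.
have loc : locally_integrable [set: R] gR.
  by apply: open_integrable_locally => //; exact: openT.
(* The integral of the density is differentiable almost everywhere, and differs from [y] by an
   affine function. *)
have dae : {ae mu, forall x, 0 < x < l -> derive1 y x = gR x - 1 /\ `|derive1 y x| <= 1}.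
  have := FTC1 int_y loc.
  apply: filterS; first exact: (ae_filter_ringOfSetsType mu).
  move=> x /= hx /andP[x0 xl].
  have [dF0 eF0] := hx (fBR _ x0); clear hx.
  apply: (lip_derive lip _ dF0 eF0); first by rewrite x0.
  move=> z /andP[z0 zl].
  rewrite /Rintegral int_oc ?(ltW z0) ?(ltW zl)//= subr0; ring.
(* The density is known to lie in [[0, 2]] only almost everywhere; truncation gives this everywhere
   and changes no integral. *)
exists (fun x => Num.min (Num.max (gR x) 0) 2); split.
- by apply: measurable_minr => //; exact: measurable_maxr.
- by move=> x; rewrite le_min le_max lexx orbT ge_min lexx orbT ler0n.
- move=> s t s0 st tl; rewrite -int_oc// -integral_itv_bndo_bndc; last first.
    by apply/measurable_EFinP; exact: measurable_funTS.
  apply: ae_eq_integral.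
  + exact: measurable_itv.
  + by apply/measurable_EFinP/measurable_funTS/measurable_minr => //; exact: measurable_maxr.
  + by apply/measurable_EFinP; exact: measurable_funTS.
  + move: dae; apply: filterS; first exact: (ae_filter_ringOfSetsType mu).
    move=> x hx /=; rewrite in_itv/= => /andP[sx xt].
    have [|->] := hx; first by apply/andP; split; lra.
    by rewrite ler_norml => /andP[h1 h2]; rewrite max_l ?min_l//; lra.
- move: dae; apply: filterS; first exact: (ae_filter_ringOfSetsType mu).
  move=> x hx xl; have [->] := hx xl.
  by rewrite ler_norml => /andP[h1 h2]; rewrite max_l ?min_l//; lra.
Unshelve. all: by end_near. Qed.

End lipschitz_density.

(** * Upper bound for [calG] by Riemann sums *)

Section calG_upper.
Context (R : realType).
Notation mu := (@lebesgue_measure R).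

Lemma integral_mul_indic d (T : measurableType d) (m : {measure set T -> \bar R})
    (D E : set T) (f : T -> R) : E `<=` D ->
  (\int[m]_(x in D) (f x * \1_E x)%:E = \int[m]_(x in E) (f x)%:E)%E.
Proof.
move=> /setIidr <-; rewrite integral_mkcondr; apply: eq_integral => x xD.
by rewrite patchE indicE in_setI xD/=; case: ifPn => _; rewrite ?mulr1 ?mulr0.
Qed.

(** For positive [u] and [v] the optimum is [lam = sqrt u / sqrt v]. When one of them vanishes the
    infimum need not be attained, whence the slack [dl]. *)
Lemma amgm_inf (u v dl : R) : 0 <= u -> 0 <= v -> 0 < dl ->
  exists2 lam, 0 < lam & lam * v + u / lam <= 2 * (Num.sqrt u * Num.sqrt v) + dl.
Proof.
move=> u0 v0 dl0; have [->|un0] := eqVneq u 0.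
  have v10 : 0 < v + 1 by rewrite ltr_wpDl.
  exists (dl / (v + 1)); first by rewrite divr_gt0.
  rewrite mul0r addr0 sqrtr0 mul0r mulr0 add0r mulrAC ler_pdivrMr//.
  by rewrite ler_wpM2l ?(ltW dl0)// lerDl.
have [->|vn0] := eqVneq v 0.
  have u10 : 0 < u + 1 by rewrite ltr_wpDl.
  exists ((u + 1) / dl); first by rewrite divr_gt0.
  rewrite mulr0 add0r sqrtr0 !mulr0 add0r invf_div mulrA ler_pdivrMr// mulrC.
  by rewrite ler_wpM2l ?(ltW dl0)// lerDl.
have su : 0 < Num.sqrt u by rewrite sqrtr_gt0 lt0r un0.
have sv : 0 < Num.sqrt v by rewrite sqrtr_gt0 lt0r vn0.
exists (Num.sqrt u / Num.sqrt v); first by rewrite divr_gt0.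
have -> : Num.sqrt u / Num.sqrt v * v + u / (Num.sqrt u / Num.sqrt v) = 2 * (Num.sqrt u * Num.sqrt v).
  move: (sqr_sqrtr u0) (sqr_sqrtr v0) su sv.
  move: (Num.sqrt u) (Num.sqrt v) => A B <- <- A0 B0.
  by field; rewrite !gt_eqF.
by rewrite lerDl ltW.
Qed.

(** The square root lies below functions affine in [w]. Concavity of [gammaf] is used in this form
    because affine functions of the density integrate exactly. *)
Lemma sqrt_amgm (w lam : R) : `|w| <= 1 -> 0 < lam ->
  Num.sqrt (1 - w ^+ 2) <= (lam * (1 - w) + (1 + w) / lam) / 2.
Proof.
rewrite ler_norml => /andP[w1 w2] lam0.
have rhs0 : 0 <= (lam * (1 - w) + (1 + w) / lam) / 2.
  have h1 : 0 <= 1 - w by lra.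
  have h2 : 0 <= 1 + w by lra.
  apply: divr_ge0 => //; apply: addr_ge0; first by apply: mulr_ge0 => //; exact: ltW.
  by apply: divr_ge0 => //; exact: ltW.
rewrite -[leRHS](ger0_norm rhs0) -sqrtr_sqr ler_wsqrtr// -subr_ge0.
have -> : ((lam * (1 - w) + (1 + w) / lam) / 2) ^+ 2 - (1 - w ^+ 2) =
   ((lam * (1 - w) - (1 + w) / lam) / 2) ^+ 2.
  by field; rewrite gt_eqF.
exact: sqr_ge0.
Qed.

Lemma integral_affine_density (g : R -> R) (s t I c1 c2 : R) : measurable_fun setT g ->
  (forall x, 0 <= g x <= 2) -> s <= t -> 0 <= c1 -> 0 <= c2 ->
  (\int[mu]_(x in `]s, t[) (g x)%:E = I%:E)%E ->
  (\int[mu]_(x in `]s, t[) (1 + c1 * (2 - g x) + c2 * g x)%:E =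
    ((t - s) + c1 * (2 * (t - s) - I) + c2 * I)%:E)%E.
Proof.
move=> mg g02 st c10 c20 gI.
have mD : measurable (`]s, t[%classic : set (measurableTypeR R)) by exact: measurable_itv.
have muD : mu (`]s, t[%classic : set R) = (t - s)%:E.
  rewrite lebesgue_measure_itv/= lte_fin; case: ltP => [_|ts]; first by rewrite EFinB.
  by rewrite (_ : t = s) ?subrr//; apply/eqP; rewrite eq_le st ts.
have m1 : measurable_fun `]s, t[ (fun x => (g x)%:E).
  by apply/measurable_EFinP; exact: measurable_funTS.
have mgT : measurable_fun (`]s, t[ : set R) g by exact: measurable_funTS.
have m2 : measurable_fun `]s, t[ (fun x => (2 - g x)%:E).
  by apply/measurable_EFinP; exact: measurable_funB.
have g2 x : 0 <= 2 - g x by have /andP[_] := g02 x; rewrite subr_ge0.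
have g1 x : 0 <= g x by have /andP[] := g02 x.
have i2 : (\int[mu]_(x in `]s, t[) (2 - g x)%:E = (2 * (t - s) - I)%:E)%E.
  have : (\int[mu]_(x in `]s, t[) (2 - g x)%:E + I%:E = (2 * (t - s))%:E)%E.
    transitivity (\int[mu]_(x in `]s, t[) ((2 - g x)%:E + (g x)%:E))%E.
      by rewrite -gI ge0_integralD// => x _; rewrite lee_fin.
    under eq_integral do rewrite -EFinD subrK.
    by rewrite integral_cst//= muD -EFinM.
  have : (0 <= \int[mu]_(x in `]s, t[) (2 - g x)%:E)%E by apply: integral_ge0 => x _; rewrite lee_fin.
  case: (\int[mu]_(x in `]s, t[) (2 - g x)%:E)%E => [z _|//|//].
  by rewrite -EFinD => -[zE]; congr EFin; rewrite -zE addrK.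
under eq_integral do rewrite 2!EFinD 2!EFinM.
rewrite ge0_integralD//; last 4 first.
- by move=> x _; rewrite adde_ge0// mule_ge0// lee_fin.
- by apply: emeasurable_funD => //; exact: emeasurable_funM.
- by move=> x _; rewrite mule_ge0// lee_fin.
- exact: emeasurable_funM.
rewrite ge0_integralD//; last 2 first.
- by move=> x _; rewrite mule_ge0// lee_fin.
- exact: emeasurable_funM.
rewrite [X in (_ + X + _)%E]ge0_integralZl//; last by move=> x _; rewrite lee_fin.
rewrite [X in (_ + _ + X)%E]ge0_integralZl//; last by move=> x _; rewrite lee_fin.
by rewrite i2 gI integral_cst//= muD mul1e -!EFinM -!EFinD.
Qed.

Variables (l b : R) (alpha : R * R -> R).
Hypotheses (l0 : 0 < l) (ca : {within Qrect l b, continuous alpha}).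
Hypothesis (a0 : forall p, Qrect l b p -> 0 <= alpha p).

(** Jensen's inequality on each piece: [lam k] is nearly optimal for the mean slope, and the affine
    majorant of [gammaf] it defines integrates almost to the shape of the increments. Freezing
    [alpha] at the left node costs [e] times a total shape of at most [2 * l]. *)
Lemma calG_le_riemann (y : R -> R) (xs : nat -> R) (K : nat) (e dl : R) : Xset l b y -> 0 < e ->
  (forall p q, Qrect l b p -> Qrect l b q -> `|p.1 - q.1| <= dl -> `|p.2 - q.2| <= dl ->
    `|alpha p - alpha q| <= e) ->
  (forall k, (k < K)%N -> xs k <= xs k.+1) ->
  (forall k, (k < K)%N -> xs k.+1 - xs k <= dl) ->
  xs 0 = 0 -> xs K = l ->
  calG l alpha y <= \sum_(k < K) alpha (xs k, y (xs k)) *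
     shape ((xs k.+1 - xs k + (y (xs k.+1) - y (xs k))) / 2)
           ((xs k.+1 - xs k - (y (xs k.+1) - y (xs k))) / 2) + 2 * e * l.
Proof.
move=> Xy e0 hmod xs_le mesh xs0 xsK.
have [y0 yl ylip] := Xy.
have [g [mg g02 gint gae]] := lipschitz_density l0 ylip.
have xs_mono p q : (p <= q)%N -> (q <= K)%N -> xs p <= xs q.
  elim: q => [|q IH]; first by rewrite leqn0 => /eqP->.
  rewrite leq_eqVlt => /predU1P[->//|ac] cK; apply: (le_trans (IH _ _)) => //; first exact: ltnW.
  exact: xs_le.
have xk k : (k <= K)%N -> 0 <= xs k <= l by move=> kK; rewrite -xs0 -xsK !xs_mono.
pose h k := xs k.+1 - xs k; pose D k := y (xs k.+1) - y (xs k).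
pose u k := (h k + D k) / 2; pose v k := (h k - D k) / 2.
have Dh k : (k < K)%N -> - h k <= D k <= h k.
  move=> kK; rewrite -ler_norml.
  have := ylip (xs k.+1) (xs k); rewrite !in_itv/= !xk ?(ltnW kK)// => /(_ isT isT).
  by rewrite [`|xs k.+1 - _|]ger0_norm ?subr_ge0 ?xs_le.
have u0 k : (k < K)%N -> 0 <= u k by move=> /Dh/andP[]; rewrite /u; lra.
have v0 k : (k < K)%N -> 0 <= v k by move=> /Dh/andP[]; rewrite /v; lra.
pose a k := alpha (xs k, y (xs k)) + e.
have ak0 k : (k < K)%N -> 0 <= a k.
  by move=> kK; rewrite addr_ge0 ?(ltW e0)// a0//; apply: (Xset_Qrect l0 Xy); exact: xk (ltnW kK).
have claim (dd : R) : 0 < dd -> calG l alpha y <= \sum_(k < K) a k * (shape (u k) (v k) + dd).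
  move=> dd0.
  have /choice[lam hlam] : forall k, exists lam, (k < K)%N ->
      0 < lam /\ lam * v k + u k / lam <= 2 * (Num.sqrt (u k) * Num.sqrt (v k)) + dd.
    move=> k; case: (ltnP k K) => kK; last by exists 0.
    by have [lam l1 l2] := amgm_inf (u0 _ kK) (v0 _ kK) dd0; exists lam.
  pose H k x := a k * (1 + lam k / 2 * (2 - g x) + (2 * lam k)^-1 * g x).
  have lamp k : (k < K)%N -> 0 < lam k by move=> kK; have [] := hlam k kK.
  have H0 k x : (k < K)%N -> 0 <= 1 + lam k / 2 * (2 - g x) + (2 * lam k)^-1 * g x.
    move=> kK; have /andP[g1 g2] := g02 x; have lk := ltW (lamp k kK).
    by rewrite !addr_ge0// mulr_ge0 ?divr_ge0 ?subr_ge0// invr_ge0 mulr_ge0.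
  have mH k : measurable_fun setT (fun x => 1 + lam k / 2 * (2 - g x) + (2 * lam k)^-1 * g x).
    apply: measurable_funD; last exact: measurable_funM.
    by apply: measurable_funD => //; apply: measurable_funM => //; exact: measurable_funB.
  (* The nodes are removed too, so that every remaining point is interior to one piece. *)
  have aeK : {ae mu, forall x, forall k, x <> xs k}.
    apply: ae_foralln => k; exists [set xs k]; split.
    - exact: measurable_set1.
    - exact: lebesgue_measure_set1.
    - by move=> x /= h'; apply: contrapT => h''; exact: h'.
  have [Z [mZ Z0 hZ]] : mu.-negligible (~` [set x | (0 < x < l -> derive1 y x = g x - 1) /\ forall k, x <> xs k]).
    have FF := ae_filter_ringOfSetsType mu.
    by apply: (@filterI _ _ FF).
  have good x : ~ Z x -> (0 < x < l -> derive1 y x = g x - 1) /\ forall k, x <> xs k.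
    by move=> nZ; apply: contrapT => h'; apply: nZ; apply: hZ.
  rewrite -lee_fin (calG_integral l0 ca a0 Xy).1.
  pose f1 k x := ((1 + lam k / 2 * (2 - g x) + (2 * lam k)^-1 * g x) * \1_(`]xs k, xs k.+1[%classic) x)%R.
  have f10 k x : (k < K)%N -> 0 <= f1 k x by move=> kK; rewrite mulr_ge0// H0.
  have mf1 k : measurable_fun setT (f1 k) by exact: measurable_funM.
  have If1 k : (k < K)%N -> (\int[mu]_(x in `[0%R, l]%classic) (f1 k x)%:E <= (shape (u k) (v k) + dd)%:E)%E.
    move=> kK; have /andP[k0 kl] := xk _ (ltnW kK); have /andP[k10 k1l] := xk _ kK.
    rewrite (_ : (\int[mu]_(x in `[0%R, l]%classic) (f1 k x)%:E)%E =
       (\int[mu]_(x in `]xs k, xs k.+1[) (1 + lam k / 2 * (2 - g x) + (2 * lam k)^-1 * g x)%:E)%E).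
      have lk := lamp k kK.
      have lk0 : 0 <= lam k / 2 by rewrite divr_ge0// ltW.
      have lk1 : 0 <= (2 * lam k)^-1 by rewrite invr_ge0 mulr_ge0// ltW.
      rewrite (integral_affine_density mg g02 (xs_le _ kK) lk0 lk1 (gint _ _ k0 (xs_le _ kK) k1l)).
      rewrite lee_fin shapeE ?u0 ?v0//.
      have [_] := hlam _ kK; rewrite -/(h k) -/(D k).
      have -> : h k + lam k / 2 * (2 * h k - (D k + h k)) + (2 * lam k)^-1 * (D k + h k) =
        u k + v k + (lam k * v k + u k / lam k).
        by rewrite /u /v; field; rewrite gt_eqF.
      by move=> h1; rewrite -[leRHS]addrA lerD2l.
    rewrite /f1; apply: (@integral_mul_indic _ _ mu) => x /=; rewrite !in_itv/= => /andP[h1 h2].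
    by apply/andP; split; lra.
  (* Adding [+oo] on the null set [Z] makes the pointwise bound hold everywhere, at no cost in the
     integral and without measurability of [derive1 y]. *)
  apply: (@le_trans _ _ (\int[mu]_(x in `[0%R, l]%classic)
      (\sum_(k < K) (a k * f1 k x)%:E + (cst +oo%E \_ Z) x))%E).
    apply: ge0_le_integral_any => x; rewrite /= in_itv/= => xl.
      by rewrite lee_fin mulr_ge0 ?gammaf_ge0// a0//; exact: Xset_Qrect.
    have s0 : (0 <= \sum_(k < K) (a k * f1 k x)%:E)%E.
      by apply: sume_ge0 => k _; rewrite lee_fin mulr_ge0 ?ak0 ?f10.
    rewrite patchE; case: ifPn => [_|/negP xZ].
      rewrite /= addey ?leey//; by apply/eqP => hh; rewrite hh in s0.
    have [dE xn] := good x (fun zx => xZ (mem_set zx)).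
    have /andP[x0 xl'] := xl.
    have [j jK xj] : exists2 j, (j < K)%N & xs j < x < xs j.+1.
      have xK : x < xs K by rewrite lt_neqAle xsK xl' andbT -xsK; apply/eqP; exact: xn.
      elim: (K) xK => [|k IH] xk1.
        by move: xk1; rewrite xs0; lra.
      have [h1|h1|h1] := ltgtP x (xs k).
      - by have [j jk hj] := IH h1; exists j => //; exact: ltnW.
      - by exists k => //; rewrite h1.
      - by case: (xn k).
    have /andP[k0 kl] := xk _ (ltnW jK); have /andP[k10 k1l] := xk _ jK.
    have /andP[xj1 xj2] := xj.
    rewrite adde0 sumEFin lee_fin.
    have -> : \sum_(k < K) a k * f1 k x = H j x.
      rewrite /H -(step_sum (fun k => a k * (1 + lam k / 2 * (2 - g x) + (2 * lam k)^-1 * g x)) xs_le jK xj).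
      by apply: eq_bigr => k _; rewrite /f1 mulrA.
    have Qx := Xset_Qrect l0 Xy xl; have Qk := Xset_Qrect l0 Xy (xk _ (ltnW jK)).
    have mk := mesh _ jK.
    have h1 : `|x - xs j| <= dl by rewrite ger0_norm; lra.
    have h2 : `|y x - y (xs j)| <= dl.
      by apply: le_trans (ylip _ _ _ _) h1; rewrite in_itv//=; exact: xk (ltnW jK).
    have := hmod _ _ Qx Qk h1 h2; rewrite ler_norml => /andP[_ h3].
    rewrite /H; apply: ler_pM; rewrite ?a0 ?gammaf_ge0//; first by rewrite /a; lra.
    have xin : 0 < x < l by apply/andP; split; lra.
    rewrite dE// /gammaf -addrA lerD2l.
    have /andP[g1 g2] := g02 x.
    have w1 : `|g x - 1| <= 1 by rewrite ler_norml; apply/andP; split; lra.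
    apply: le_trans (sqrt_amgm w1 (lamp _ jK)) _.
    rewrite le_eqVlt; apply/orP; left; apply/eqP.
    by field; rewrite gt_eqF// lamp.
  rewrite ge0_integralD//; last 4 first.
  - by move=> x _; apply: sume_ge0 => k _; rewrite lee_fin mulr_ge0 ?ak0 ?f10.
  - apply: emeasurable_sum => k; apply/measurable_EFinP; apply: measurable_funM => //.
    exact: (measurable_funS measurableT (@subsetT _ _) (mf1 k)).
  - by move=> x _; rewrite patchE; case: ifPn => _; rewrite ?leey.
  - apply: (measurable_funS measurableT) => //; apply/measurable_restrict => //.
  rewrite (_ : (\int[mu]_(x in `[0%R, l]%classic) (cst +oo \_ Z) x)%E = 0%E).
    rewrite adde0 ge0_integral_sum//; last 2 first.
    - by move=> k; apply/measurable_EFinP; apply: measurable_funM => //;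
      exact: (measurable_funS measurableT (@subsetT _ _) (mf1 k)).
    - by move=> k x _; rewrite lee_fin mulr_ge0 ?ak0 ?f10.
    rewrite -sumEFin; apply: lee_sum => k _.
    under eq_integral do rewrite EFinM.
    rewrite ge0_integralZl//; last 3 first.
    - by apply/measurable_EFinP; exact: (measurable_funS measurableT (@subsetT _ _) (mf1 k)).
    - by move=> x _; rewrite lee_fin f10.
    - by rewrite lee_fin ak0.
    by rewrite EFinM; apply: lee_wpmul2l; [rewrite lee_fin ak0|exact: If1].
  rewrite -integral_mkcondr integral_cst//=; last exact: measurableI.
  rewrite (_ : mu _ = 0%E) ?mule0//.
  apply: (@subset_measure0 _ _ _ mu _ Z) => //; exact: measurableI.
have a1 : 0 < 1 + \sum_(k < K) a k by rewrite ltr_wpDr// sumr_ge0// => k _; rewrite ak0.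
apply/ler_addgt0Pr => ep ep0.
(* The slacks then sum to at most [ep]; the 1 guards against a vanishing denominator. *)
apply: le_trans (claim (ep / (1 + \sum_(k < K) a k)) _) _; first exact: divr_gt0.
under eq_bigr do rewrite mulrDr.
rewrite big_split/= -mulr_suml.
have le1 : (\sum_(k < K) a k) * (ep / (1 + \sum_(k < K) a k)) <= ep.
  by rewrite mulrCA -[leRHS]mulr1 ler_wpM2l ?(ltW ep0)// ler_pdivrMr// mul1r lerDr.
apply: lerD => //.
have -> : 2 * e * l = \sum_(k < K) 2 * e * (xs k.+1 - xs k).
  rewrite -mulr_sumr; congr (_ * _).
  by rewrite -(big_mkord xpredT (fun k => xs k.+1 - xs k)) telescope_sumr// xs0 xsK subr0.
rewrite -big_split/=; apply: ler_sum => k _.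
rewrite /a mulrDl lerD2l (mulrC 2 e) -[leRHS]mulrA ler_wpM2l ?(ltW e0)//.
apply: le_trans (shape_le (u0 _ (ltn_ord k)) (v0 _ (ltn_ord k))) _.
by rewrite le_eqVlt; apply/orP; left; apply/eqP; rewrite /u /v /h; field.
Qed.

End calG_upper.

(** * Coarse graining of paths *)

Section coarse_graining.
Context (R : realType).
Variables (l b : R) (alpha : R * R -> R).
Hypotheses (l0 : 0 < l) (bl : `|b| < l) (ca : {within Qrect l b, continuous alpha}).
Hypothesis (a0 : forall p, Qrect l b p -> 0 <= alpha p).
Implicit Types (N : nat) (p q : nat * nat) (s : seq bool) (w : nat * nat -> R).

Definition lattice_pt N p : R * R := ((p.1%:R + p.2%:R) / N%:R, (p.1%:R - p.2%:R) / N%:R).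
Definition mN N : nat := Num.truncn (N%:R * ((l + b) / 2)).
Definition nN N : nat := Num.truncn (N%:R * ((l - b) / 2)).
Definition wt N w p : R := alpha (lattice_pt N p) / N%:R * w p.

Let lb : 0 < l + b /\ 0 < l - b.
Proof. by move: bl; rewrite ltr_norml => /andP[]; split; lra. Qed.

Lemma mN_itv N : (mN N)%:R <= N%:R * ((l + b) / 2) < (mN N)%:R + 1.
Proof.
rewrite natr1; apply: truncn_itv; rewrite mulr_ge0// divr_ge0//; exact: ltW lb.1.
Qed.

Lemma nN_itv N : (nN N)%:R <= N%:R * ((l - b) / 2) < (nN N)%:R + 1.
Proof.
rewrite natr1; apply: truncn_itv; rewrite mulr_ge0// divr_ge0//; exact: ltW lb.2.
Qed.

Lemma Qrect_uv (u v : R) : Qrect l b (u + v, u - v) <-> 0 <= u <= (l + b) / 2 /\ 0 <= v <= (l - b) / 2.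
Proof.
split => [[/= _]|[/andP[u1 u2] /andP[v1 v2]]].
  by rewrite !ler_norml => /andP[h1 h2] /andP[h3 h4]; split; apply/andP; split; lra.
by split => /=; rewrite ?ler_norml; apply/andP; split; lra.
Qed.

Lemma lattice_pt_uv N p : lattice_pt N p = (p.1%:R / N%:R + p.2%:R / N%:R, p.1%:R / N%:R - p.2%:R / N%:R).
Proof. by rewrite /lattice_pt mulrDl mulrBl. Qed.

Lemma grid_Qrect N p : (0 < N)%N -> (p \in grid (mN N) (nN N)) <-> Qrect l b (lattice_pt N p).
Proof.
move=> N0; have NR : 0 < N%:R :> R by rewrite ltr0n.
rewrite mem_grid lattice_pt_uv; split => [/andP[p1 p2]|/Qrect_uv[]].
  apply/Qrect_uv; have /andP[m1 _] := mN_itv N; have /andP[n1 _] := nN_itv N.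
  by rewrite !divr_ge0//= !ler_pdivrMr// ![_ / 2 * _]mulrC; split;
    [apply: le_trans m1|apply: le_trans n1]; rewrite ler_nat.
rewrite !divr_ge0//= !ler_pdivrMr// ![_ / 2 * _]mulrC => h1 h2.
have /andP[_ m2] := mN_itv N; have /andP[_ n2] := nN_itv N.
rewrite -ltnS -(ltr_nat R) -natr1 (le_lt_trans h1 m2)/=.
by rewrite -ltnS -(ltr_nat R) -natr1 (le_lt_trans h2 n2).
Qed.

Lemma psumZ w (k : R) p s : psum (fun q => k * w q) p s = k * psum w p s.
Proof. by elim: s p => [|e s IH] p /=; rewrite ?mulr0// IH mulrDr. Qed.

Variables (e dl A eps : R) (N : nat) (w : nat * nat -> R).
Hypotheses (e0 : 0 < e) (eps0 : 0 < eps) (N0 : (0 < N)%N).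
Hypothesis (modulus : forall p q : R * R, Qrect l b p -> Qrect l b q ->
  `|p.1 - q.1| <= dl -> `|p.2 - q.2| <= dl -> `|alpha p - alpha q| <= e).
Hypothesis (A0 : 0 < A) (aA : forall p : R * R, Qrect l b p -> alpha p <= A).
Hypothesis w0 : forall p, p \in grid (mN N) (nN N) -> 0 <= w p.

Let NR : 0 < N%:R :> R. Proof. by rewrite ltr0n. Qed.

(** All visited sites lie within [dl] of [c], so [alpha] can be frozen there. Truncation at 0 keeps
    the lower factor nonnegative, so that it may multiply lower bounds of [psum]. *)
Lemma psum_wt_bounds (c : R * R) p s : Qrect l b c ->
  ((pend p s).1 <= mN N)%N -> ((pend p s).2 <= nN N)%N ->
  (forall q, (p.1 <= q.1 <= (pend p s).1)%N -> (p.2 <= q.2 <= (pend p s).2)%N ->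
    `|(lattice_pt N q).1 - c.1| <= dl /\ `|(lattice_pt N q).2 - c.2| <= dl) ->
  Num.max (alpha c - e) 0 / N%:R * psum w p s <= psum (wt N w) p s <= (alpha c + e) / N%:R * psum w p s.
Proof.
move=> Qc pm pn hq; rewrite -!psumZ.
have key q : (p.1 <= q.1 <= (pend p s).1)%N -> (p.2 <= q.2 <= (pend p s).2)%N ->
    [/\ 0 <= w q, Num.max (alpha c - e) 0 <= alpha (lattice_pt N q) & alpha (lattice_pt N q) <= alpha c + e].
  move=> q1 q2; have [h1 h2] := hq q q1 q2.
  have qg : q \in grid (mN N) (nN N).
    rewrite mem_grid; move: q1 q2 => /andP[_ q1] /andP[_ q2].
    by rewrite (leq_trans q1 pm) (leq_trans q2 pn).
  have Qq := (grid_Qrect q N0).1 qg.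
  have := modulus Qq Qc h1 h2; rewrite ler_norml => /andP[h3 h4].
  split; [exact: w0|by rewrite ge_max a0// andbT; lra|by lra].
apply/andP; split; apply: ler_psum => q q1 q2 _; have [wq h1 h2] := key q q1 q2; rewrite /wt.
  by rewrite ler_wpM2r// ler_wpM2r// invr_ge0 ltW.
by rewrite ler_wpM2r// ler_wpM2r// invr_ge0 ltW.
Qed.

Lemma shapeZ (u v : R) : 0 <= u -> 0 <= v -> shape u v / N%:R = shape (u / N%:R) (v / N%:R).
Proof.
move=> u0 v0; have Ni : 0 <= N%:R^-1 :> R by rewrite invr_ge0 ltW.
by rewrite /shape !sqrtrM// -mulrDl exprMn sqr_sqrtr.
Qed.

Notation Gstar := (sup [set calG l alpha y | y in Xset l b]).

(** The path is cut into [K] pieces of nearly equal length and compared with the polygon through the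
    cut points. Freezing [alpha] costs [2 * e * l] on the path and again on the polygon, and each
    piece adds [eps] times the bound [A + e]. *)
Lemma path_upper (K : nat) s : (0 < K)%N -> l / K%:R + 1 / N%:R <= dl -> 2 / N%:R <= dl ->
  (forall a c s, (a + count id s <= mN N)%N -> (c + count negb s <= nN N)%N ->
    psum w (a, c) s <= shape (count id s)%:R (count negb s)%:R + eps * N%:R) ->
  count id s = mN N -> count negb s = nN N ->
  psum (wt N w) (0, 0)%N s <= Gstar + 4 * e * l + K%:R * ((A + e) * eps).
Proof.
move=> K0 dl1 dl2 up sm sn.
have KR : 0 < K%:R :> R by rewrite ltr0n.
pose M := size s.
have sizeE t : size t = (count id t + count negb t)%N by rewrite -(count_predC id t).
have ME : M = (mN N + nN N)%N by rewrite /M sizeE sm sn.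
have /andP[m1 m2] := mN_itv N; have /andP[n1 n2] := nN_itv N.
have Ml : M%:R <= N%:R * l by rewrite ME natrD; lra.
(* Rounded equidistant cuts; consecutive ones differ by at most [M / K + 1] steps. *)
pose t k := ((k * M) %/ K)%N.
have tK : t K = M by rewrite /t mulKn.
have t_le k : (t k <= t k.+1)%N by apply: leq_div2r; rewrite leq_mul2r leqnSn orbT.
have t_leM k : (k <= K)%N -> (t k <= M)%N by move=> kK; rewrite -tK; apply: leq_div2r; rewrite leq_mul2r kK orbT.
have t_step k : (t k.+1)%:R - (t k)%:R <= M%:R / K%:R + 1 :> R.
  have h1 : (t k.+1 * K)%:R <= (k.+1 * M)%:R :> R by rewrite ler_nat leq_divM.
  have h2 : (k * M)%:R < ((t k).+1 * K)%:R :> R by rewrite ltr_nat ltn_ceil.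
  rewrite -(ler_pM2r KR) [leRHS]mulrDl divfK ?gt_eqF// mulrBl.
  move: h1 h2; rewrite !natrM -!natr1; lra.
pose pk k := pend (0, 0)%N (take (t k) s).
pose seg k := drop (t k) (take (t k.+1) s).
have takeE k : take (t k.+1) s = take (t k) s ++ seg k.
  by rewrite -[LHS](cat_take_drop (t k)) take_takel.
have pkS k : pk k.+1 = pend (pk k) (seg k) by rewrite /pk takeE pend_cat.
have psumE k : psum (wt N w) (0, 0)%N (take (t k) s) = \sum_(j < k) psum (wt N w) (pk j) (seg j).
  elim: k => [|k IH]; first by rewrite big_ord0 /t mul0n div0n take0.
  by rewrite big_ord_recr/= -IH takeE psum_cat.
pose a k := count id (seg k); pose c k := count negb (seg k).
have acE k : (k < K)%N -> (a k)%:R + (c k)%:R = (t k.+1)%:R - (t k)%:R :> R.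
  by move=> kK; rewrite -natrD -sizeE size_drop size_takel ?t_leM// natrB.
have pkg k : ((pk k).1 <= mN N)%N /\ ((pk k).2 <= nN N)%N.
  by rewrite /pk /pend /= !add0n -sm -sn; split; apply: leq_count_subseq; exact: take_subseq.
have Qk k : Qrect l b (lattice_pt N (pk k)).
  by apply/grid_Qrect => //; rewrite mem_grid; have [-> ->] := pkg k.
have pk1 k : (pk k.+1).1%:R = (pk k).1%:R + (a k)%:R :> R by rewrite pkS /= natrD.
have pk2 k : (pk k.+1).2%:R = (pk k).2%:R + (c k)%:R :> R by rewrite pkS /= natrD.
have MNl : M%:R / N%:R <= l by rewrite ler_pdivrMr// mulrC.
have acN k : (k < K)%N -> ((a k)%:R + (c k)%:R) / N%:R <= dl :> R.
  move=> kK; apply: le_trans dl1; rewrite acE//.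
  apply: (@le_trans _ _ ((M%:R / K%:R + 1) / N%:R)).
    by rewrite ler_wpM2r ?invr_ge0 ?(ltW NR).
  by rewrite mulrDl lerD2r mulrAC ler_wpM2r ?invr_ge0 ?(ltW KR).
pose al k := alpha (lattice_pt N (pk k)).
pose sh k : R := shape ((a k)%:R / N%:R) ((c k)%:R / N%:R).
have al0 k : 0 <= al k by exact: a0.
have alA k : al k <= A by exact: aA.
have segU k : (k < K)%N -> psum (wt N w) (pk k) (seg k) <= (al k + e) * (sh k + eps).
  move=> kK; have [p1 p2] := pkg k.+1; rewrite pkS in p1 p2.
  have /andP[_ h] : Num.max (al k - e) 0 / N%:R * psum w (pk k) (seg k) <= psum (wt N w) (pk k) (seg k)
      <= (al k + e) / N%:R * psum w (pk k) (seg k).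
    apply: psum_wt_bounds => // q /andP[q1 q2] /andP[q3 q4].
    move: q1 q2 q3 q4 (acN k kK); rewrite -!(ler_nat R) /= !natrD -/(a k) -/(c k) => q1 q2 q3 q4 hk.
    have bnd z : `|z| <= (a k)%:R + (c k)%:R -> `|z / N%:R| <= dl.
      move=> hz; rewrite normrM (gtr0_norm (x := N%:R^-1)) ?invr_gt0//.
      by apply: le_trans hk; rewrite ler_wpM2r// invr_ge0 ltW.
    by split; rewrite -mulrBl; apply: bnd; rewrite ler_norml; apply/andP; split; lra.
  apply: le_trans h _; rewrite -mulrA ler_wpM2l ?addr_ge0// ?(ltW e0)// mulrC ler_pdivrMr//.
  rewrite mulrDl /sh -shapeZ// divfK ?gt_eqF//.
  by have := up (pk k).1 (pk k).2 (seg k) p1 p2; rewrite -surjective_pairing.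
have -> : s = take (t K) s by rewrite tK take_size.
rewrite psumE.
(* The last lattice site need not be [(l, b)]: an additional node [K.+1] at that corner closes the
   polygon, with an edge of width at most [2 / N]. *)
pose xs k := if (k <= K)%N then (lattice_pt N (pk k)).1 else l.
pose ys k := if (k <= K)%N then (lattice_pt N (pk k)).2 else b.
have dx k : (k < K)%N -> xs k.+1 - xs k = ((a k)%:R + (c k)%:R) / N%:R.
  by move=> kK; rewrite /xs kK (ltnW kK) /lattice_pt /= pk1 pk2; ring.
have dy k : (k < K)%N -> ys k.+1 - ys k = ((a k)%:R - (c k)%:R) / N%:R.
  by move=> kK; rewrite /ys kK (ltnW kK) /lattice_pt /= pk1 pk2; ring.
have pkK : pk K = (mN N, nN N) by rewrite /pk tK take_size /pend sm sn.
pose ru := (l + b) / 2 - (mN N)%:R / N%:R; pose rv := (l - b) / 2 - (nN N)%:R / N%:R.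
have ru01 : 0 <= ru <= 1 / N%:R.
  rewrite /ru subr_ge0 ler_pdivrMr// [_ / 2 * _]mulrC m1/= lerBlDr -mulrDl ler_pdivlMr// mulrC; lra.
have rv01 : 0 <= rv <= 1 / N%:R.
  rewrite /rv subr_ge0 ler_pdivrMr// [_ / 2 * _]mulrC n1/= lerBlDr -mulrDl ler_pdivlMr// mulrC; lra.
have dxK : xs K.+1 - xs K = ru + rv.
  by rewrite /xs ltnn leqnn pkK /lattice_pt /= /ru /rv; field; rewrite gt_eqF.
have dyK : ys K.+1 - ys K = ru - rv.
  by rewrite /ys ltnn leqnn pkK /lattice_pt /= /ru /rv; field; rewrite gt_eqF.
have kE (k : nat) : (k < K.+1)%N -> k = K \/ (k < K)%N by rewrite ltnS leq_eqVlt => /predU1P.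
have G : \sum_(k < K) al k * sh k - 2 * e * l <= Gstar.
  apply: le_trans (@calG_polygon _ _ _ _ l0 ca a0 xs ys K.+1 _ _ e0 modulus _ _ _ _ _ _).
  - rewrite lerD2r big_ord_recr/=; apply: ler_wpDr.
      rewrite mulr_ge0 ?shape_ge0// a0//= /xs /ys leqnn -surjective_pairing; exact: Qk.
    rewrite le_eqVlt; apply/orP; left; apply/eqP; apply: eq_bigr => k _.
    rewrite dx// dy// /xs /ys (ltnW (ltn_ord k)) -surjective_pairing /al /sh.
    by congr (_ * shape _ _); field; rewrite gt_eqF.
  - move=> k /kE[->|kK].
      by move: ru01 rv01 => /andP[h1 _] /andP[h2 _]; rewrite dxK dyK ler_norml; apply/andP; split; lra.
    rewrite dx// dy// normrM (gtr0_norm (x := N%:R^-1)) ?invr_gt0// ler_pM2r ?invr_gt0//.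
    have := ler0n R (a k); have := ler0n R (c k) => h1 h2.
    by rewrite ler_norml; apply/andP; split; lra.
  - move=> k /kE[->|kK]; last by rewrite dx// acN.
    rewrite dxK; apply: le_trans dl2; move: ru01 rv01 => /andP[_ h1] /andP[_ h2].
    lra.
  - by rewrite /xs /= /lattice_pt /pk /t mul0n div0n take0 /= /pend /= addr0 mul0r.
  - by rewrite /ys /= /lattice_pt /pk /t mul0n div0n take0 /= /pend /= subr0 mul0r.
  - by rewrite /xs ltnn.
  - by rewrite /ys ltnn.
have shS : \sum_(k < K) sh k <= 2 * l.
  apply: (@le_trans _ _ (\sum_(k < K) 2 * (((t k.+1)%:R - (t k)%:R) / N%:R))).
    apply: ler_sum => k _; apply: le_trans (shape_le _ _) _; rewrite ?divr_ge0//.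
    by rewrite -mulrDl acE.
  rewrite -mulr_sumr -mulr_suml -(big_mkord xpredT (fun k => (t k.+1)%:R - (t k)%:R)).
  rewrite telescope_sumr// tK ler_pM2l//.
  by apply: le_trans MNl; rewrite ler_pM2r ?invr_gt0// gerBl.
apply: (@le_trans _ _ (\sum_(k < K) (al k * sh k + e * sh k + (A + e) * eps))).
  apply: ler_sum => k _; apply: (le_trans (segU _ (ltn_ord k))).
  by rewrite mulrDr mulrDl lerD2l ler_wpM2r ?(ltW eps0)// lerD2r.
rewrite !big_split/= sumr_const card_ord -mulr_sumr -[_ *+ K]mulr_natl lerD2r.
have := ler_wpM2l (ltW e0) shS; lra.
Qed.

(** Square roots are not Lipschitz at 0, so a rounding by [c = r ^ 2] is absorbed by [(S + 2 r) ^ 2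
    <= (1 + eta) S ^ 2 + 4 (1 + 1 / eta) r ^ 2]: a small relative error and an additive one of order
    [c]. *)
Lemma shape_perturb (u v u' v' c eta : R) : 0 <= u' -> 0 <= v' -> 0 <= c -> 0 < eta ->
  u <= u' + c -> v <= v' + c ->
  shape u v <= (1 + eta) * shape u' v' + 4 * (1 + eta^-1) * c.
Proof.
move=> u0 v0 c0 eta0 uc vc.
have sqrtD (x z : R) : 0 <= x -> z <= x + c -> Num.sqrt z <= Num.sqrt x + Num.sqrt c.
  move=> x0 zx; apply: (@le_trans _ _ (Num.sqrt (x + c))); first by rewrite ler_wsqrtr.
  rewrite -(ger0_norm (addr_ge0 (sqrtr_ge0 x) (sqrtr_ge0 c))) -sqrtr_sqr ler_wsqrtr//.
  by rewrite sqrrD !sqr_sqrtr// lerD2r lerDl mulrn_wge0// mulr_ge0 ?sqrtr_ge0.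
have h : Num.sqrt u + Num.sqrt v <= (Num.sqrt u' + Num.sqrt v') + 2 * Num.sqrt c.
  by have := sqrtD _ _ u0 uc; have := sqrtD _ _ v0 vc; lra.
rewrite /shape; move: h; set S := Num.sqrt u' + _; set S' := Num.sqrt u + _ => h.
have S0 : 0 <= S' by rewrite addr_ge0 ?sqrtr_ge0.
apply: (@le_trans _ _ ((S + 2 * Num.sqrt c) ^+ 2)).
  by rewrite lerXn2r// nnegrE (le_trans S0 h).
have := sqr_sqrtr c0; move: (Num.sqrt c) => r <-.
rewrite -subr_ge0.
have -> : (1 + eta) * S ^+ 2 + 4 * (1 + eta^-1) * r ^+ 2 - (S + 2 * r) ^+ 2 =
  eta * (S - 2 * r / eta) ^+ 2 by field; rewrite gt_eqF.
by rewrite mulr_ge0 ?sqr_ge0// ltW.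
Qed.

(** Equidistant points of [y] are rounded to the lattice and joined by nearly optimal paths. This is
    possible because [y] has Lipschitz constant 1: the coordinates [u] and [v] do not decrease along
    it. *)
Lemma path_lower (K : nat) (eta : R) (y : R -> R) : (0 < K)%N -> 0 < eta ->
  l / K%:R + 2 / N%:R <= dl ->
  (forall a c m n, (a + m <= mN N)%N -> (c + n <= nN N)%N -> exists s, [/\ count id s = m,
    count negb s = n & shape m%:R n%:R - eps * N%:R <= psum w (a, c) s]) ->
  Xset l b y ->
  calG l alpha y <= lpp (wt N w) (mN N) (nN N) + 4 * e * l + 2 * A * eta * l +
    K%:R * (A * (eps + 4 * (1 + eta^-1) / N%:R)).
Proof.
move=> K0 eta0 dl1 low Xy; have [y0 yl ylip] := Xy.
have KR : 0 < K%:R :> R by rewrite ltr0n.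
pose xs (k : nat) := k%:R * l / K%:R.
have xs0 : xs 0%N = 0 by rewrite /xs !mul0r.
have xsK : xs K = l by rewrite /xs mulrAC mulfV ?mul1r// gt_eqF.
have xsS k : xs k.+1 - xs k = l / K%:R by rewrite /xs -natr1; ring.
have lK0 : 0 < l / K%:R by exact: divr_gt0.
have xsl k : (k <= K)%N -> 0 <= xs k <= l.
  move=> kK; rewrite /xs -mulrA mulr_ge0 ?(ltW lK0)//= mulrCA -[leRHS]mulr1 ler_pM2l//.
  by rewrite ler_pdivrMr// mul1r ler_nat.
pose u k := (xs k + y (xs k)) / 2; pose v k := (xs k - y (xs k)) / 2.
have uvb k : (k <= K)%N -> 0 <= u k <= (l + b) / 2 /\ 0 <= v k <= (l - b) / 2.
  move=> kK; apply/Qrect_uv.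
  have -> : (u k + v k, u k - v k) = (xs k, y (xs k)) by rewrite /u /v; congr pair; field.
  by apply: (Xset_Qrect l0 Xy); exact: xsl.
have uvS k : (k < K)%N -> u k <= u k.+1 /\ v k <= v k.+1.
  move=> kK; have := ylip (xs k.+1) (xs k); rewrite !in_itv/= !xsl ?(ltnW kK)// => /(_ isT isT).
  rewrite xsS (gtr0_norm lK0) ler_norml -(xsS k) /u /v => /andP[h1 h2].
  by split; lra.
pose i k := Num.truncn (N%:R * u k); pose j k := Num.truncn (N%:R * v k).
have iP k : (k <= K)%N -> (i k)%:R <= N%:R * u k < (i k)%:R + 1.
  by move=> /uvb[/andP[h _] _]; rewrite natr1; apply: truncn_itv; rewrite mulr_ge0.
have jP k : (k <= K)%N -> (j k)%:R <= N%:R * v k < (j k)%:R + 1.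
  by move=> /uvb[_ /andP[h _]]; rewrite natr1; apply: truncn_itv; rewrite mulr_ge0.
have iS k : (k < K)%N -> (i k <= i k.+1)%N.
  by move=> /uvS[h _]; apply: le_truncn; rewrite ler_pM2l.
have jS k : (k < K)%N -> (j k <= j k.+1)%N.
  by move=> /uvS[_ h]; apply: le_truncn; rewrite ler_pM2l.
(* Rounding down makes the chain start at the origin and end exactly at the corner of the grid. *)
have iK : i K = mN N by rewrite /i /mN /u xsK yl.
have jK : j K = nN N by rewrite /j /nN /v xsK yl.
have i0 : i 0%N = 0%N by rewrite /i /u xs0 y0 addr0 mul0r mulr0 truncn0.
have j0 : j 0%N = 0%N by rewrite /j /v xs0 y0 subr0 mul0r mulr0 truncn0.
pose al k := alpha (xs k, y (xs k)).
have Qk k : (k <= K)%N -> Qrect l b (xs k, y (xs k)) by move=> kK; apply: (Xset_Qrect l0 Xy); exact: xsl.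
pose sh k : R := shape (((i k.+1)%:R - (i k)%:R) / N%:R) (((j k.+1)%:R - (j k)%:R) / N%:R).
have iKle k : (k <= K)%N -> (i k <= mN N)%N.
  by move=> /uvb[/andP[_ h] _]; apply: le_truncn; rewrite ler_pM2l.
have jKle k : (k <= K)%N -> (j k <= nN N)%N.
  by move=> /uvb[_ /andP[_ h]]; apply: le_truncn; rewrite ler_pM2l.
have chain k : (k <= K)%N -> exists s, [/\ count id s = i k, count negb s = j k &
    \sum_(k' < k) ((al k' - e) * sh k' - A * eps) <= psum (wt N w) (0, 0)%N s].
  elim: k => [|k IH] kK; first by exists [::]; rewrite i0 j0 big_ord0.
  have [s [si sj hs]] := IH (ltnW kK).
  have dij : (i k + (i k.+1 - i k) = i k.+1)%N /\ (j k + (j k.+1 - j k) = j k.+1)%N.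
    by rewrite !subnKC ?iS ?jS.
  have [||s' [s'i s'j hs']] := low (i k) (j k) (i k.+1 - i k)%N (j k.+1 - j k)%N.
  - by rewrite dij.1 iKle.
  - by rewrite dij.2 jKle.
  have pe : pend (i k, j k) s' = (i k.+1, j k.+1) by rewrite /pend /= s'i s'j dij.1 dij.2.
  exists (s ++ s'); rewrite !count_cat si sj s'i s'j dij.1 dij.2; split => //.
  rewrite big_ord_recr/= psum_cat; apply: lerD => //.
  rewrite (_ : pend _ s = (i k, j k)); last by rewrite /pend si sj.
  have /andP[h _] : Num.max (al k - e) 0 / N%:R * psum w (i k, j k) s' <= psum (wt N w) (i k, j k) s'
      <= (al k + e) / N%:R * psum w (i k, j k) s'.
    apply: psum_wt_bounds; rewrite ?pe; [exact: Qk (ltnW kK)|exact: iKle|exact: jKle|].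
    move=> q /andP[/= q1 q2] /andP[q3 q4].
    have [u1 v1] := uvS k kK.
    have /andP[i1 i2] := iP _ (ltnW kK); have /andP[j1 j2] := jP _ (ltnW kK).
    have /andP[i3 i4] := iP _ kK; have /andP[j3 j4] := jP _ kK.
    have xv : xs k = u k + v k by rewrite /u /v; field.
    have yv : y (xs k) = u k - v k by rewrite /u /v; field.
    have huv : u k.+1 - u k + (v k.+1 - v k) = l / K%:R by rewrite -(xsS k) /u /v; field.
    move: q1 q2 q3 q4; rewrite -!(ler_nat R) => q1 q2 q3 q4.
    have NV : N%:R / N%:R = 1 :> R by rewrite mulfV// gt_eqF.
    have qa : - (1 / N%:R) <= q.1%:R / N%:R - u k <= u k.+1 - u k.
      rewrite lerD2r ler_pdivrMr// lerBrDr [_ + u k]addrC ler_pdivlMr// mulrBl divfK ?gt_eqF//.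
      by apply/andP; split; lra.
    have qb : - (1 / N%:R) <= q.2%:R / N%:R - v k <= v k.+1 - v k.
      rewrite lerD2r ler_pdivrMr// lerBrDr [_ + v k]addrC ler_pdivlMr// mulrBl divfK ?gt_eqF//.
      by apply/andP; split; lra.
    rewrite mulrDl mulrBl yv xv !ler_norml.
    have N1 : 0 < 1 / N%:R :> R by rewrite divr_gt0.
    move: qa qb => /andP[qa1 qa2] /andP[qb1 qb2] {i1 i2 i3 i4 j1 j2 j3 j4 q1 q2 q3 q4 NV hs hs'}.
    by split; apply/andP; split; lra.
  apply: le_trans h.
  have mx0 : 0 <= Num.max (al k - e) 0 by rewrite le_max lexx orbT.
  have mxA : Num.max (al k - e) 0 <= A.
    rewrite ge_max (ltW A0) andbT; have := aA (Qk _ (ltnW kK)); rewrite -/(al k); move: e0; lra.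
  have shN : sh k * N%:R = shape (i k.+1 - i k)%:R (j k.+1 - j k)%:R.
    by rewrite !natrB ?iS ?jS// /sh -shapeZ ?divfK ?gt_eqF// subr_ge0 ler_nat ?iS ?jS.
  apply: (@le_trans _ _ (Num.max (al k - e) 0 * (sh k - eps))); last first.
    rewrite -mulrA ler_wpM2l// mulrC ler_pdivlMr// mulrBl shN.
    exact: hs'.
  rewrite mulrBr; apply: lerB.
    by rewrite ler_wpM2r ?shape_ge0// le_max lexx.
  by rewrite ler_wpM2r// ltW.
have [s [si sj hs]] := chain K (leqnn K).
have := psum_le_lpp (wt N w) s; rewrite si sj iK jK => hl.
have R1 : calG l alpha y <= \sum_(k < K) al k * shape (u k.+1 - u k) (v k.+1 - v k) + 2 * e * l.
  have := @calG_le_riemann _ _ _ _ l0 ca a0 y xs K e dl Xy e0 modulus.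
  have -> : \sum_(k < K) al k * shape (u k.+1 - u k) (v k.+1 - v k) =
    \sum_(k < K) alpha (xs k, y (xs k)) *
     shape ((xs k.+1 - xs k + (y (xs k.+1) - y (xs k))) / 2)
           ((xs k.+1 - xs k - (y (xs k.+1) - y (xs k))) / 2).
    by apply: eq_bigr => k _; congr (_ * shape _ _); rewrite /u /v; field.
  apply => //.
  - by move=> k _; rewrite -subr_ge0 xsS ltW.
  - by move=> k _; rewrite xsS; apply: le_trans dl1; rewrite lerDl divr_ge0.
have shS : \sum_(k < K) sh k <= 2 * l.
  apply: (@le_trans _ _ (\sum_(k < K) 2 * (((i k.+1 + j k.+1)%:R - (i k + j k)%:R) / N%:R))).
    apply: ler_sum => k _; apply: le_trans (shape_le _ _) _; rewrite ?divr_ge0 ?subr_ge0 ?ler_nat ?iS ?jS//.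
    by rewrite -mulrDl !natrD le_eqVlt; apply/orP; left; apply/eqP; congr (2 * (_ / _)); ring.
  rewrite -mulr_sumr -mulr_suml -(big_mkord xpredT (fun k => (i k.+1 + j k.+1)%:R - (i k + j k)%:R)).
  rewrite telescope_sumr// i0 j0 subr0 iK jK ler_pM2l// ler_pdivrMr// natrD.
  by have /andP[m1 _] := mN_itv N; have /andP[n1 _] := nN_itv N; lra.
have N1 : 0 <= 1 / N%:R :> R by rewrite divr_ge0.
(* Each term splits into what the chain of paths realizes and the errors: [e * sh k] from freezing
   [alpha], [A * eta * sh k] and the part in [1 / N] from rounding, and [A * eps] from the passage
   times. *)
have R2 : \sum_(k < K) al k * shape (u k.+1 - u k) (v k.+1 - v k) <=
  \sum_(k < K) ((al k - e) * sh k - A * eps + ((e + A * eta) * sh k + A * (eps + 4 * (1 + eta^-1) / N%:R))).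
  apply: ler_sum => k _; have kK := ltn_ord k.
  have al0 : 0 <= al k by apply: a0; exact: Qk (ltnW kK).
  have alA : al k <= A by apply: aA; exact: Qk (ltnW kK).
  have sp : shape (u k.+1 - u k) (v k.+1 - v k) <= (1 + eta) * sh k + 4 * (1 + eta^-1) * (1 / N%:R).
    have /andP[i1 i2] := iP _ (ltnW kK); have /andP[j1 j2] := jP _ (ltnW kK).
    have /andP[i3 i4] := iP _ kK; have /andP[j3 j4] := jP _ kK.
    apply: shape_perturb => //; rewrite ?divr_ge0 ?subr_ge0 ?ler_nat ?iS ?jS//.
      by rewrite -mulrDl ler_pdivlMr// mulrC; lra.
    by rewrite -mulrDl ler_pdivlMr// mulrC; lra.
  have sh0 : 0 <= sh k by exact: shape_ge0.
  set q := 4 * (1 + eta^-1) in sp *.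
  have q0 : 0 <= q by rewrite mulr_ge0// addr_ge0// invr_ge0 ltW.
  apply: le_trans (ler_wpM2l al0 sp) _.
  have h1 : al k * (eta * sh k) <= A * (eta * sh k) by rewrite ler_wpM2r// mulr_ge0// ltW.
  have h2 : al k * (q * (1 / N%:R)) <= A * (q * (1 / N%:R)) by rewrite ler_wpM2r// mulr_ge0.
  have -> : A * (eps + q / N%:R) = A * eps + A * (q * (1 / N%:R)) by rewrite mul1r mulrDr.
  rewrite mulrDr (mulrDl 1 eta) mul1r (mulrDr (al k) (sh k)).
  move: h1 h2; lra.
rewrite big_split/= in R2.
rewrite [X in _ <= _ + X](_ : _ = (e + A * eta) * (\sum_(k < K) sh k) +
    K%:R * (A * (eps + 4 * (1 + eta^-1) / N%:R))) in R2; last first.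
  rewrite big_split/= -mulr_sumr; congr (_ + _).
  by rewrite sumr_const card_ord -[LHS]mulr_natl.
have h3 : (e + A * eta) * (\sum_(k < K) sh k) <= (e + A * eta) * (2 * l).
  by rewrite ler_wpM2l// addr_ge0 ?(ltW e0)// mulr_ge0// ltW.
have h4 : (e + A * eta) * (2 * l) = 2 * e * l + 2 * A * eta * l by ring.
rewrite h4 in h3; move: R1 R2 h3 hs hl.
set BB := K%:R * _; set CC := \sum_(k < K) ((al k - e) * _ - _).
lra.
Qed.

End coarse_graining.

(** * The deterministic conclusion off the bad event *)

Section good_event.
Context (R : realType).
Variables (l b : R) (alpha : R * R -> R).
Hypotheses (l0 : 0 < l) (bl : `|b| < l) (ca : {within Qrect l b, continuous alpha}).
Hypothesis (a0 : forall p, Qrect l b p -> 0 <= alpha p).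
Notation Gstar := (sup [set calG l alpha y | y in Xset l b]).

Lemma Xset_nonempty : Xset l b !=set0.
Proof.
exists (fun x => b / l * x); split; rewrite ?mulr0 ?divfK ?gt_eqF// => x1 x2 _ _.
rewrite -mulrBr normrM ler_piMl// normrM normfV (gtr0_norm l0) ler_pdivrMr// mul1r.
exact: ltW.
Qed.

(** The constants are fixed in the order [e], [dl], [K], [eta], [eps], [N0]; each kind of error
    receives at most [delta / 4]. *)
Lemma lpp_near_sup (delta : R) : 0 < delta -> exists eps N0 : R, 0 < eps /\
  forall N (w : nat * nat -> R), (0 < N)%N -> N0 <= N%:R ->
  (forall p, p \in grid (mN l b N) (nN l b N) -> 0 <= w p) ->
  (forall a c s, (a + count id s <= mN l b N)%N -> (c + count negb s <= nN l b N)%N ->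
    psum w (a, c) s <= shape (count id s)%:R (count negb s)%:R + eps * N%:R) ->
  (forall a c m n, (a + m <= mN l b N)%N -> (c + n <= nN l b N)%N -> exists s, [/\ count id s = m,
    count negb s = n & shape m%:R n%:R - eps * N%:R <= psum w (a, c) s]) ->
  w (0, 0)%N <= eps * N%:R ->
  `|wt alpha N w (0, 0)%N + lpp (wt alpha N w) (mN l b N) (nN l b N) - Gstar| <= delta.
Proof.
move=> d0; have [A A0 aA] := alpha_bounded ca.
pose e := Num.min 1 (delta / (16 * l)).
have e0 : 0 < e by rewrite lt_min ltr01 divr_gt0// mulr_gt0.
have e1 : e <= 1 by rewrite ge_min lexx.
have e2 : 4 * e * l <= delta / 4.
  have : e <= delta / (16 * l) by rewrite ge_min lexx orbT.
  rewrite ler_pdivlMr ?mulr_gt0//; lra.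
have [dl dl0 hdl] := alpha_modulus ca e0.
pose K := (Num.truncn (2 * l / dl)).+1.
have KR : 0 < K%:R :> R by rewrite ltr0n.
have lK : l / K%:R <= dl / 2.
  have : 2 * l / dl < K%:R by exact: truncnS_gt.
  rewrite ltr_pdivrMr// ler_pdivrMr//; lra.
pose eta := delta / (8 * A * l).
have eta0 : 0 < eta by rewrite divr_gt0// !mulr_gt0.
have eta1 : 2 * A * eta * l = delta / 4.
  by rewrite /eta; field; rewrite !gt_eqF.
(* There are [K + 1] shares: one for each piece and one for the weight at the origin, which [lpp]
   omits. *)
pose eps := delta / (4 * (K%:R + 1) * (A + 1)).
have A1 : 0 < A + 1 by rewrite addr_gt0.
have K1 : 0 < K%:R + 1 :> R by rewrite addr_gt0.
have eps0 : 0 < eps by rewrite divr_gt0// !mulr_gt0.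
have epsE : (K%:R + 1) * ((A + 1) * eps) = delta / 4.
  by rewrite /eps; field; rewrite !gt_eqF.
pose q := 4 * (1 + eta^-1).
have q0 : 0 < q by rewrite mulr_gt0// addr_gt0// invr_gt0.
exists eps, (Num.max (4 / dl) (4 * (K%:R * (A * q)) / delta)); split => // N w N0.
have NR : 0 < N%:R :> R by rewrite ltr0n.
rewrite ge_max => /andP[N1 N2] w0 up low w00.
have N1' : 2 / N%:R <= dl / 2.
  by move: N1; rewrite ler_pdivrMr// ler_pdivrMr//; lra.
have N2' : K%:R * (A * (q / N%:R)) <= delta / 4.
  by move: N2; rewrite ler_pdivrMr// !mulrA ler_pdivrMr//; lra.
have i1 : 1 / N%:R <= 2 / N%:R :> R by rewrite ler_pM2r ?invr_gt0// ler1n.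
have Q00 : Qrect l b (lattice_pt R N (0, 0)%N).
  by apply/(grid_Qrect bl _ N0); rewrite mem_grid.
have al0 := a0 Q00; have alA := aA _ Q00.
have x00 : 0 <= w (0, 0)%N by apply: w0; rewrite mem_grid.
have b1 : 0 <= wt alpha N w (0, 0)%N by rewrite mulr_ge0// divr_ge0.
have b2 : wt alpha N w (0, 0)%N <= (A + 1) * eps.
  rewrite /wt mulrAC ler_pdivrMr// -mulrA; apply: ler_pM => //.
  by apply: le_trans alA _; rewrite lerDl.
have h1 : lpp (wt alpha N w) (mN l b N) (nN l b N) <= Gstar + 4 * e * l + K%:R * ((A + e) * eps).
  have [s [sm sn <-]] := lpp_path (wt alpha N w) (mN l b N) (nN l b N).
  by apply: (@path_upper _ _ _ _ l0 bl ca a0 e dl A eps) => //; lra.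
have h2 : Gstar <= lpp (wt alpha N w) (mN l b N) (nN l b N) + 4 * e * l + 2 * A * eta * l +
    K%:R * (A * (eps + 4 * (1 + eta^-1) / N%:R)).
  apply: ge_sup; first by have [y Xy] := Xset_nonempty; exists (calG l alpha y), y.
  move=> _ [y Xy <-].
  by apply: (@path_lower _ _ _ _ l0 bl ca a0 e dl A eps) => //; lra.
have k1 : K%:R * ((A + e) * eps) <= K%:R * ((A + 1) * eps).
  by rewrite ler_pM2l// ler_pM2r// lerD2l.
have k2 : K%:R * (A * eps) <= K%:R * ((A + 1) * eps).
  by rewrite ler_pM2l// ler_pM2r// lerDl.
have k3 : K%:R * (A * (eps + q / N%:R)) = K%:R * (A * eps) + K%:R * (A * (q / N%:R)).
  by rewrite !mulrDr.
rewrite -/q k3 in h2; rewrite mulrDl mul1r in epsE.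
have p0 : 0 < (A + 1) * eps by rewrite mulr_gt0.
rewrite ler_norml; move: h1 h2; set L := lpp _ _ _ => h1 h2.
by apply/andP; split; lra.
Qed.

End good_event.

(** * From lattice points of the rectangle to the grid *)

Section lattice_transfer.
Context (R : realType).
Variables (l b : R) (N : nat).
Hypotheses (bl : `|b| < l) (N0 : (0 < N)%N).
Implicit Types (p q : nat * nat) (s : seq bool).
Notation pt := (lattice_pt R N).

Let NR : 0 < N%:R :> R. Proof. by rewrite ltr0n. Qed.
Let NR' : (N%:R : R) != 0. Proof. by rewrite gt_eqF. Qed.

Definition lattice_inv (z : R * R) : nat * nat :=
  (Num.truncn (N%:R * ((z.1 + z.2) / 2)), Num.truncn (N%:R * ((z.1 - z.2) / 2))).

Lemma lattice_ptK : cancel pt lattice_inv.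
Proof.
move=> [i j]; rewrite /lattice_inv /lattice_pt /=.
have -> : N%:R * (((i%:R + j%:R) / N%:R + (i%:R - j%:R) / N%:R) / 2) = i%:R :> R by field.
have -> : N%:R * (((i%:R + j%:R) / N%:R - (i%:R - j%:R) / N%:R) / 2) = j%:R :> R by field.
by rewrite !natrK.
Qed.

Lemma SN_grid (z : R * R) : SN l b N z <-> exists2 p, p \in grid (mN l b N) (nN l b N) & z = pt p.
Proof.
split => [[Qz [i [j [/dvdzP[a ij] zE]]]]|[p pg ->]]; last first.
  split; first exact/(grid_Qrect bl).
  exists (p.1%:Z + p.2%:Z), (p.1%:Z - p.2%:Z); split.
    by apply/dvdzP; exists p.1%:Z; lia.
  by rewrite /lattice_pt !rmorphD rmorphN.
(* With [i + j = 2 a] the grid coordinates are [a] and [i - a]: the parity condition makes them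
   integers. *)
have jE : j = a * 2 - i by rewrite -ij addrC addKr.
have zE' : z = (a%:~R / N%:R + (i - a)%:~R / N%:R, a%:~R / N%:R - (i - a)%:~R / N%:R).
  by rewrite zE jE !rmorphB rmorphM /=; congr pair; field.
have := Qz; rewrite zE' => /Qrect_uv[/andP[a0 _] /andP[c0 _]].
rewrite pmulr_lge0 ?invr_gt0// ler0z in a0; rewrite pmulr_lge0 ?invr_gt0// ler0z in c0.
have zp : z = pt (`|a|%N, `|(i - a)%R|%N).
  by rewrite zE' lattice_pt_uv /= !natr_absz !ger0_norm.
exists (`|a|%N, `|(i - a)%R|%N); last by rewrite -zE'.
by apply/(grid_Qrect bl _ N0); rewrite -zp.
Qed.

(** The first coordinate is the sum of the grid coordinates over [N], and this is largest only at
    the corner. *)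
Lemma rightmost_corner (z : R * R) : rightmost l b N z <-> z = pt (mN l b N, nN l b N).
Proof.
have cornerS : SN l b N (pt (mN l b N, nN l b N)) by apply/SN_grid; exists (mN l b N, nN l b N); rewrite ?mem_grid ?leqnn.
have le q : q \in grid (mN l b N) (nN l b N) -> (pt q).1 <= (pt (mN l b N, nN l b N)).1.
  by rewrite mem_grid => /andP[h1 h2]; rewrite ler_pM2r ?invr_gt0// lerD ?ler_nat.
split => [[/SN_grid[q qg ->] /(_ _ cornerS)]|->]; last first.
  by split => // _ /SN_grid[q qg ->]; exact: le.
rewrite ler_pM2r ?invr_gt0// -!natrD ler_nat; move: qg; rewrite mem_grid => /andP[h1 h2] h3.
by congr pt; case: q h1 h2 h3 => q1 q2 /= h1 h2 h3; congr pair; lia.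
Qed.

Fixpoint ppath p s : seq (nat * nat) := if s is e :: s' then pstep e p :: ppath (pstep e p) s' else [::].

Lemma psum_ppath (x : nat * nat -> R) p s : psum x p s = \sum_(q <- ppath p s) x q.
Proof. by elim: s p => [|e s IH] p /=; rewrite ?big_nil ?big_cons ?IH. Qed.

Lemma last_ppath p s : last p (ppath p s) = pend p s.
Proof. by elim: s p => [|e s IH] p /=; rewrite ?IH ?pend_cons// /pend !addn0; case: p. Qed.

Lemma ppath_le p s q : q \in ppath p s -> ((q.1 <= (pend p s).1) && (q.2 <= (pend p s).2))%N.
Proof.
elim: s p => [//|e s IH] p; rewrite in_cons pend_cons => /predU1P[->|/IH//].
by rewrite !leq_addr.
Qed.

Lemma path_lattice p (pi : seq (R * R)) :
  path (@lstep R N) (pt p) pi <-> exists s, pi = map pt (ppath p s).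
Proof.
split => [|[s ->]].
  elim: pi p => [|z pi IH] p /=; first by exists [::].
  move=> /andP[/andP[/eqP z1 z2] hpi].
  have [e ze] : exists e, z = pt (pstep e p).
    have z1' : z.1 = N%:R^-1 + (pt p).1 by rewrite -z1 subrK.
    have z2' u : z.2 - (pt p).2 = u -> z.2 = u + (pt p).2 by move=> <-; rewrite subrK.
    case/orP: z2 => /eqP/z2' z2; [exists true|exists false];
      by rewrite [z]surjective_pairing z1' z2 /lattice_pt /= -natr1; congr pair; ring.
  have [|s ->] := IH (pstep e p); first by rewrite -ze.
  by exists (e :: s); rewrite ze.
elim: s p => [//|e s IH] p /=; rewrite IH andbT /lstep /lattice_pt.
apply/andP; split; first by apply/eqP; case: e => /=; rewrite -natr1; ring.
by case: e => /=; rewrite -natr1; apply/orP; [left|right]; apply/eqP; ring.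
Qed.

(** Lattice paths to the rightmost point are the words with prescribed letter counts, and among
    these the recursion attains the supremum. *)
Lemma LPP_lpp (x : R * R -> R) :
  LPP l b N x = x (0, 0) + lpp (x \o pt) (mN l b N) (nN l b N).
Proof.
have p00 : pt (0, 0)%N = (0, 0) by rewrite /lattice_pt /= addr0 subr0 mul0r.
rewrite /LPP.
have -> : [set (\sum_(p <- (0, 0) :: pi) x p) | pi in [set pi | is_lpath l b N pi]] =
    [set x (0, 0) + psum (x \o pt) (0, 0)%N s |
      s in [set s | count id s = mN l b N /\ count negb s = nN l b N]].
  apply/seteqP; split.
    move=> _ [pi [pth _ rm] <-]; rewrite -p00 in pth rm.
    have [s piE] := (path_lattice _ _).1 pth.
    exists s; last by rewrite big_cons psum_ppath piE big_map.
    move: rm => /rightmost_corner; rewrite piE last_map last_ppath => /(can_inj lattice_ptK).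
    by rewrite /pend /= !add0n => -[-> ->].
  move=> _ [s [sm sn] <-]; exists (map pt (ppath (0, 0)%N s)).
    rewrite /is_lpath -p00; split.
    - by apply/path_lattice; exists s.
    - move=> _ /mapP[q /ppath_le qs ->]; apply/SN_grid; exists q => //.
      by move: qs; rewrite /pend /= !add0n sm sn mem_grid.
    - by apply/rightmost_corner; rewrite last_map last_ppath /pend /= !add0n sm sn.
  by rewrite big_cons psum_ppath big_map.
have [s [sm sn sE]] := lpp_path (x \o pt) (mN l b N) (nN l b N).
have ub : ubound [set x (0, 0) + psum (x \o pt) (0, 0)%N s |
      s in [set s | count id s = mN l b N /\ count negb s = nN l b N]]
      (x (0, 0) + lpp (x \o pt) (mN l b N) (nN l b N)).
  by move=> _ [t [tm tn] <-]; rewrite lerD2l -tm -tn; exact: psum_le_lpp.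
apply/eqP; rewrite eq_le; apply/andP; split.
  by apply: ge_sup => //; exists (x (0, 0) + psum (x \o pt) (0, 0)%N s), s.
apply: ub_le_sup; first by eexists; exact: ub.
by exists s => //; rewrite sE.
Qed.

End lattice_transfer.

(** * Extension of the probability space by further exponentials *)

Section extension.
Context (R : realType) (I : eqType) (r : I -> R).
Hypothesis r0 : forall i, 0 < r i.

(** The new variable is the second coordinate on a product with an exponential law, and [phi] is the
    first projection, along which the old variables are pulled back. *)
Lemma iexp_extend1 d (T : measurableType d) (P : probability T R) (X : I -> T -> R) s i :
  i \notin s -> iexp P r X s ->
  exists d' (T' : measurableType d') (P' : probability T' R) (phi : T' -> T) X',
  [/\ measurable_fun setT phi, forall A, measurable A -> P' (phi @^-1` A) = P A,
      iexp P' r X' (i :: s) & forall j, j \in s -> X' j = X j \o phi].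
Proof.
move=> si [mX h].
pose Q : probability R R := expo (r0 i).
pose X' j (w : T * R) := if j == i then w.2 else X j w.1.
exists _, _, (product_prob P Q), fst, X'; split.
- exact: measurable_fst.
- move=> A mA.
  transitivity ((P \x Q)%E (A `*` setT)).
    by congr (product_measure1 _ _ _); apply/seteqP; split => // -[x z] [].
  by rewrite product_measure1E// [X in (_ * X)%E](@probability_setT _ _ _ Q) mule1.
- split => [j|B mB].
    rewrite /X' in_cons; case: eqP => [_ _|_ /= sj]; first exact: measurable_snd.
    by apply: measurableT_comp; [exact: mX|exact: measurable_fst].
  transitivity ((P \x Q)%E (box X B s `*` B i)).
    congr (product_measure1 _ _ _); apply/seteqP; split => -[x z] /=.
      move=> hw; split.
        move=> j sj; have := hw j; rewrite in_cons sj orbT /X' => /(_ isT).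
        by case: eqP => [ji|//]; rewrite ji (negbTE si) in sj.
      by have := hw i; rewrite mem_head /X' eqxx => /(_ isT).
    move=> [hw Bz] j; rewrite in_cons /X'; case: eqP => [->//|_ /=]; exact: hw.
  rewrite product_measure1E//; last exact: measurable_box.
  transitivity ((\prod_(j <- s) fine (exponential_prob (r j) (B j)))%:E * Q (B i))%E.
    by rewrite -h.
  rewrite big_cons mulrC EFinM; apply: congr1.
  by rewrite fineK//; exact: (@fin_num_measure _ _ _ Q).
- move=> j sj; apply/funext => -[x z]; rewrite /X' /=; case: eqP => // ji.
  by rewrite ji (negbTE si) in sj.
Qed.

Lemma iexp_extend d (T : measurableType d) (P : probability T R) (X : I -> T -> R) s s2 :
  uniq (s2 ++ s) -> iexp P r X s ->
  exists d' (T' : measurableType d') (P' : probability T' R) (phi : T' -> T) X',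
  [/\ measurable_fun setT phi, forall A, measurable A -> P' (phi @^-1` A) = P A,
      iexp P' r X' (s2 ++ s) & forall j, j \in s -> X' j = X j \o phi].
Proof.
elim: s2 => [_ h|i s2 IH /= /andP[is2 us] h]; first by
  exists d, T, P, id, X; split => //; exact: measurable_id.
have [d1 [T1 [P1 [phi1 [X1 [mphi1 hphi1 h1 hX1]]]]]] := IH us h.
have [d2 [T2 [P2 [phi2 [X2 [mphi2 hphi2 h2 hX2]]]]]] := iexp_extend1 is2 h1.
exists d2, T2, P2, (phi1 \o phi2), X2; split => //.
- exact: measurableT_comp.
- move=> A mA; rewrite comp_preimage hphi2 ?hphi1//.
  by rewrite -[X in measurable X]setTI; exact: mphi1.
- by move=> j sj; rewrite hX2 ?mem_cat ?sj ?orbT// hX1.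
Qed.

End extension.

Lemma le_lpp (R : realType) (x x' : nat * nat -> R) m n : (forall p, p \in grid m n -> x p <= x' p) ->
  lpp x m n <= lpp x' m n.
Proof.
move=> xx'; have [s [sm sn <-]] := lpp_path x m n.
rewrite -sm -sn; apply: le_trans (psum_le_lpp x' s); apply: ler_psum => q /andP[_ q1] /andP[_ q2] _.
by apply: xx'; rewrite mem_grid -sm -sn; move: q1 q2; rewrite /pend /= !add0n => -> ->.
Qed.

(** * Exponential bounds and almost sure convergence for the given weights *)

Section concentration.
Context d (T : measurableType d) (R : realType) (P : probability T R).
Variables (l b : R) (alpha : R * R -> R) (xi : nat -> R * R -> T -> R).
Hypotheses (l0 : 0 < l) (bl : `|b| < l) (ca : {within Qrect l b, continuous alpha}).
Hypothesis (a0 : forall p, Qrect l b p -> 0 <= alpha p).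
Hypothesis (mxi : forall N p, SN l b N p -> measurable_fun setT (xi N p)).
Hypothesis (dxi : forall N p, (0 < N)%N -> SN l b N p ->
  distributed_as_scaled_exp P (xi N p) (alpha p / N%:R)).
Hypothesis (ixi : forall N, (0 < N)%N -> mutually_independent P (SN l b N) (xi N)).
Notation Gstar := (sup [set calG l alpha y | y in Xset l b]).
Notation gridN N := (grid (mN l b N) (nN l b N)).
Notation pt := (lattice_pt R).

Let SN_pt N p : (0 < N)%N -> p \in gridN N -> SN l b N (pt N p).
Proof. by move=> N0 pg; apply/(SN_grid bl N0); exists p. Qed.

Lemma iexp_active N : (0 < N)%N ->
  iexp P (fun=> 1) (fun p w => N%:R / alpha (pt N p) * xi N (pt N p) w)
    [seq p <- gridN N | 0 < alpha (pt N p)].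
Proof.
move=> N0; have NR : 0 < N%:R :> R by rewrite ltr0n.
set s := [seq p <- _ | _].
have ptK : cancel (pt N) (@lattice_inv R N) by exact: lattice_ptK.
suff h : iexp P (fun=> 1) (fun z w => N%:R / alpha z * xi N z w) (map (pt N) s).
  exact: (iexp_reindex ptK h).
have sS z : z \in map (pt N) s -> SN l b N z /\ 0 < alpha z.
  by move=> /mapP[p]; rewrite mem_filter => /andP[ap pg] ->; split => //; exact: SN_pt.
have us : uniq (map (pt N) s).
  by rewrite map_inj_uniq ?filter_uniq ?grid_uniq//; exact: can_inj ptK.
split => [z /sS[zS az]|B mB]; first by apply: measurable_funM => //; exact: mxi.
pose B' z := (fun x => N%:R / alpha z * x) @^-1` B z.
have mB' z : measurable (B' z).
  by rewrite -[X in measurable X]setTI; apply: measurable_funM.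
have fin := @fin_num_measure _ _ _ P (box (xi N) B' (map (pt N) s)).
transitivity (P (box (xi N) B' (map (pt N) s))) => //.
rewrite -[LHS]fineK ?fin//; last by apply: measurable_box => // z /sS[/mxi].
apply: congr1; rewrite [LHS](ixi N0 us _ mB'); last by move=> z /sS[].
apply: eq_big_seq => z /sS[zS az]; rewrite (dxi N0 zS)//.
congr (fine (exponential_prob _ _)); apply/funext => x; rewrite /B' /preimage /=.
by congr (B z _); field; rewrite !gt_eqF.
Qed.

Lemma negligible_inactive N : (0 < N)%N -> exists Z : set T,
  [/\ measurable Z, P Z = 0%E & forall w p, ~ Z w -> p \in gridN N -> ~~ (0 < alpha (pt N p)) ->
    xi N (pt N p) w = 0].
Proof.
move=> N0; set s := [seq p <- gridN N | ~~ (0 < alpha (pt N p))].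
pose F p := if p \in s then xi N (pt N p) @^-1` [set~ 0] else set0.
have sS p : p \in s -> SN l b N (pt N p) /\ alpha (pt N p) = 0.
  rewrite mem_filter -leNgt => /andP[ap pg]; split; first exact: SN_pt.
  by apply/eqP; rewrite eq_le ap a0//; exact/(grid_Qrect bl).
have mF p : measurable (F p).
  rewrite /F; case: ifPn => // /sS[pS _]; rewrite -[X in measurable X]setTI.
  by apply: (mxi pS) => //; exact: measurableC.
have PF p : (P (F p) <= 0%:E)%E.
  rewrite /F; case: ifPn => [/sS[pS ap]|]; last by rewrite measure0.
  rewrite (dxi N0 pS); last exact: measurableC.
  (* With scale 0 this is the preimage of [[set~ 0]] under the zero map, which is empty. *)
  rewrite (_ : _ @^-1` _ = set0); last first.
    by apply/seteqP; split => x //=; rewrite ap !mul0r.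
  by rewrite [X in (X <= _)%E](@measure0 _ _ _ (expo (@ltr01 R))).
have [mZ PZ] := union_bound s mF PF.
exists (\big[setU/set0]_(p <- s) F p); split => //.
  by apply/eqP; rewrite eq_le measure_ge0 andbT; apply: le_trans PZ _; rewrite mulr0.
move=> w p nZ pg ap; apply: contrapT => h; apply: nZ.
have ps : p \in s by rewrite mem_filter ap.
by rewrite -bigcup_seq; exists p => //=; rewrite /F ps.
Qed.

Lemma measurable_LPP N : (0 < N)%N -> measurable_fun setT (fun w => LPP l b N (fun p => xi N p w)).
Proof.
move=> N0.
rewrite (_ : (fun w => _) = fun w => xi N (0, 0) w + lpp ((fun p => xi N (pt N p))^~ w) (mN l b N) (nN l b N)).
  apply: measurable_funD.
    rewrite (_ : (0, 0) = pt N (0, 0)%N); first by apply: mxi; apply: SN_pt; rewrite ?mem_grid.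
    by rewrite /lattice_pt /= addr0 subr0 mul0r.
  by apply: measurable_lpp => p p1 p2 _; apply: mxi; apply: SN_pt => //; rewrite mem_grid p1.
by apply/funext => w; rewrite (LPP_lpp bl N0).
Qed.

Lemma measurable_deviation N (delta : R) : (0 < N)%N ->
  measurable [set w | delta < `|LPP l b N (fun p => xi N p w) - Gstar|].
Proof.
move=> N0.
have mf : measurable_fun setT (fun w => `|LPP l b N (fun p => xi N p w) - Gstar|).
  apply: measurableT_comp => //; apply: measurable_funB => //; exact: measurable_LPP.
have := mf measurableT `]delta, +oo[%classic (measurable_itv _); rewrite setTI.
by congr measurable; apply/seteqP; split => w /=; rewrite in_itv/= andbT.
Qed.

Lemma deviation_bound (delta : R) : 0 < delta -> exists c C N0 : R, [/\ 0 < c, 0 < C &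
  forall N, (0 < N)%N -> N0 <= N%:R ->
  (P [set w | (delta < `|LPP l b N (fun p => xi N p w) - Gstar|)%R]
     <= (C * expR (- (c * N%:R)))%:E)%E].
Proof.
move=> delta0; have [eps [N0 [eps0 near]]] := lpp_near_sup l0 bl ca a0 delta0.
have [c [C [c0 C0 hrost]]] := rost eps0 l0.
(* The rate [eps] and the additional 1 come from the weight at the origin, whose exponential
   variable exceeds [eps * N] with probability [expR (- (eps * N))]. *)
exists (Num.min c eps), (C + 1), N0; split; [by rewrite lt_min c0|by rewrite addr_gt0|].
move=> N Np NN0; have NR : 0 < N%:R :> R by rewrite ltr0n.
set s := [seq p <- gridN N | 0 < alpha (pt N p)]; pose s2 := [seq p <- gridN N | ~~ (0 < alpha (pt N p))].
have us : uniq (s2 ++ s).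
  rewrite cat_uniq !filter_uniq ?grid_uniq//= andbT; apply/hasPn => p.
  by rewrite !mem_filter => /andP[-> _].
have [d' [T' [P' [phi [E [mphi hphi hE EE]]]]]] := iexp_extend (fun=> ltr01) us (iexp_active Np).
have {}hE : iexp P' (fun=> 1) E (gridN N).
  apply: iexp_sub us (grid_uniq _ _) _ (fun=> ltr01) hE => p pg.
  by rewrite mem_cat !mem_filter pg !andbT orNb.
have /andP[mle _] := mN_itv bl N; have /andP[nle _] := nN_itv bl N.
have [b1 b2] : b <= l /\ - b <= l.
  by split; apply/ltW; apply: le_lt_trans bl; rewrite ?ler_norm// -normrN ler_norm.
have [||Bad [mBad PBad good]] := hrost N (mN l b N) (nN l b N) d' T' P' E Np _ _ hE.
- by apply: le_trans mle _; rewrite mulrC ler_wpM2r//; lra.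
- by apply: le_trans nle _; rewrite mulrC ler_wpM2r//; lra.
have [Z [mZ PZ hZ]] := negligible_inactive Np.
have g00 : (0, 0)%N \in gridN N by rewrite mem_grid.
pose H := E (0, 0)%N @^-1` `]eps * N%:R, +oo[%classic.
have mH : measurable H.
  by rewrite -[X in measurable X]setTI; apply: hE.1 => //; exact: measurable_itv.
have PH : P' H = (expR (- (eps * N%:R)))%:E.
  have [_ /(_ (fun=> `]eps * N%:R, +oo[%classic))] : iexp P' (fun=> 1) E [:: (0, 0)%N].
    by apply: iexp_sub (grid_uniq _ _) _ _ (fun=> ltr01) hE => // p; rewrite inE => /eqP->.
  rewrite box_cons big_cons big_nil mulr1.
  have -> : box E (fun=> `]eps * N%:R, +oo[%classic) [::] = setT by apply/seteqP; split.
  rewrite setIT => -> //; rewrite -[exponential_prob _ _]/(expo (@ltr01 R) _) expo_tail /=.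
  by rewrite max_l ?mulN1r// mulr_ge0// ltW.
pose D := [set w | delta < `|LPP l b N (fun p => xi N p w) - Gstar|].
have mD : measurable D by exact: measurable_deviation.
have mphi' A : measurable A -> measurable (phi @^-1` A).
  by move=> mA; rewrite -[X in measurable X]setTI; exact: mphi.
(* On the extended space the deviation event is covered by the bad event, a large variable at the
   origin, and the null event of a nonzero weight at a site with [alpha = 0]. *)
have sub : phi @^-1` D `<=` (Bad `|` H) `|` phi @^-1` Z.
  move=> w Dw; apply: contrapT => /not_orP[/not_orP[nBad nH] nZ].
  have [E0 up low] := good w nBad.
  have xiE p : p \in gridN N -> xi N (pt N p) (phi w) = wt alpha N (E^~ w) p.
    move=> pg; rewrite /wt; case: (boolP (0 < alpha (pt N p))) => ap.
      by rewrite EE ?mem_filter ?ap//=; field; rewrite !gt_eqF.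
    rewrite (hZ _ _ nZ pg ap); have -> : alpha (pt N p) = 0.
      by apply/eqP; rewrite eq_le leNgt ap a0//; exact/(grid_Qrect bl).
    by rewrite !mul0r.
  have E00 : E (0, 0)%N w <= eps * N%:R.
    by rewrite leNgt; apply/negP => h; apply: nH; rewrite /H /= in_itv/= h.
  have := near N (E^~ w) Np NN0 E0 up low E00.
  rewrite -xiE//; have -> : lpp (wt alpha N (E^~ w)) (mN l b N) (nN l b N) =
      lpp ((fun p => xi N p (phi w)) \o pt N) (mN l b N) (nN l b N).
    by apply/eqP; rewrite eq_le !le_lpp// => p pg /=; rewrite xiE.
  have -> : pt N (0, 0)%N = (0, 0) by rewrite /lattice_pt /= addr0 subr0 mul0r.
  by rewrite -(LPP_lpp bl Np) leNgt; apply/negP; rewrite negbK.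
rewrite -/D -hphi//.
apply: (@le_trans _ _ (P' ((Bad `|` H) `|` phi @^-1` Z))).
  apply: le_measure => //; rewrite inE; first exact: mphi'.
  by apply: measurableU; [exact: measurableU|exact: mphi'].
apply: le_trans (measureU2 _ _ _) _; [exact: measurableU|exact: mphi'|].
rewrite [X in (_ + X)%E]hphi// PZ adde0.
apply: le_trans (measureU2 _ mBad mH) _.
apply: (@le_trans _ _ ((C * expR (- (c * N%:R)))%:E + (expR (- (eps * N%:R)))%:E)%E).
  by apply: leeD; [exact: PBad|move/eqP: PH; rewrite eq_le => /andP[]].
rewrite -EFinD lee_fin mulrDl mul1r; apply: lerD.
  by rewrite ler_pM2l// ler_expR lerN2 ler_pM2r// ge_min lexx.
by rewrite ler_expR lerN2 ler_pM2r// ge_min lexx orbT.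
Qed.

Lemma exponential_deviation (delta : R) : 0 < delta -> exists c C : R, 0 < c /\ 0 < C /\
  forall N, (0 < N)%N ->
  (P [set w | (delta < `|LPP l b N (fun p => xi N p w) - Gstar|)%R]
     < (C * expR (- (c * N%:R)))%:E)%E.
Proof.
move=> /deviation_bound[c [C [N0 [c0 C0 h]]]].
(* The last summand covers [N <= N0], where it alone makes the bound at least 1; the surplus makes
   the inequality strict. *)
exists c, (C + 1 + expR (c * `|N0|)); split => //; split; first by rewrite !addr_gt0// expR_gt0.
move=> N Np; have ex0 : 0 < expR (- (c * N%:R)) := expR_gt0 _.
have [NN0|/ltW NN0] := leP N0 N%:R.
  apply: le_lt_trans (h N Np NN0) _; rewrite lte_fin ltr_pM2r// -addrA ltrDl addr_gt0//.
  exact: expR_gt0.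
apply: le_lt_trans (probability_le1 _ _) _; first exact: measurable_deviation.
rewrite lte_fin mulrDl -expRD ltr_pwDl//; first by rewrite mulr_gt0// addr_gt0.
rewrite -[leLHS]expR0 ler_expR -mulrBr mulr_ge0 ?(ltW c0)// subr_ge0.
exact: le_trans NN0 (ler_norm _).
Qed.

(** Borel-Cantelli is applied for each tolerance [1 / (k + 1)]; the countably many almost sure
    events together give convergence. *)
Lemma LPP_cvg_ae : {ae P, forall w, (fun N => LPP l b N (fun p => xi N p w)) @ \oo --> Gstar}.
Proof.
have eventually k : {ae P, forall w, exists n, forall N, (n <= N)%N ->
    `|LPP l b N (fun p => xi N p w) - Gstar| <= k.+1%:R^-1}.
  have k0 : 0 < k.+1%:R^-1 :> R by rewrite invr_gt0 ltr0n.
  have [c [C [c0 [C0 hC]]]] := exponential_deviation k0.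
  (* Shifted by one, since the bound is stated for positive [N]. *)
  pose F n := [set w | k.+1%:R^-1 < `|LPP l b n.+1 (fun p => xi n.+1 p w) - Gstar|].
  have mF n : measurable (F n) by exact: measurable_deviation.
  exists (lim_sup_set F); split.
  - apply: bigcap_measurable => // n _; apply: bigcup_measurable => // m _; exact: mF.
  - apply: lim_sup_set_cvg0 => //.
    pose a := C * expR (- c).
    have z1 : `|expR (- c)| < 1 by rewrite ger0_norm ?expR_ge0// expR_lt1 oppr_lt0.
    apply: (@le_lt_trans _ _ (a * (1 - expR (- c))^-1)%:E); last exact: ltry.
    apply: lime_le; first by apply: is_cvg_nneseries => n _ _; exact: measure_ge0.
    apply: nearW => m.
    apply: (@le_trans _ _ (series (geometric a (expR (- c))) m)%:E); last first.
      rewrite lee_fin; apply: geometric_le_lim => //; last exact: expR_gt0.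
      by rewrite mulr_ge0 ?expR_ge0// ltW.
    rewrite /series /= -sumEFin; apply: lee_sum => n _; apply: ltW.
    apply: lt_le_trans (hC n.+1 isT) _.
    rewrite lee_fin /a -mulrA ler_pM2l// -expRM_natl -expRD ler_expR -natr1; lra.
  - move=> w /= hw; apply: contrapT => nw; apply: hw.
    have [n hn] : exists n, forall m, (n <= m)%N -> ~ F m w.
      apply: contrapT => h; apply: nw => n _; apply: contrapT => h'.
      by apply: h; exists n => m nm Fm; apply: h'; exists m.
    exists n.+1 => -[//|N] nN; rewrite leNgt; apply/negP; exact: (hn N).
have := ae_foralln eventually; apply: filterS => w hw; apply/cvgrPdist_le => eps eps0.
have [n hn] := hw (Num.truncn eps^-1).
exists n => // N /= nN; rewrite distrC; apply: le_trans (hn N nN) _.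
by rewrite invf_ple ?posrE// ltW// truncnS_gt.
Qed.

End concentration.

Unset Implicit Arguments.

Theorem theorem1 (d : measure_display) (T : measurableType d) (R : realType)
  (P : probability T R) (l b : R) (alpha : R * R -> R)
  (xi : nat -> R * R -> T -> R) :
  0 < l -> `|b| < l ->
  {within Qrect l b, continuous alpha} ->
  (forall p, Qrect l b p -> 0 <= alpha p) ->
  (forall N p, SN l b N p -> measurable_fun setT (xi N p)) ->
  (forall N p, (0 < N)%N -> SN l b N p ->
     distributed_as_scaled_exp P (xi N p) (alpha p / N%:R)) ->
  (forall N, (0 < N)%N -> mutually_independent P (SN l b N) (xi N)) ->
  let Gstar := sup [set calG l alpha y | y in Xset l b] in
  {ae P, forall w, (fun N => LPP l b N (fun p => xi N p w)) @ \oo --> Gstar}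
  /\ (forall delta : R, 0 < delta -> exists c C : R, 0 < c /\ 0 < C /\
       forall N : nat, (0 < N)%N ->
         (P [set w | (delta < `|LPP l b N (fun p => xi N p w) - Gstar|)%R]
           < (C * expR (- (c * N%:R)))%:E)%E).
Proof.
move=> l0 bl ca a0 mxi dxi ixi Gstar; split; first exact: LPP_cvg_ae.
by move=> delta delta0; exact: exponential_deviation.
Qed.
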